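(* Let $n\ge2$. Each equivalence class of compatible positive periodic flags in $H^n$ is an affine Tits building of type $\widetilde{A}_{n-1}$.
   Context: Setting. $H=H^n=L^2(S^1,\mathbb{C}^n)$, with $z=e^{i\theta}$ acting by multiplication. $H^+$ is the closed subspace of functions whose Fourier coefficients of negative index vanish, $H^{--}$ its orthogonal complement. $Gr^+(H)$ is the set of closed $W\subset H$ such that the orthogonal projection $W\to H^+$ is Fredholm and the orthogonal projection $W\to H^{--}$ is compact; $Gr^{n,+}=\{W\in Gr^+(H): zW\subset W\}$. Flags. A full positive periodic flag is a sequence $\{W_k\}_{k\in\mathbb{Z}}$ in $Gr^{n,+}$ with $W_{k+1}\subset W_k$, $\dim(W_k/W_{k+1})=1$, $zW_k=W_{k+n}$. A (partial) periodic flag is a sequence in $Gr^{n,+}$ with $W_{k+1}\subseteq W_k$ and $zW_k=W_{k+n}$, identified with its set of members. The flags, ordered by inclusion of sets of members, are the simplices of a simplicial complex whose vertices are the elementary flags $\{z^kW\}_{k\in\mathbb{Z}}$ and whose chambers are the full flags. Compatibility. Two flags $\{W_k\}$ and $\{W'_k\}$ are compatible if for every member $W_j$ of the first there are members $W'_{j'},W'_{l'}$ of the second with $W'_{j'}\subset W_j\subset W'_{l'}$, and vice versa. This is an equivalence relation. An equivalence class is regarded as a subcomplex of the complex above. Apartments. A (periodic) frame is a sequence of one-dimensional subspaces $\{U_k\}_{k\in\mathbb{Z}}$ of $H$ with $U_{k+n}=zU_k$ and closed span $H$; it is normal with respect to a full flag $\{W_k\}$ if $W_k=W_{k+1}\oplus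 U_k$ for all $k$. An admissible permutation is a bijection $\pi:\mathbb{Z}\to\mathbb{Z}$ with $\pi(k+n)=\pi(k)+n$; it sends $\{W_k\}$ to the flag whose $k$-th member is the closed span of $U_{\pi(l)}$, $l\ge k$, and acts correspondingly on the faces of $\{W_k\}$. The apartment of $(\{W_k\},\{U_k\})$, with $\{U_k\}$ normal with respect to $\{W_k\}$, consists of all images of faces of $\{W_k\}$ under admissible permutations. Building. A (Tits) building is a thick chamber complex with a system of thin subcomplexes (apartments) such that any two chambers lie in a common apartment, and for any two apartments $A,A'$ there is an isomorphism $A\to A'$ fixing $A\cap A'$.
   Formalization: The apartments of a class are those of pairs (full flag in the class, normal frame) whose apartment is contained in the class; for other normal frames the closed span of the U_l, l≥k, can be smaller than W_k and the apartment leaves the class. *)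

(* Defs.v *)
From HB Require Import structures.
From mathcomp Require Import all_boot all_order all_algebra.
From mathcomp Require Import generic_quotient ring_quotient.
From mathcomp Require Import all_classical all_reals all_analysis.
From mathcomp Require Import measurable_realfun complex ring lra.

Set Implicit Arguments.
Unset Strict Implicit.
Unset Printing Implicit Defensive.

Import Order.TTheory GRing.Theory Num.Theory.
Import numFieldNormedType.Exports.

Local Open Scope classical_set_scope.
Local Open Scope ring_scope.
Local Open Scope complex_scope.
Local Open Scope quotient_scope.


Section Circle.
Variable R : realType.
Local Notation T := (measurableTypeR R).
Local Notation C := R[i].

(* Functions on S^1 are functions of the angle theta in [0, 2 pi]: they are
   functions on R taken modulo equality almost everywhere for Lebesgue measure
   restricted to [0, 2 pi]. *)
Definition circle_measure : {measure set T -> \bar R} :=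
  mrestr (@lebesgue_measure R) (measurable_itv `[0, (2 * pi)%R]).
Local Notation mu := circle_measure.

(* e^{it} *)
Definition cis (t : R) : C := cos t +i* sin t.

Definition Cintegral (h : T -> C) : C :=
  (\int[mu]_x complex.Re (h x))%R +i* (\int[mu]_x complex.Im (h x))%R.

Definition Cintegrable (h : T -> C) :=
  mu.-integrable setT (EFin \o (fun x => complex.Re (h x))) /\
  mu.-integrable setT (EFin \o (fun x => complex.Im (h x))).

Definition CL2 (h : T -> C) : Prop :=
  (fun x => complex.Re (h x)) \in Lfun mu 2%:E /\
  (fun x => complex.Im (h x)) \in Lfun mu 2%:E.

Lemma Lfun2D (f g : T -> R) : f \in Lfun mu 2%:E -> g \in Lfun mu 2%:E ->
  (fun x => f x + g x) \in Lfun mu 2%:E.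
Proof.
move=> hf hg; have := (Lfun_submod_closed mu (lee1n 2)).2 1 _ _ hf hg.
by rewrite scale1r => h; exact: h.
Qed.

Lemma Lfun2Z (a : R) (f : T -> R) : f \in Lfun mu 2%:E ->
  (fun x => a * f x) \in Lfun mu 2%:E.
Proof.
have [h0 hD] := Lfun_submod_closed mu (lee1n 2).
move=> hf; have := hD a _ _ hf h0.
by rewrite addr0 => h; exact: h.
Qed.

Lemma Lfun2_bounded (h f : T -> R) : measurable_fun setT h ->
  (forall x, `|h x| <= 1) -> f \in Lfun mu 2%:E ->
  (fun x => h x * f x) \in Lfun mu 2%:E.
Proof.
move=> mh h1; rewrite inE => /andP[mf]; rewrite inE/= => lf.
move: mf; rewrite inE/= => mf.
have mhf : measurable_fun setT (fun x => h x * f x) by exact: measurable_funM.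
rewrite inE; apply/andP; split; rewrite inE//=.
apply: le_lt_trans lf; rewrite unlock.
have mp (g : T -> R) : measurable_fun setT g ->
  measurable_fun setT (fun x => (`|(EFin \o g) x| `^ 2)%E).
  move=> mg; apply/measurable_EFinP.
  apply/(@measurableT_comp _ _ _ _ _ _ (fun x : R => x `^ 2)%R) => //.
  exact/measurableT_comp.
rewrite gt0_ler_poweR//.
- by rewrite in_itv/= leey integral_ge0.
- by rewrite in_itv/= leey integral_ge0.
- apply: ge0_le_integral => //; try exact: mp.
    by move=> x _; rewrite /= lee_fin powR_ge0.
  move=> x _ /=; rewrite lee_fin; apply: ge0_ler_powR; rewrite ?nnegrE//.
  by rewrite normrM ler_piMl.
Qed.

Lemma CL2D (a : C) f g : CL2 f -> CL2 g -> CL2 (fun x => a * f x + g x).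
Proof.
case: a => a b [rf jf] [rg jg]; split.
  rewrite (_ : (fun _ => _) = fun x => (a * complex.Re (f x) +
    - b * complex.Im (f x)) + complex.Re (g x)).
    by apply: Lfun2D => //; apply: Lfun2D; exact: Lfun2Z.
  by apply/funext => x; case: (f x) (g x) => [u v] [u' v'] /=; rewrite mulNr.
rewrite (_ : (fun _ => _) = fun x => (a * complex.Im (f x) +
  b * complex.Re (f x)) + complex.Im (g x)).
  by apply: Lfun2D => //; apply: Lfun2D; exact: Lfun2Z.
by apply/funext => x; case: (f x) (g x) => [u v] [u' v'] /=.
Qed.

Lemma CL2_0 : CL2 (fun=> 0).
Proof. by have [h0 _] := Lfun_submod_closed mu (lee1n 2); split; exact: h0. Qed.

Lemma CL2_cis k f : CL2 f -> CL2 (fun x => cis (k * x) * f x).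
Proof.
have mk : measurable_fun setT (fun x : T => k * x) by exact: measurable_funM.
have mc : measurable_fun setT (fun x : T => cos (k * x)).
  by apply: (@measurableT_comp _ _ _ _ _ _ (@cos R)) => //;
    apply: continuous_measurable_fun; exact: continuous_cos.
have ms : measurable_fun setT (fun x : T => sin (k * x)).
  by apply: (@measurableT_comp _ _ _ _ _ _ (@sin R)) => //;
    apply: continuous_measurable_fun; exact: continuous_sin.
have c1 x : `|cos (k * x)| <= 1 by rewrite ler_norml cos_geN1 cos_le1.
have s1 x : `|sin (k * x)| <= 1 by rewrite ler_norml sin_geN1 sin_le1.
move=> [rf jf]; split.
  rewrite (_ : (fun _ => _) = fun x => cos (k * x) * complex.Re (f x) +
    -1 * (sin (k * x) * complex.Im (f x))).
    by apply: Lfun2D; rewrite ?Lfun2Z ?Lfun2_bounded.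
  by apply/funext => x; case: (f x) => [u v] /=; rewrite mulN1r.
rewrite (_ : (fun _ => _) = fun x => cos (k * x) * complex.Im (f x) +
  sin (k * x) * complex.Re (f x)).
  by apply: Lfun2D; exact: Lfun2_bounded.
by apply/funext => x; case: (f x) => [u v] /=.
Qed.

Lemma CL2_int f g : CL2 f -> CL2 g -> Cintegrable (fun x => f x * (g x)^*).
Proof.
have mM (u v : T -> R) : u \in Lfun mu 2%:E -> v \in Lfun mu 2%:E ->
    mu.-integrable setT (fun x => (u x * v x)%:E).
  by move=> hu hv; exact/Lfun1_integrable/Lfun2_mul_Lfun1.
move=> [rf jf] [rg jg]; split.
  rewrite (_ : _ \o _ = fun x =>
    (complex.Re (f x) * complex.Re (g x))%:E +
    (complex.Im (f x) * complex.Im (g x))%:E)%E.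
    by apply: integrableD => //; exact: mM.
  apply/funext => x /=; rewrite -EFinD.
  by case: (f x) (g x) => [u v] [u' v'] /=; rewrite mulrN opprK.
rewrite (_ : _ \o _ = fun x =>
  (complex.Im (f x) * complex.Re (g x))%:E -
  (complex.Re (f x) * complex.Im (g x))%:E)%E.
  by apply: integrableB => //; exact: mM.
apply/funext => x /=; rewrite -EFinB.
by case: (f x) (g x) => [u v] [u' v'] /=; rewrite mulrN addrC.
Qed.

Lemma eq_Cintegral_ae (f g : T -> C) : Cintegrable f -> Cintegrable g ->
  (\forall x \ae mu, f x = g x) -> Cintegral f = Cintegral g.
Proof.
move=> [rf jf] [rg jg] fg; rewrite /Cintegral; congr (_ +i* _).
  rewrite /Rintegral; congr fine; apply: ae_eq_integral => //.
  - by case/integrableP: rf.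
  - by case/integrableP: rg.
  - by apply: filterS fg => x /= ->.
rewrite /Rintegral; congr fine; apply: ae_eq_integral => //.
- by case/integrableP: jf.
- by case/integrableP: jg.
- by apply: filterS fg => x /= ->.
Qed.

Lemma CintegralD (a : C) f g : Cintegrable f -> Cintegrable g ->
  Cintegral (fun x => a * f x + g x) = a * Cintegral f + Cintegral g.
Proof.
case: a => a b [rf jf] [rg jg]; rewrite /Cintegral.
have iZ c (u : T -> R) : mu.-integrable setT (EFin \o u) ->
    mu.-integrable setT (EFin \o (fun x => c * u x)).
  by move=> hu; exact: (integrableZl measurableT c hu).
have -> : (fun x => complex.Re ((a +i* b) * f x + g x)) =
  fun x => (a * complex.Re (f x) + (- b) * complex.Im (f x)) + complex.Re (g x).
  by apply/funext => x; case: (f x) (g x) => [u v] [u' v'] /=; rewrite mulNr.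
have -> : (fun x => complex.Im ((a +i* b) * f x + g x)) =
  fun x => (a * complex.Im (f x) + b * complex.Re (f x)) + complex.Im (g x).
  by apply/funext => x; case: (f x) (g x) => [u v] [u' v'] /=.
have iD (u v : T -> R) : mu.-integrable setT (EFin \o u) ->
    mu.-integrable setT (EFin \o v) ->
    mu.-integrable setT (EFin \o (fun x => u x + v x)).
  by move=> hu hv; exact: (integrableD measurableT hu hv).
rewrite !RintegralD ?RintegralZl//; do ?[exact: iZ | exact: iD (iZ _ _ _) (iZ _ _ _)].
by rewrite mulNr.
Qed.

Lemma Cintegral_sqr_ge0 f : 0 <= Cintegral (fun x => f x * (f x)^*).
Proof.
rewrite /Cintegral lecE /=; apply/andP; split.
  rewrite (_ : (fun _ => _) = fun=> 0) ?Rintegral_cst ?mul0r//.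
  by apply/funext => x; case: (f x) => [a b] /=; rewrite mulrN mulrC addNr.
apply: Rintegral_ge0 => x _; case: (f x) => [a b] /=.
by rewrite mulrN opprK addr_ge0 // -expr2 sqr_ge0.
Qed.

Lemma Cintegral_sqr_eq0 f : CL2 f -> Cintegral (fun x => f x * (f x)^*) = 0 ->
  \forall x \ae mu, f x = 0.
Proof.
move=> hf; have [/[dup] ir /integrableP[mr lr] _] := CL2_int hf hf.
rewrite /Cintegral => -[/eqP + _].
set r := (fun x => complex.Re _) in mr lr ir *.
have r0 x : 0 <= r x.
  rewrite /r; case: (f x) => [a b] /=.
  by rewrite mulrN opprK addr_ge0 // -expr2 sqr_ge0.
rewrite /Rintegral fine_eq0; last exact: integrable_fin_num.
move=> /eqP i0.
have /(ae_eq_integral_abs _ measurableT mr) : (\int[mu]_(x in setT) `|(EFin \o r) x| = 0)%E.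
  by rewrite -[RHS]i0; apply: eq_integral => x _; rewrite gee0_abs// lee_fin.
apply: filterS => x /= /(_ I) [].
rewrite /r; case: (f x) => [a b] /= /eqP.
rewrite mulrN opprK paddr_eq0 -?expr2 ?sqr_ge0// !sqrf_eq0.
by move=> /andP[/eqP-> /eqP->].
Qed.

End Circle.

Section L2fun.
Variables (R : realType) (n : nat).
Local Notation T := (measurableTypeR R).
Local Notation C := R[i].
Local Notation mu := (circle_measure R).

Definition L2pred : {pred T -> 'rV[C]_n} :=
  fun f => `[< forall j, CL2 (fun x => f x 0 j) >].

Lemma L2pred_submod_closed : submod_closed L2pred.
Proof.
split=> [|a f g /asboolP hf /asboolP hg]; apply/asboolP => j.
  rewrite (_ : (fun _ => _) = fun=> 0); first exact: CL2_0.
  by apply/funext => x; rewrite mxE.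
rewrite (_ : (fun _ => _) = fun x => a * f x 0 j + g x 0 j); first exact: CL2D.
by apply/funext => x; rewrite !mxE.
Qed.

HB.instance Definition _ :=
  GRing.isSubmodClosed.Build _ _ L2pred L2pred_submod_closed.

Definition L2fun : Type := {f : T -> 'rV[C]_n | f \in L2pred}.
HB.instance Definition _ := SubChoice.on L2fun.
HB.instance Definition _ := [SubChoice_isSubLmodule of L2fun by <:].

Lemma L2funP (f : L2fun) j : CL2 (fun x => val f x 0 j).
Proof. by have /asboolP := valP f. Qed.

Definition L2null : {pred L2fun} := fun f => `[< \forall x \ae mu, val f x = 0 >].

Lemma L2null_zmod_closed : zmod_closed L2null.
Proof.
split=> [|f g /asboolP hf /asboolP hg]; apply/asboolP.
  by apply: aeW.
by apply: filterS2 hf hg => x /= fx gx; rewrite !fctE fx gx subr0.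
Qed.

HB.instance Definition _ :=
  GRing.isZmodClosed.Build _ L2null L2null_zmod_closed.

(* L^2(S^1, C^n) *)
Definition L2 : Type := Quotient.quot L2null.
HB.instance Definition _ := GRing.Zmodule.on L2.
HB.instance Definition _ := EqQuotient.on L2.


Lemma L2_eqP (f g : L2fun) :
  \pi_L2 f = \pi_L2 g <-> \forall x \ae mu, val f x = val g x.
Proof.
split=> [/eqP|fg].
  rewrite -[_ == _]Quotient.idealrBE => /asboolP.
  by apply: filterS => x /=; rewrite !fctE => /eqP; rewrite subr_eq0 => /eqP.
apply/eqP; rewrite -[_ == _]Quotient.idealrBE; apply/asboolP.
by apply: filterS fg => x /= e; rewrite !fctE e subrr.
Qed.


Lemma L2_piD (f g : L2fun) : \pi_L2 (f + g) = \pi_L2 f + \pi_L2 g.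
Proof. exact: (@Quotient.pi_add _ L2null). Qed.

Lemma L2_pi0 : \pi_L2 0 = 0.
Proof. by apply: (@addIr _ (\pi_L2 0)); rewrite -L2_piD !add0r. Qed.

Lemma L2P (f : L2) : exists g, f = \pi_L2 g.
Proof. by exists (repr f); rewrite reprK. Qed.

Definition L2scale (a : C) (f : L2) : L2 := \pi_L2 (a *: repr f).

Lemma L2scaleE a (f : L2fun) : L2scale a (\pi_L2 f) = \pi_L2 (a *: f).
Proof.
have /L2_eqP ef : \pi_L2 (repr (\pi_L2 f)) = \pi_L2 f by rewrite reprK.
by apply/L2_eqP; apply: filterS ef => x /= e; rewrite !fctE e.
Qed.

Fact L2scaleA a b f : L2scale a (L2scale b f) = L2scale (a * b) f.
Proof. by have [g ->] := L2P f; rewrite !L2scaleE scalerA. Qed.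
Fact L2scale1 : left_id 1 L2scale.
Proof. by move=> f; have [g ->] := L2P f; rewrite L2scaleE scale1r. Qed.
Fact L2scaleDr : right_distributive L2scale +%R.
Proof.
move=> a f g; have [f' ->] := L2P f; have [g' ->] := L2P g.
by rewrite -L2_piD !L2scaleE scalerDr L2_piD.
Qed.
Fact L2scaleDl f : {morph L2scale^~ f : a b / a + b}.
Proof. by move=> a b; have [g ->] := L2P f; rewrite !L2scaleE scalerDl L2_piD. Qed.

HB.instance Definition _ := GRing.Zmodule_isLmodule.Build C L2
  L2scaleA L2scale1 L2scaleDr L2scaleDl.

(* linear in f, and not divided by the total mass 2 pi *)
Definition inner (f g : L2) : C :=
  \sum_j Cintegral (fun x => val (repr f) x 0 j * (val (repr g) x 0 j)^*).

Lemma innerE (f g : L2fun) : inner (\pi_L2 f) (\pi_L2 g) =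
  \sum_j Cintegral (fun x => val f x 0 j * (val g x 0 j)^*).
Proof.
have /L2_eqP ef : \pi_L2 (repr (\pi_L2 f)) = \pi_L2 f by rewrite reprK.
have /L2_eqP eg : \pi_L2 (repr (\pi_L2 g)) = \pi_L2 g by rewrite reprK.
apply: eq_bigr => j _; apply: eq_Cintegral_ae.
- exact: CL2_int (L2funP _ _) (L2funP _ _).
- exact: CL2_int (L2funP _ _) (L2funP _ _).
- by apply: filterS2 ef eg => x /= -> ->.
Qed.

Lemma innerDl a f g h : inner (a *: f + g) h = a * inner f h + inner g h.
Proof.
have [f' ->] := L2P f; have [g' ->] := L2P g; have [h' ->] := L2P h.
rewrite -[a *: _]/(L2scale a _) L2scaleE -L2_piD.
rewrite !innerE mulr_sumr -big_split; apply: eq_bigr => j _ /=.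
rewrite -CintegralD; try exact: CL2_int (L2funP _ _) (L2funP _ _).
by congr Cintegral; apply/funext => x; rewrite !mxE mulrDl mulrA.
Qed.

Lemma innerC f g : inner g f = (inner f g)^*.
Proof.
rewrite /inner rmorph_sum; apply: eq_bigr => j _.
rewrite /Cintegral /=; congr (_ +i* _).
  congr Rintegral; apply/funext => x.
  case: (val (repr f) x 0 j) (val (repr g) x 0 j) => [a b] [c d] /=.
  by rewrite !mulrN !opprK mulrC [b * _]mulrC.
have [hr hi] := CL2_int (L2funP (repr f) j) (L2funP (repr g) j).
rewrite -mulN1r -RintegralZl//; congr Rintegral; apply/funext => x.
case: (val (repr f) x 0 j) (val (repr g) x 0 j) => [a b] [c d] /=.
by rewrite !mulrN mulN1r opprD opprK addrC mulrC [b * _]mulrC.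
Qed.


Lemma inner_ge0 f : 0 <= inner f f.
Proof. by apply: sumr_ge0 => j _; exact: Cintegral_sqr_ge0. Qed.

Lemma inner_eq0 f : inner f f = 0 -> f = 0.
Proof.
have [g ->] := L2P f; rewrite innerE => /eqP.
rewrite psumr_eq0 => [|j _]; last exact: Cintegral_sqr_ge0.
move=> /allP g0; rewrite -L2_pi0; apply/L2_eqP.
have : \forall x \ae mu, forall j, val g x 0 j = 0.
  apply: filter_forall => j; apply: Cintegral_sqr_eq0; first exact: L2funP.
  exact/eqP/g0/mem_index_enum.
by apply: filterS => x /= gx; apply/rowP => j; rewrite gx mxE.
Qed.

Definition L2norm (f : L2) : C := (Num.sqrt (complex.Re (inner f f)))%:C.

Let ReinnerDl a f g h : complex.Re (inner (a%:C *: f + g) h) =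
  a * complex.Re (inner f h) + complex.Re (inner g h).
Proof.
by rewrite innerDl; case: (inner f h) (inner g h) => [u v] [u' v'] /=; rewrite mul0r subr0.
Qed.

Let ReinnerC f g : complex.Re (inner f g) = complex.Re (inner g f).
Proof. by rewrite innerC; case: (inner g f). Qed.

Let Reinner_ge0 f : 0 <= complex.Re (inner f f).
Proof. by have := inner_ge0 f; rewrite lecE => /andP[]. Qed.

Fact L2norm_eq0 f : L2norm f = 0 -> f = 0.
Proof.
move=> [] /eqP; rewrite sqrtr_eq0 => h; apply: inner_eq0.
have := inner_ge0 f; rewrite lecE => /andP[/eqP].
case: (inner f f) h => a b /= a0 -> a1.
by congr (_ +i* _); apply/eqP; rewrite eq_le a0.
Qed.

Fact L2normZ a f : L2norm (a *: f) = `|a| * L2norm f.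
Proof.
have ipZl b u v : inner (b *: u) v = b * inner u v.
  have inner0 : inner 0 v = 0.
    by have := innerDl 1 0 0 v; rewrite scale1r addr0 mul1r -[LHS]addr0 => /addrI.
  by rewrite -[b *: u]addr0 innerDl inner0 addr0.
rewrite /L2norm ipZl [inner f (a *: f)]innerC ipZl rmorphM /= -innerC mulrA.
case: a => a b; rewrite -[`|_|]/((Num.sqrt (a ^+ 2 + b ^+ 2))%:C).
have := Reinner_ge0 f; case: (inner f f) => u v /= u0.
rewrite -(rmorphM (real_complex R)) -sqrtrM ?addr_ge0 ?sqr_ge0//=; congr (Num.sqrt _)%:C.
by rewrite !mulrN opprK [b * a]mulrC addNr mul0r subr0 !expr2.
Qed.

Fact L2normD f g : L2norm (f + g) <= L2norm f + L2norm g.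
Proof.
rewrite /L2norm -rmorphD lecR.
set b := fun u v => complex.Re (inner u v).
rewrite -![complex.Re _]/(b _ _).
have bDl a u v w : b (a%:C *: u + v) w = a * b u w + b v w by exact: ReinnerDl.
have bC u v : b u v = b v u by exact: ReinnerC.
have b0 u : 0 <= b u u by exact: Reinner_ge0.
have b0l v : b 0 v = 0.
  by have := bDl 1 0 0 v; rewrite scaler0 addr0 mul1r -[LHS]addr0 => /addrI.
have bZ a u v : b (a%:C *: u) v = a * b u v.
  by rewrite -[_ *: _]addr0 bDl b0l addr0.
have bA u v w : b (u + v) w = b u w + b v w.
  by have := bDl 1 u v w; rewrite scale1r mul1r.
have bN0 u v : Num.sqrt (b u u) = 0 -> b u v = 0.
  by move=> h; rewrite (_ : u = 0) ?b0l//; apply: L2norm_eq0; rewrite /L2norm -/(b u u) h.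
have bD u v : b (u + v) (u + v) = b u u + 2 * b u v + b v v.
  by rewrite bA (bC u) (bC v) !bA (bC v u); ring.
have s0 := sqrtr_ge0 (b f f); have t0 := sqrtr_ge0 (b g g).
have ss := sqr_sqrtr (b0 f); have tt := sqr_sqrtr (b0 g).
have CS : b f g <= Num.sqrt (b f f) * Num.sqrt (b g g).
  have [/bN0 ->|sN0] := eqVneq (Num.sqrt (b f f)) 0; first by rewrite mulr_ge0.
  have [/bN0 h|tN0] := eqVneq (Num.sqrt (b g g)) 0; first by rewrite bC h mulr_ge0.
  set s := Num.sqrt (b f f) in s0 sN0 ss *; set t := Num.sqrt (b g g) in t0 tN0 tt *.
  have st : 0 < s * t by rewrite mulr_gt0// lt_def ?sN0 ?tN0.
  have := b0 (t%:C *: f + (- s)%:C *: g).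
  rewrite bD !bZ ![b _ (_ *: _)]bC !bZ (bC g f) -ss -tt.
  rewrite (_ : _ + _ = 2 * (s * t) * (s * t - b f g)); last by ring.
  by rewrite pmulr_rge0 ?subr_ge0// mulr_gt0.
rewrite -(@ler_pXn2r _ 2) ?nnegrE ?addr_ge0 ?sqrtr_ge0//.
rewrite sqr_sqrtr ?b0// bD sqrrD ss tt.
by rewrite lerD2r lerD2l mulr2n mulrDl mul1r lerD.
Qed.

HB.instance Definition _ :=
  Lmodule_isNormed.Build C L2 L2normD L2normZ L2norm_eq0.


Let L2shift_pred k (f : L2fun) :
  (fun x => cis (k * x) *: val f x) \in L2pred.
Proof.
apply/asboolP => j; rewrite (_ : (fun _ => _) = fun x => cis (k * x) * val f x 0 j).
  exact/CL2_cis/L2funP.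
by apply/funext => x; rewrite mxE.
Qed.

(* multiplication by z^k, where z = e^{i theta} *)
Definition zpow (k : int) (f : L2) : L2 :=
  \pi_L2 (exist (fun h => h \in L2pred) _ (L2shift_pred k%:~R (repr f))).

(* the component along e_j of the Fourier coefficient of index k *)
Definition fourier (f : L2) (k : int) (j : 'I_n) : C :=
  ((2 * pi)^-1)%:C *
  Cintegral (fun x => val (repr f) x 0 j * cis (- (k%:~R * x))).

End L2fun.

Section LinearAlgebra.
Variables (K : fieldType) (V : lmodType K).
Implicit Types A B W : set V.

Definition subspace W := submod_closed [in W].

(* dim (A / B) = d: some family b_0, ..., b_(d-1) in A induces a basis *)
Definition quotient_dim A B (d : nat) :=
  exists b : 'I_d -> V,
    [/\ forall i, A (b i),
        forall v, A v -> exists c : 'I_d -> K, B (v - \sum_i c i *: b i) &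
        forall c : 'I_d -> K, B (\sum_i c i *: b i) -> forall i, c i = 0].

Definition direct_sum W A B :=
  W = [set a + b | a in A & b in B] /\ A `&` B = [set 0].

End LinearAlgebra.

Section Grassmannian.
Variables (R : realType) (n : nat).
Local Notation H := (L2 R n).
Implicit Types (W A B : set H) (T : H -> H).

Definition closed_subspace W := subspace W /\ closed W.

Definition closed_span A : set H := smallest closed_subspace A.

Definition orthocomplement A : set H :=
  [set f | forall g, A g -> inner f g = 0].

Definition orth_proj A (f : H) : H :=
  xget 0 [set g | A g /\ orthocomplement A (f - g)].

Definition Hplus : set H := [set f | forall k j, k < 0 -> fourier f k j = 0].

Definition Hminus : set H := orthocomplement Hplus.

(* The range of a bounded operator with finite-dimensional cokernel is
   automatically closed. *)
Definition fredholm T A B :=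
  (exists d, quotient_dim (A `&` T @^-1` [set 0]) [set 0] d) /\
  (exists d, quotient_dim B (T @` A) d).

Definition compact_operator T A :=
  precompact (T @` (A `&` [set f | `|f| <= 1])).

(* Gr^+(H) *)
Definition Gr_plus : set (set H) :=
  [set W | [/\ closed_subspace W, fredholm (orth_proj Hplus) W Hplus &
               compact_operator (orth_proj Hminus) W]].

(* Gr^{n,+} *)
Definition Gr_nplus : set (set H) :=
  [set W | Gr_plus W /\ zpow 1 @` W `<=` W].

End Grassmannian.
Arguments Hplus {R n}.
Arguments Hminus {R n}.

Section Complexes.
Variable V : Type.
Implicit Types (D A : set (set V)) (c d s : set V).

(* Abstract simplicial complexes, without the empty simplex. The vertices of D
   are the v such that D [set v]. *)
Definition simplicial_complex D :=
  forall s, D s -> [/\ finite_set s, s !=set0 &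
    forall t, t `<=` s -> t !=set0 -> D t].

Definition chamber D c := D c /\ forall s, D s -> c `<=` s -> s = c.

Definition adjacent c d := exists x y, [/\ c x, d y & c `\ x = d `\ y].

Definition gallery D c d :=
  exists m (g : nat -> set V), [/\ g 0 = c, g m = d,
    forall i, (i <= m)%N -> chamber D (g i) &
    forall i, (i < m)%N -> adjacent (g i) (g i.+1)].

Definition chamber_complex D :=
  [/\ simplicial_complex D,
      forall s, D s -> exists2 c, chamber D c & s `<=` c,
      exists d : nat, forall c, chamber D c -> (c #= `I_d)%card &
      forall c d, chamber D c -> chamber D d -> gallery D c d].

(* the faces of codimension one of the chambers *)
Definition panel D s := exists c x, [/\ chamber D c, c x & s = c `\ x].

Definition thick D := forall s, panel D s ->
  exists c1 c2 c3, [/\ c1 <> c2, c1 <> c3, c2 <> c3 &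
    [/\ chamber D c1, chamber D c2, chamber D c3 &
        [/\ s `<=` c1, s `<=` c2 & s `<=` c3]]].

Definition thin D := forall s, panel D s ->
  exists c1 c2, c1 <> c2 /\
    forall c, chamber D c /\ s `<=` c <-> c = c1 \/ c = c2.

End Complexes.

Definition complex_iso (V V' : Type) (D : set (set V)) (D' : set (set V'))
    (f : V -> V') :=
  (forall v w, D [set v] -> D [set w] -> f v = f w -> v = w) /\
  [set f @` s | s in D] = D'.

Definition building (V : Type) (D : set (set V)) (apts : set (set (set V))) :=
  [/\ chamber_complex D /\ thick D,
      forall A, apts A ->
        [/\ A `<=` D, chamber_complex A, thin A & chamber A `<=` chamber D],
      forall c d, chamber D c -> chamber D d ->
        exists A, [/\ apts A, A c & A d] &
      forall A A', apts A -> apts A' -> exists f, complex_iso A A' f /\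
        forall v, A [set v] -> A' [set v] -> f v = v].

Section Coxeter.
Variables (n : nat) (m : 'I_n -> 'I_n -> nat).

(* Equality in the Coxeter group <s_i | (s_i s_j)^(m i j) = 1> of two words in
   the generators. The value m i j = 0 stands for infinity (the relation below
   is then trivial). *)
Inductive coxeter_eq : seq 'I_n -> seq 'I_n -> Prop :=
| coxeter_refl w : coxeter_eq w w
| coxeter_sym w w' : coxeter_eq w w' -> coxeter_eq w' w
| coxeter_trans w w' w'' :
    coxeter_eq w w' -> coxeter_eq w' w'' -> coxeter_eq w w''
| coxeter_rel u v i j :
    coxeter_eq (u ++ flatten (nseq (m i j) [:: i; j]) ++ v) (u ++ v).

(* the coset of w modulo the maximal standard parabolic subgroup generated by
   the s_j with j != i, as a set of words *)
Definition coxeter_vertex (w : seq 'I_n) (i : 'I_n) : set (seq 'I_n) :=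
  [set v | exists2 u, all (predC1 i) u & coxeter_eq (w ++ u) v].

Definition coxeter_complex : set (set (set (seq 'I_n))) :=
  [set s | exists w (J : set 'I_n),
     J !=set0 /\ s = [set coxeter_vertex w i | i in J]].

Definition building_of_type (V : Type) (D : set (set V))
    (apts : set (set (set V))) :=
  building D apts /\
  forall A, apts A -> exists f, complex_iso coxeter_complex A f.

End Coxeter.

(* the Coxeter matrix of type A~_(n-1), for n >= 2 *)
Definition affineA_matrix (n : nat) (i j : 'I_n) : nat :=
  if i == j then 1%N else
  if n == 2 then 0%N else
  if (i.+1 %% n == j)%N || (j.+1 %% n == i)%N then 3 else 2.

Section Flags.
Variables (R : realType) (n : nat).
Local Notation H := (L2 R n).
Implicit Types (W U : int -> set H) (S E : set (set H)) (p : int -> int).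

Definition periodic_flag W :=
  [/\ forall k, Gr_nplus (W k), forall k, W (k + 1) `<=` W k &
      forall k, zpow 1 @` W k = W (k + n%:Z)].

Definition full_flag W :=
  periodic_flag W /\ forall k, quotient_dim (W k) (W (k + 1)) 1.

(* a flag is identified with its set of members *)
Definition flag S := exists2 W, periodic_flag W & S = range W.

Definition compatible S S' :=
  (forall A, S A -> (exists2 B, S' B & B `<=` A) /\
                    (exists2 B, S' B & A `<=` B)) /\
  (forall A, S' A -> (exists2 B, S B & B `<=` A) /\
                     (exists2 B, S B & A `<=` B)).

Definition compatibility_class (F : set (set (set H))) :=
  exists2 S, flag S & F = [set S' | flag S' /\ compatible S S'].

Definition elementary E :=
  exists2 W, Gr_nplus W & E = [set zpow k @` W | k in [set: int]].

(* the simplex defined by a flag: its vertices are the elementary flags among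
   its faces *)
Definition flag_simplex S : set (set (set H)) :=
  [set E | elementary E /\ E `<=` S].

Definition flag_complex (F : set (set (set H))) :
    set (set (set (set H))) := flag_simplex @` F.

Definition frame U :=
  [/\ forall k, subspace (U k) /\ quotient_dim (U k) [set 0] 1,
      forall k, U (k + n%:Z) = zpow 1 @` U k &
      closed_span (\bigcup_k U k) = setT].

Definition normal_frame W U :=
  forall k, direct_sum (W k) (W (k + 1)) (U k).

Definition admissible p :=
  bijective p /\ forall k, p (k + n%:Z) = p k + n%:Z.

Definition permuted_member U p (k : int) : set H :=
  closed_span (\bigcup_(l in [set l | k <= l]) U (p l)).

(* all the images of the faces of W under the admissible permutations *)
Definition apartment W U : set (set (set H)) :=
  [set S' | exists p S, [/\ admissible p, flag S, S `<=` range W &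
     S' = permuted_member U p @` [set k | S (W k)]]].

(* The apartments of the class F. An apartment of F has to be a subcomplex of
   F: this excludes the normal frames such that the closed span of the U_l,
   l >= k, is smaller than W_k (for n = 1, W_k = z^k H^+ and
   U_k = C z^k (z - 1/2), it is (z - 1/2) z^k H^+). *)
Definition apartments (F : set (set (set H))) :
    set (set (set (set (set H)))) :=
  [set A | exists W U, [/\ full_flag W /\ F (range W),
     frame U /\ normal_frame W U, apartment W U `<=` F &
     A = flag_complex (apartment W U)]].

End Flags.

(* Main.v *)
Require Import Defs.
From mathcomp Require Import all_boot all_order all_algebra.
From mathcomp Require Import generic_quotient ring_quotient.
From mathcomp Require Import all_classical all_reals all_analysis.
From mathcomp Require Import measurable_realfun complex ring lra zify.
Require Import Defs.

Set Implicit Arguments.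
Unset Strict Implicit.
Unset Printing Implicit Defensive.

Import Order.TTheory GRing.Theory Num.Theory.
Import numFieldNormedType.Exports.

Local Open Scope classical_set_scope.
Local Open Scope ring_scope.
Local Open Scope complex_scope.
Local Open Scope quotient_scope.

(** Let [L0] be a member of a flag of the class. The members of the flags of the
    class are the z-stable subspaces of [H] which lie between two translates
    [z^N L0] and [z^-N L0]; they are called lattices ([class_lattice]).
    Multiplication by z has codimension [n] on a lattice, by an index computation
    ([Gr_qd]). So a lattice has an integer type, its codimension relative to
    [L0], which z increases by [n], and between two nested lattices there is a
    lattice of each intermediate type, because z is nilpotent on their quotient
    ([lattice_interpolating]). Hence every flag refines to a full one, and the
    chambers are the chains with one lattice of each type. From here on the
    situation resembles that of lattice chains over a field of Laurent series,
    except that [H] is not complete for the filtration by a chain, so that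
    bases have to be controlled through closed spans.

    An apartment comes from a basis: vectors [u k] with [u (k + n) = z u k] and a
    chain [V] such that [u k] has order exactly [k] and [V k] is the closed span
    of the [u l], [l >= k]. Its lattices are the closed spans of the [u a], [a]
    in [X], for the sets [X] of integers which are stable under adding [n],
    bounded below and contain a half-line; [X] is the set of orders of the
    elements of the lattice ([spn_head]). So an apartment is the complex of
    chains of such sets, and its chambers are the images of [V] under the
    permutations of the affine symmetric group ([tchain_perm]). Sorting a
    permutation by exchanging neighbours solves the word problem of that group
    ([coxeter_complete]); it gives the galleries and the isomorphism with the
    Coxeter complex ([coxeter_iso]). A panel leaves two choices for the missing
    index set ([apartment_thin]), but a projective line of choices for the
    missing lattice ([lattice_thick]).

    Two chains [V] and [V'] lie in one apartment ([common_apartment]). The first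
    one has an orthogonal basis ([basis_exists]). Its closed spans are large
    enough because a family [z^k v_i], [i < n], of orthogonal nonzero vectors is
    total ([shift_total]): its values at almost every point form an orthogonal
    basis of [C^n], since Fourier coefficients determine an integrable function
    ([fourier_unique]). Then the [n] vectors are modified one at a time so that
    each one realizes the relative position of [V] and [V']. A modification only
    adds to [v r] a finite combination of the other vectors, so that the closed
    spans do not change ([basis_approach], [basis_replace]).

    For two apartments, take a maximal chain of common lattices and complete it
    to a chamber of each. Sending a lattice to the one with the same index set
    relative to these chambers is an isomorphism, and a common lattice has the
    same index set in both apartments ([aligned]). *)

(** * Subspaces and dimensions of quotients *)

Section Subspaces.
Variables (K : fieldType) (V : lmodType K).
Implicit Types A B M : set V.

Lemma subspaceP A :
  subspace A <-> A 0 /\ forall a u v, A u -> A v -> A (a *: u + v).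
Proof.
split=> -[h0 hD]; split.
- by move: h0; rewrite inE.
- by move=> a u v Au Av; have := hD a u v; rewrite !inE; exact.
- by rewrite inE.
- by move=> a u v; rewrite !inE; exact: hD.
Qed.

Lemma sub0 A : subspace A -> A 0.
Proof. by case/subspaceP. Qed.

Lemma subZD A a u v : subspace A -> A u -> A v -> A (a *: u + v).
Proof. by case/subspaceP=> _; exact. Qed.

Lemma subZ A a u : subspace A -> A u -> A (a *: u).
Proof. by move=> sA Au; rewrite -[_ *: _]addr0; apply: subZD => //; exact: sub0. Qed.

Lemma subD A u v : subspace A -> A u -> A v -> A (u + v).
Proof. by move=> sA Au Av; rewrite -[u]scale1r; exact: subZD. Qed.

Lemma subN A u : subspace A -> A u -> A (- u).
Proof. by move=> sA Au; rewrite -scaleN1r; exact: subZ. Qed.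

Lemma subB A u v : subspace A -> A u -> A v -> A (u - v).
Proof. by move=> sA Au Av; apply: subD => //; exact: subN. Qed.

Lemma sub_sum A I (r : seq I) (P : pred I) (E : I -> V) : subspace A ->
  (forall i, P i -> A (E i)) -> A (\sum_(i <- r | P i) E i).
Proof.
move=> sA AE; elim/big_ind: _ => //; first exact: sub0.
by move=> u v; exact: subD.
Qed.

Lemma subDl A u v : subspace A -> A v -> A (u + v) -> A u.
Proof. by move=> sA Av /subB - /(_ _ sA Av); rewrite addrK. Qed.

Lemma subspaceI A B : subspace A -> subspace B -> subspace (A `&` B).
Proof.
move=> sA sB; apply/subspaceP; split; first by split; exact: sub0.
by move=> a u v [Au Bu] [Av Bv]; split; exact: subZD.
Qed.

Lemma subspace0 : subspace [set 0 : V].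
Proof. by apply/subspaceP; split=> // a u v -> ->; rewrite scaler0 addr0. Qed.

Definition sumset A B : set V := [set a + b | a in A & b in B].

Lemma sumsetP A B v : sumset A B v <-> exists a b, [/\ A a, B b & v = a + b].
Proof.
split=> [[a Aa [b Bb <-]]|[a [b [Aa Bb ->]]]]; first by exists a, b.
by exists a => //; exists b.
Qed.

Lemma subspace_sum A B : subspace A -> subspace B -> subspace (sumset A B).
Proof.
move=> sA sB; apply/subspaceP; split.
  by apply/sumsetP; exists 0, 0; rewrite addr0; split=> //; exact: sub0.
move=> a u v /sumsetP[u1 [u2 [A1 B1 ->]]] /sumsetP[v1 [v2 [A2 B2 ->]]].
apply/sumsetP; exists (a *: u1 + v1), (a *: u2 + v2); split; try exact: subZD.
by rewrite scalerDr addrACA.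
Qed.

Lemma sumset_ge_l A B : subspace B -> A `<=` sumset A B.
Proof.
by move=> sB a Aa; apply/sumsetP; exists a, 0; rewrite addr0; split=> //; exact: sub0.
Qed.

Lemma sumset_ge_r A B : subspace A -> B `<=` sumset A B.
Proof.
by move=> sA a Aa; apply/sumsetP; exists 0, a; rewrite add0r; split=> //; exact: sub0.
Qed.

Lemma sumset_le A B M : subspace M -> A `<=` M -> B `<=` M -> sumset A B `<=` M.
Proof.
by move=> sM AM BM v /sumsetP[a [b [/AM Ma /BM Mb ->]]]; exact: subD.
Qed.

Definition independent A B q (b : 'I_q -> V) :=
  (forall i, A (b i)) /\
  (forall c : 'I_q -> K, B (\sum_i c i *: b i) -> forall i, c i = 0).

(** The coordinates of more than [p] vectors on [p] generators form a matrix with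
    a nonzero left kernel, hence give a nontrivial relation modulo [B]. *)
Lemma qd_le A B p q (b : 'I_q -> V) : subspace B -> quotient_dim A B p ->
  independent A B b -> (q <= p)%N.
Proof.
move=> sB [a [Aa gen _]] [Ab ind]; rewrite leqNgt; apply/negP => pq.
have /choice[m hm] : forall j, exists c : 'I_p -> K, B (b j - \sum_i c i *: a i).
  by move=> j; exact: gen.
pose M : 'M[K]_(q, p) := \matrix_(j, i) m j i.
have /rowV0Pn[c /sub_kermxP cM c0] : kermx M != 0.
  rewrite -mxrank_eq0 mxrank_ker subn_eq0 -ltnNge.
  exact: leq_ltn_trans (rank_leq_col M) pq.
have h : B (\sum_j c 0 j *: b j).
  rewrite (_ : \sum_j _ = \sum_j c 0 j *: (b j - \sum_i m j i *: a i)).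
    by apply: sub_sum => // j _; exact: subZ.
  under [RHS]eq_bigr do rewrite scalerBr scaler_sumr.
  rewrite sumrB exchange_big /= [X in _ - X]big1 ?subr0// => i _.
  under eq_bigr do rewrite scalerA.
  rewrite -scaler_suml.
  have /rowP/(_ i) := cM; rewrite !mxE => E.
  rewrite (_ : \sum_i0 _ = 0) ?scale0r// -[RHS]E.
  by apply: eq_bigr => j _; rewrite mxE.
by move/eqP: c0; apply; apply/rowP => j; rewrite mxE; exact: ind h j.
Qed.

Lemma qd_uniq A B p q : subspace B ->
  quotient_dim A B p -> quotient_dim A B q -> p = q.
Proof.
move=> sB hp hq; apply/eqP; rewrite eqn_leq; apply/andP; split.
  by case: (hp) => b [Ab _ ind]; apply: (qd_le sB hq (b := b)).
by case: (hq) => b [Ab _ ind]; apply: (qd_le sB hp (b := b)).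
Qed.

Definition fam_cons q (v : V) (b : 'I_q -> V) (i : 'I_q.+1) : V :=
  if unlift ord0 i is Some j then b j else v.

Lemma sum_fam_cons q v (b : 'I_q -> V) (c : 'I_q.+1 -> K) :
  \sum_i c i *: fam_cons v b i =
  c ord0 *: v + \sum_i c (lift ord0 i) *: b i.
Proof.
rewrite big_ord_recl /fam_cons unlift_none; congr (_ + _).
by apply: eq_bigr => i _; rewrite liftK.
Qed.

(** A maximal independent family generates. *)
Lemma qd_bounded A B p : subspace B ->
  (forall q (b : 'I_q -> V), independent A B b -> (q <= p)%N) ->
  exists q, quotient_dim A B q.
Proof.
move=> sB bnd.
pose P q := `[< exists b : 'I_q -> V, independent A B b >].
have exP : exists q, P q.
  exists 0%N; apply/asboolP; exists (fun=> 0); split; by [case|move=> ? ? []].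
have leP q : P q -> (q <= p)%N by move=> /asboolP[b]; exact: bnd.
case: (ex_maxnP exP leP) => q /asboolP[b [Ab ind]] qmax.
exists q, b; split=> // v Av.
have : ~ independent A B (fam_cons v b).
  move=> h; have := qmax q.+1; rewrite ltnn => /(_ _)/wrap[]//.
  by apply/asboolP; exists (fam_cons v b).
move=> /not_andP[[]|].
  by move=> i; rewrite /fam_cons; case: (unlift _ _).
move=> /existsNP[c] /not_implyP[]; rewrite sum_fam_cons => Bc /existsNP[i ci].
have c0 : c ord0 != 0.
  apply/eqP => c0; move: Bc; rewrite c0 scale0r add0r => /ind h.
  by apply: ci; case: (unliftP ord0 i) => [j|] ->.
exists (fun i => - ((c ord0)^-1 * c (lift ord0 i))).
rewrite (_ : _ - _ = (c ord0)^-1 *: (c ord0 *: v + \sum_i c (lift ord0 i) *: b i)).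
  exact: subZ.
rewrite scalerDr scalerA mulVf// scale1r scaler_sumr; congr (_ + _).
by rewrite -sumrN; apply: eq_bigr => j _; rewrite scaleNr opprK scalerA.
Qed.

Lemma qd_sub A B M p : subspace B -> M `<=` A ->
  quotient_dim A B p -> exists q, quotient_dim M B q.
Proof.
move=> sB MA hp; apply: (qd_bounded (p := p)) => // q b [Mb ind].
by apply: (qd_le sB hp (b := b)); split=> // i; exact: MA.
Qed.

Lemma qd_quo A B M p : subspace B -> subspace M -> B `<=` M ->
  quotient_dim A B p -> exists q, quotient_dim A M q.
Proof.
move=> sB sM BM hp; apply: (qd_bounded (p := p)) => // q b [Mb ind].
by apply: (qd_le sB hp (b := b)); split=> // c /BM; exact: ind.
Qed.

Lemma qd_add A B M p q : subspace B -> subspace M -> B `<=` M -> M `<=` A ->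
  quotient_dim A M p -> quotient_dim M B q -> quotient_dim A B (p + q).
Proof.
move=> sB sM BM MA [a [Aa genA indA]] [b [Mb genB indB]].
pose e (i : 'I_(p + q)) := match fintype.split i with inl j => a j | inr j => b j end.
have sumE (c : 'I_(p + q) -> K) : \sum_i c i *: e i =
    \sum_i c (lshift q i) *: a i + \sum_i c (rshift p i) *: b i.
  rewrite big_split_ord; congr (_ + _); apply: eq_bigr => i _; rewrite /e.
    by rewrite (unsplitK (inl i)).
  by rewrite (unsplitK (inr i)).
exists e; split.
- by move=> i; rewrite /e; case: (fintype.split i) => j //; exact: MA.
- move=> v Av; have [c hc] := genA _ Av; have [c' hc'] := genB _ hc.
  exists (fun i => match fintype.split i with inl j => c j | inr j => c' j end).
  rewrite sumE opprD addrA.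
  under [X in _ - X - _]eq_bigr do rewrite (unsplitK (inl _)).
  by under [X in _ - X]eq_bigr do rewrite (unsplitK (inr _)).
- move=> c; rewrite sumE => Bc.
  have bM : M (\sum_i c (rshift p i) *: b i).
    by apply: sub_sum => // i _; exact: subZ.
  have ca : forall i, c (lshift q i) = 0.
    by apply: indA; apply: (subDl _ bM) => //; exact: BM.
  have cb : forall i, c (rshift p i) = 0.
    apply: indB; move: Bc; rewrite big1 ?add0r// => i _.
    by rewrite ca scale0r.
  by move=> i; rewrite -(splitK i); case: (fintype.split i).
Qed.

Lemma qd_refl A : subspace A -> quotient_dim A A 0.
Proof.
move=> sA; exists (fun=> 0); split; [by case| |by move=> ? ? []].
by move=> v Av; exists (fun=> 0); rewrite big_ord0 subr0.
Qed.

Lemma qd0 A B : quotient_dim A B 0 -> A `<=` B.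
Proof. by move=> [b [_ gen _]] v /gen[c]; rewrite big_ord0 subr0. Qed.

Lemma qd1P A B : subspace B -> (exists2 u, A u & ~ B u /\
    forall v, A v -> exists c, B (v - c *: u)) <-> quotient_dim A B 1.
Proof.
move=> sB; split=> [[u Au [nBu gen]]|[b [Ab gen ind]]].
  exists (fun=> u); split=> //.
    by move=> v /gen[c Bc]; exists (fun=> c); rewrite big_ord1.
  move=> c; rewrite big_ord1 => Bc i; apply/eqP/negPn/negP; rewrite (ord1 i) => c0.
  apply: nBu; rewrite -[u]scale1r -(mulVf c0) -scalerA; exact: subZ.
exists (b ord0) => //; split.
  move=> Bb; have /(_ _ ord0)/wrap[] := ind (fun=> 1).
    by rewrite big_ord1 scale1r.
  by move/eqP; rewrite oner_eq0.
by move=> v /gen[c]; rewrite big_ord1 => h; exists (c ord0).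
Qed.

Lemma qd_split A B p : subspace B -> subspace A -> B `<=` A ->
  quotient_dim A B p.+1 -> exists M,
  [/\ subspace M, B `<=` M, M `<=` A, quotient_dim M B 1 & quotient_dim A M p].
Proof.
move=> sB sA BA hp; have [b [Ab gen ind]] := hp.
pose M := [set v | exists c, B (v - c *: b ord0)].
have sM : subspace M.
  apply/subspaceP; split; first by exists 0; rewrite scale0r subr0; exact: sub0.
  move=> a u v [c Bc] [d Bd]; exists (a * c + d).
  rewrite scalerDl -scalerA opprD addrACA -scalerBr; exact: subZD.
have BM : B `<=` M by move=> v Bv; exists 0; rewrite scale0r subr0.
have MA : M `<=` A.
  move=> v [c /BA h]; apply: (subDl sA (v := - (c *: b ord0))) => //.
  by apply: subN => //; exact: subZ.
have M1 : quotient_dim M B 1.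
  apply/qd1P => //; exists (b ord0); first by exists 1; rewrite scale1r subrr; exact: sub0.
  split=> // Bb; have /(_ _ ord0)/wrap[] := ind (fun i => (i == ord0)%:R).
    rewrite (bigD1 ord0)//= big1 ?addr0 ?scale1r// => i /negbTE ->.
    by rewrite scale0r.
  by move/eqP; rewrite oner_eq0.
have [q hq] := qd_quo sB sM BM hp; exists M; split=> //.
have := qd_uniq sB hp (qd_add sB sM BM MA hq M1); rewrite addn1 => -[->].
exact: hq.
Qed.

Lemma qd_hyperplane A B p : subspace B -> subspace A -> B `<=` A ->
  quotient_dim A B p.+1 -> exists M,
  [/\ subspace M, B `<=` M, M `<=` A & quotient_dim A M 1].
Proof.
elim: p B => [|p IH] B sB sA BA hp; first by exists B; split.
have [N [sN BN NA _ hN]] := qd_split sB sA BA hp.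
have [M [sM NM MA hM]] := IH _ sN sA NA hN.
by exists M; split=> //; exact: subset_trans NM.
Qed.

End Subspaces.

Section RankNullity.
Variables (K : fieldType) (V V' : lmodType K) (T : V -> V').
Hypothesis linT : linear T.

Lemma lin0 : T 0 = 0.
Proof. by have := linT 1 0 0; rewrite !scale1r addr0 -[LHS]addr0 => /addrI. Qed.

Lemma linZ a u : T (a *: u) = a *: T u.
Proof. by rewrite -[a *: u]addr0 linT lin0 addr0. Qed.

Lemma linD u v : T (u + v) = T u + T v.
Proof. by have := linT 1 u v; rewrite !scale1r. Qed.

Lemma linB u v : T (u - v) = T u - T v.
Proof. by rewrite linD -scaleN1r linZ scaleN1r. Qed.

Lemma lin_sum I (r : seq I) (P : pred I) (E : I -> V) :
  T (\sum_(i <- r | P i) E i) = \sum_(i <- r | P i) T (E i).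
Proof. exact: (big_morph T linD lin0). Qed.

Lemma subspace_img (A : set V) : subspace A -> subspace (T @` A).
Proof.
move=> sA; apply/subspaceP; split.
  by exists 0; [exact: sub0|exact: lin0].
move=> a _ _ [u Au <-] [v Av <-].
by exists (a *: u + v); [exact: subZD|exact: linT].
Qed.

Lemma subspace_preimg (B : set V') : subspace B -> subspace (T @^-1` B).
Proof.
move=> sB; apply/subspaceP; split; first by rewrite /= lin0; exact: sub0.
by move=> a u v /= Bu Bv; rewrite linT; exact: subZD.
Qed.

(** Only the induced map of the quotients has to be bijective. *)
Lemma qd_transfer (A B : set V) (A' B' : set V') p :
  subspace A -> subspace B' ->
  (forall v, A v -> A' (T v)) ->
  (forall w, A' w -> exists2 v, A v & B' (w - T v)) ->
  (forall v, A v -> (B v <-> B' (T v))) ->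
  quotient_dim A B p <-> quotient_dim A' B' p.
Proof.
move=> sA sB' TA surj TB.
have Tsum q (b : 'I_q -> V) (c : 'I_q -> K) :
    T (\sum_i c i *: b i) = \sum_i c i *: T (b i).
  by rewrite lin_sum; apply: eq_bigr => i _; rewrite linZ.
have Asum q (b : 'I_q -> V) (c : 'I_q -> K) : (forall i, A (b i)) ->
    A (\sum_i c i *: b i).
  by move=> Ab; apply: sub_sum => // i _; exact: subZ.
split=> [[b [Ab gen ind]]|[b [Ab gen ind]]].
  exists (T \o b); split=> [i|w /surj[v Av Bv]|c Bc].
  - exact: TA.
  - have [c Bc] := gen _ Av; exists c.
    have := subD sB' Bv ((TB _ (subB sA Av (Asum _ b c Ab))).1 Bc).
    by rewrite linB Tsum addrA subrK.
  - by apply: ind; apply/TB; [exact: Asum|rewrite Tsum].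
have /choice[a ha] : forall i, exists v, A v /\ B' (b i - T v).
  by move=> i; have [v ? ?] := surj _ (Ab i); exists v.
have Aa i : A (a i) by case: (ha i).
have diff c : B' (\sum_i c i *: b i - \sum_i c i *: T (a i)).
  rewrite -sumrB; apply: sub_sum => // i _; rewrite -scalerBr.
  by apply: subZ => //; case: (ha i).
exists a; split=> // [v Av|c Bc].
  have [c Bc] := gen _ (TA _ Av); exists c; apply/TB; first exact: subB (Asum _ _ _ _).
  have := subD sB' Bc (diff c).
  by rewrite addrA subrK linB Tsum.
apply: ind; have := subD sB' (diff c) ((TB _ (Asum _ _ _ Aa)).1 Bc).
by rewrite Tsum subrK.
Qed.

Lemma qd_img (A : set V) (B : set V') p : subspace A -> subspace B ->
  quotient_dim A (A `&` T @^-1` B) p <-> quotient_dim (T @` A) B p.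
Proof.
move=> sA sB; apply: qd_transfer => //.
- by move=> _ [v Av <-]; exists v => //; rewrite subrr; exact: sub0.
- by move=> v Av; split=> [[]|].
Qed.

End RankNullity.

Section RankNullity2.
Variables (K : fieldType) (V V' : lmodType K) (T : V -> V').
Hypothesis linT : linear T.
Variables (A B : set V).
Hypotheses (sA : subspace A) (sB : subspace B) (BA : B `<=` A).
Local Notation ker := (T @^-1` [set 0]).
Local Notation M := (A `&` T @^-1` (T @` B)).

Let sM : subspace M.
Proof. by apply: subspaceI => //; apply/(subspace_preimg linT)/subspace_img. Qed.

Let BM : B `<=` M.
Proof. by move=> b Bb; split; [exact: BA|exists b]. Qed.

Let qd_ker q : quotient_dim (A `&` ker) (B `&` ker) q <-> quotient_dim M B q.
Proof.
apply: (@qd_transfer _ _ _ idfun) => //.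
- by apply: subspaceI => //; apply/(subspace_preimg linT)/subspace0.
- by move=> v [Av Tv]; split=> //; exists 0; [exact: sub0|rewrite Tv (lin0 linT)].
- move=> v [Av [b Bb Tb]]; exists (v - b); last by rewrite opprB addrCA subrr addr0.
  by split; [apply: subB => //; exact: BA|rewrite /= linB// Tb subrr].
- by move=> v [Av Tv]; split=> // -[].
Qed.

Lemma rank_nullity p q : quotient_dim (T @` A) (T @` B) p ->
  quotient_dim (A `&` ker) (B `&` ker) q -> quotient_dim A B (p + q).
Proof.
move=> /(qd_img linT _ sA (subspace_img linT sB)) hp /qd_ker hq.
by apply: (qd_add _ sM _ _ hp hq) => // v [].
Qed.

Lemma rank_nullity_conv d : quotient_dim A B d -> exists p q,
  [/\ quotient_dim (T @` A) (T @` B) p,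
      quotient_dim (A `&` ker) (B `&` ker) q & d = (p + q)%N].
Proof.
move=> hd; have [p hp] := qd_quo sB sM BM hd.
have MA : M `<=` A by move=> v [].
have [q hq] := qd_sub sB MA hd.
exists p, q; split.
- by apply/(qd_img linT) => //; exact: subspace_img.
- exact/qd_ker.
- by apply: (qd_uniq sB hd); apply: (qd_add sB sM).
Qed.

End RankNullity2.

Lemma qd_inj (K : fieldType) (V V' : lmodType K) (T : V -> V') (A B : set V) p :
  linear T -> injective T -> subspace A -> subspace B ->
  quotient_dim (T @` A) (T @` B) p <-> quotient_dim A B p.
Proof.
move=> linT injT sA sB; apply: iff_sym; apply: (qd_transfer linT) => //.
- exact: subspace_img.
- move=> _ [v Av <-]; exists v => //; rewrite subrr.
  by apply: sub0; exact: subspace_img.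
- by move=> v Av; split=> [Bv|[w Bw /injT <-]//]; exists v.
Qed.

(** * Affine permutations and the affine symmetric group *)

Section AffinePermutations.
Variable n : nat.
Hypothesis hn : (2 <= n)%N.
Implicit Types (a b k : int) (i j : 'I_n) (p : int -> int) (w : seq 'I_n).

Local Notation dv x := ((n%:Z %| x)%Z).

Lemma dv_eq x y : dv x -> x = y -> dv y.
Proof. by move=> h <-. Qed.

Lemma dvP x : reflect (exists q : int, x = q * n%:Z) (dv x).
Proof. exact: dvdzP. Qed.

Lemma dv_neq x y : dv x -> y != x -> `|y - x| < n%:Z -> ~~ dv y.
Proof.
move=> /dvP[q ->] yx lt; apply/dvP => -[q' yE]; subst y.
have {}yx : q' != q by apply: contra_neq yx => ->.
rewrite -mulrBl normrM [`|n%:Z|]ger0_norm// in lt.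
have : 1 <= `|q' - q| by rewrite -gtz0_ge1 normr_gt0 subr_eq0.
nia.
Qed.

Lemma ndv_eq x y z : dv x -> ~~ dv y -> z = y + x -> ~~ dv z.
Proof. by move=> hx hy ->; rewrite (rpredDr _ hx). Qed.

Lemma ndv_eqN x y z : dv x -> ~~ dv y -> z = x - y -> ~~ dv z.
Proof. by move=> hx hy ->; rewrite (rpredDl _ hx) rpredN. Qed.

Lemma ndv_eq0 y z : ~~ dv y -> z = y -> ~~ dv z.
Proof. by move=> hy ->. Qed.

(** The affine transposition exchanging [a + q n] and [a + 1 + q n]. *)
Definition tr a k : int :=
  if dv (k - a) then k + 1 else if dv (k - a - 1) then k - 1 else k.

Lemma tr_0 a k : dv (k - a) -> tr a k = k + 1.
Proof. by rewrite /tr => ->. Qed.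

Lemma tr_1 a k : dv (k - a - 1) -> tr a k = k - 1.
Proof.
move=> h; rewrite /tr h; case: ifP => // h'.
by have := dv_neq h (y := k - a); rewrite h'; lia.
Qed.

Lemma tr_2 a k : ~~ dv (k - a) -> ~~ dv (k - a - 1) -> tr a k = k.
Proof. by rewrite /tr => /negbTE -> /negbTE ->. Qed.

Ltac dvlia :=
  repeat match goal with
  | h : is_true (dv _) |- _ => clear h
  | h : is_true (~~ dv _) |- _ => clear h
  end; lia.

Ltac dvtac :=
  match goal with
  | h : is_true (dv ?x) |- is_true (dv ?y) =>
      apply: (@dv_eq x y h); dvlia
  | h : is_true (dv ?x) |- is_true (~~ dv ?y) =>
      apply: (@dv_neq x y h); dvlia
  | h : is_true (~~ dv ?x) |- is_true (~~ dv ?y) =>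
      apply: (@ndv_eq0 x y h); dvlia
  | h : is_true (dv ?x), h' : is_true (~~ dv ?x') |- is_true (~~ dv ?y) =>
      apply: (@ndv_eq x x' y h h'); dvlia
  | h : is_true (dv ?x), h' : is_true (~~ dv ?x') |- is_true (~~ dv ?y) =>
      apply: (@ndv_eqN x x' y h h'); dvlia
  end.

Lemma tr_invol a k : tr a (tr a k) = k.
Proof.
have [h|h] := boolP (dv (k - a)).
  by rewrite (tr_0 h) tr_1 ?addrK//; dvtac.
have [h'|h'] := boolP (dv (k - a - 1)).
  by rewrite (tr_1 h') tr_0 ?subrK//; dvtac.
by rewrite !tr_2.
Qed.

Lemma tr_add a k q : tr a (k + q * n%:Z) = tr a k + q * n%:Z.
Proof.
have hq : dv (q * n%:Z) by apply/dvP; exists q.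
have e c : k + q * n%:Z + c = k + c + q * n%:Z by rewrite addrAC.
rewrite /tr !e (addrAC _ _ (-1)) !(rpredDr _ hq); case: (dv (k - a)) => //.
by case: (dv (k - a - 1)).
Qed.

Lemma tr_congr a b k : dv (a - b) -> tr a k = tr b k.
Proof.
move=> /dvP[q]; rewrite /tr => /eqP; rewrite subr_eq => /eqP ->.
have e : k - (q * n%:Z + b) = (- q) * n%:Z + (k - b) by lia.
have hq : dv (- q * n%:Z) by apply/dvP; exists (- q).
by rewrite e -[_ + (k - b) - 1]addrA !(rpredDl _ hq).
Qed.

Lemma tr_far a b k : ~~ dv (a - b) -> ~~ dv (a - b - 1) -> ~~ dv (a - b + 1) ->
  tr a (tr b k) = tr b (tr a k).
Proof.
move=> h1 h2 h3.
have [h|h] := boolP (dv (k - a)).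
  rewrite (tr_0 h) [tr b k]tr_2; [|dvtac|dvtac].
  rewrite (tr_0 h) tr_2 //; dvtac.
have [h'|h'] := boolP (dv (k - a - 1)).
  rewrite (tr_1 h') [tr b k]tr_2; [|dvtac|dvtac].
  rewrite (tr_1 h') tr_2 //; dvtac.
rewrite [tr a k]tr_2//.
have [h''|h''] := boolP (dv (k - b)).
  by rewrite (tr_0 h'') tr_2//; dvtac.
have [h4|h4] := boolP (dv (k - b - 1)).
  by rewrite (tr_1 h4) tr_2//; dvtac.
by rewrite (tr_2 h'' h4) tr_2.
Qed.

Lemma tr_braid a k : (2 < n)%N ->
  tr a (tr (a + 1) (tr a k)) = tr (a + 1) (tr a (tr (a + 1) k)).
Proof.
move=> n3.
have [h|h] := boolP (dv (k - a)).
  rewrite (tr_0 h) (@tr_0 _ (k + 1)); last dvtac.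
  rewrite tr_2; [|dvtac|dvtac].
  rewrite (@tr_2 (a + 1) k); [|dvtac|dvtac].
  by rewrite (tr_0 h) tr_0//; dvtac.
have [h1|h1] := boolP (dv (k - a - 1)).
  rewrite (tr_1 h1) (@tr_2 (a + 1) (k - 1)); [|dvtac|dvtac].
  rewrite tr_0; last dvtac.
  rewrite (@tr_0 (a + 1) k); last dvtac.
  rewrite (@tr_2 a (k + 1)); [|dvtac|dvtac].
  by rewrite tr_1; [lia|dvtac].
have [h2|h2] := boolP (dv (k - a - 2)).
  rewrite (tr_2 h h1) (@tr_1 (a + 1) k); last dvtac.
  rewrite tr_1; last dvtac.
  by rewrite tr_2//; dvtac.
rewrite (tr_2 h h1) (@tr_2 (a + 1) k); [|dvtac|dvtac].
by rewrite (tr_2 h h1) tr_2//; dvtac.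
Qed.

Definition word_perm w k : int := foldr (fun i : 'I_n => tr i%:Z) k w.

Lemma word_perm_cat w w' k : word_perm (w ++ w') k = word_perm w (word_perm w' k).
Proof. by rewrite /word_perm foldr_cat. Qed.

Lemma word_perm_rcons w i k : word_perm (rcons w i) k = word_perm w (tr i%:Z k).
Proof. by rewrite -cats1 word_perm_cat. Qed.

Lemma word_perm_revK w k : word_perm (rev w) (word_perm w k) = k.
Proof.
elim: w k => [|i w IH] k //=.
by rewrite rev_cons word_perm_rcons tr_invol IH.
Qed.

Lemma dv_ord i j : dv (i%:Z - j%:Z) = (i == j).
Proof.
apply/idP/eqP => [h|->]; last by rewrite subrr.
apply/val_inj/eqP/negPn/negP => /= ij.
have := ltn_ord i; have := ltn_ord j => lj li.
by have := @dv_neq 0 (i%:Z - j%:Z) (dvdz0 _); rewrite h => F; suff: ~~ true by []; apply: F; lia.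
Qed.

Lemma dv_ordS i j : dv (i%:Z + 1 - j%:Z) = (i.+1 %% n == j)%N.
Proof.
have n0 : (0 < n)%N by lia.
have h : dv (i.+1%:Z - (i.+1 %% n)%:Z).
  apply/dvP; exists (i.+1 %/ n)%:Z; rewrite {1}(divn_eq i.+1 n).
  by rewrite PoszD PoszM addrK.
rewrite -[RHS]/(Ordinal (ltn_pmod i.+1 n0) == j) -dv_ord /=.
rewrite (_ : _ - _ = (i.+1%:Z - (i.+1 %% n)%N%:Z) + ((i.+1 %% n)%N%:Z - j%:Z)); last by lia.
by rewrite rpredDl.
Qed.

Local Notation m := (@affineA_matrix n).
Local Notation ceq := (coxeter_eq m).

Lemma coxeter_sound w w' : ceq w w' -> word_perm w =1 word_perm w'.
Proof.
elim=> {w w'} [w|w w' _ IH|w w' w'' _ IH _ IH'|u v i j] k //.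
  by rewrite IH IH'.
rewrite !word_perm_cat; congr (word_perm u _); move: (word_perm v k) => {}k.
rewrite /affineA_matrix; case: eqVneq => [->|ij] /=; first exact: tr_invol.
case: eqVneq => [//|n2].
case: ifP => [/orP[]|/negbT].
- rewrite -dv_ordS => h.
  have e k' : tr j k' = tr (i%:Z + 1) k'.
    by apply: tr_congr; rewrite -rpredN opprB.
  rewrite /= !e tr_braid; last by lia.
  by rewrite !tr_invol.
- rewrite -dv_ordS => h.
  have e k' : tr i k' = tr (j%:Z + 1) k'.
    by apply: tr_congr; rewrite -rpredN opprB.
  rewrite /= !e -tr_braid; last by lia.
  by rewrite !tr_invol.
- rewrite negb_or -!dv_ordS => /andP[h1 h2].
  have h3 : ~~ dv (i%:Z - j%:Z) by rewrite dv_ord.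
  have h4 : ~~ dv (i%:Z - j%:Z - 1).
    by rewrite (_ : _ - 1 = - (j%:Z + 1 - i%:Z)) ?rpredN//; lia.
  by rewrite /= [tr i (tr j (tr i _))]tr_far ?tr_invol//; dvtac.
Qed.

Local Notation adm := (admissible n).

Lemma periodic_add p k q : (forall k, p (k + n%:Z) = p k + n%:Z) ->
  p (k + q * n%:Z) = p k + q * n%:Z.
Proof.
move=> hp.
have hN (q' : nat) k' : p (k' + q'%:Z * n%:Z) = p k' + q'%:Z * n%:Z.
  elim: q' k' => [|q' IH] k'; first by rewrite mul0r !addr0.
  rewrite (_ : k' + _ = k' + q'%:Z * n%:Z + n%:Z); last by lia.
  by rewrite hp IH; lia.
case: q => q; first exact: hN.
have := hN q.+1 (k + Negz q * n%:Z).
by rewrite -addrA -mulrDl NegzE addNr mul0r addr0 => ->; lia.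
Qed.

Lemma adm_add p k q : adm p -> p (k + q * n%:Z) = p k + q * n%:Z.
Proof. by move=> [_ hp]; exact: periodic_add. Qed.

Lemma adm_comp p q : adm p -> adm q -> adm (p \o q).
Proof.
move=> [bp hp] [bq hq]; split; first exact: bij_comp.
by move=> k /=; rewrite hq hp.
Qed.

Lemma adm_tr a : adm (tr a).
Proof.
split; first by exists (tr a) => k; exact: tr_invol.
by move=> k; have := tr_add a k 1; rewrite mul1r.
Qed.

Lemma adm_word w : adm (word_perm w).
Proof.
elim: w => [|i w IH]; first by split=> //; exists id.
exact: (adm_comp (adm_tr i) IH).
Qed.

Lemma adm_dv p a b : adm p -> dv (a - b) -> p a - a = p b - b.
Proof.
move=> hp /dvP[q /eqP]; rewrite subr_eq => /eqP ->.
by rewrite [_ + b]addrC adm_add//; lia.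
Qed.

Lemma adm_ltS p a b : adm p -> dv (a - b) ->
  (p a < p (a + 1)) = (p b < p (b + 1)).
Proof.
move=> hp hab; have := adm_dv hp hab.
have : dv (a + 1 - (b + 1)) by dvtac.
by move=> /(adm_dv hp); lia.
Qed.

Lemma tr_l a : tr a a = a + 1.
Proof. by rewrite tr_0// subrr dvdz0. Qed.

Lemma tr_r a : tr a (a + 1) = a.
Proof. by rewrite -{1}tr_l tr_invol. Qed.

Lemma sum_tr (F : int -> int) p i : adm p ->
  \sum_(j < n) F (p (tr i j%:Z) - j%:Z) + F (p i%:Z - i%:Z) + F (p (i%:Z + 1) - (i%:Z + 1)) =
  \sum_(j < n) F (p j%:Z - j%:Z) + F (p (i%:Z + 1) - i%:Z) + F (p i%:Z - (i%:Z + 1)).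
Proof.
move=> hp; have n0 : (0 < n)%N by lia.
pose j := Ordinal (ltn_pmod i.+1 n0).
have hj : dv (i%:Z + 1 - j%:Z) by rewrite dv_ordS.
have hj' : dv (j%:Z - (i%:Z + 1)) by rewrite -rpredN opprB.
have ji : j != i.
  rewrite -dv_ord; have := @dv_neq _ (j%:Z - i%:Z) hj'; apply; lia.
rewrite (bigD1 i)//= (bigD1 j)//= [in RHS](bigD1 i)//= [in RHS](bigD1 j)//= tr_l.
rewrite (adm_dv hp hj').
have -> : p (tr i j%:Z) - j%:Z = p i%:Z - (i%:Z + 1).
  have := adm_dv (adm_comp hp (adm_tr i)) hj'; rewrite /= => ->.
  by rewrite tr_r.
rewrite [X in _ + (_ + X)](_ : _ = \sum_(k < n | (k != i) && (k != j)) F (p k%:Z - k%:Z)).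
  by ring.
apply: eq_bigr => k /andP[ki kj]; rewrite tr_2// ?dv_ord//.
rewrite (_ : _ - 1 = (k%:Z - j%:Z) + (j%:Z - (i%:Z + 1))); last by lia.
by rewrite (rpredDr _ hj') dv_ord.
Qed.

(** The charge separates the translations, while words have charge zero: the
    Coxeter group is the kernel of the charge. *)
Definition charge p : int := \sum_(j < n) (p j%:Z - j%:Z).

(** Undoing a descent decreases the energy, which makes sorting terminate. *)
Definition energy p : int := \sum_(j < n) (p j%:Z - j%:Z) ^+ 2.

Lemma energy_ge0 p : 0 <= energy p.
Proof. by apply: sumr_ge0 => j _; exact: sqr_ge0. Qed.

Lemma charge_tr p i : adm p -> charge (p \o tr i) = charge p.
Proof. by move=> hp; have := sum_tr id i hp; rewrite /charge /=;
  move: (\sum_(j < n) _) (\sum_(j < n) _) => S1 S2; lia. Qed.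

Lemma energy_tr p i : adm p -> p (i%:Z + 1) < p i%:Z ->
  energy (p \o tr i) < energy p.
Proof.
move=> hp lt; have := sum_tr (fun x => x ^+ 2) i hp; rewrite /energy /= !expr2.
move: (\sum_(j < n) _) (\sum_(j < n) _) => S1 S2; nia.
Qed.

Lemma charge_shift p c : charge (fun k => p k + c) = charge p + n%:Z * c.
Proof.
rewrite /charge; under eq_bigr do rewrite addrAC.
by rewrite big_split /= sumr_const card_ord -mulr_natl natz.
Qed.

Lemma eq_charge p q : p =1 q -> charge p = charge q.
Proof. by move=> e; apply: eq_bigr => j _; rewrite e. Qed.

Lemma charge_word w : charge (word_perm w) = 0.
Proof.
elim/last_ind: w => [|w i IH].
  by rewrite /charge big1// => j _; rewrite subrr.
rewrite -IH -(charge_tr i (adm_word w)); apply: eq_charge => k /=.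
exact: word_perm_rcons.
Qed.

Inductive ascending : seq 'I_n -> Prop :=
| ascending_nil : ascending [::]
| ascending_rcons w i : ascending w ->
    word_perm w i%:Z < word_perm w (i%:Z + 1) -> ascending (rcons w i).

(** An increasing bijection of the integers is a translation. *)
Lemma adm_no_descent p : adm p ->
  (forall i : 'I_n, p i%:Z < p (i%:Z + 1)) -> forall k, p k = k + p 0.
Proof.
move=> hp hi; have n0 : (0 < n)%N by lia.
have up k : p k < p (k + 1).
  have k0 : 0 <= (k %% n%:Z)%Z by rewrite modz_ge0//; lia.
  have kn : (absz (k %% n%:Z)%Z < n)%N.
    by rewrite -ltz_nat gez0_abs// ltz_pmod//; lia.
  have e := divz_eq k n%:Z.
  rewrite (@adm_ltS p k (Ordinal kn)%:Z) ?hi//= gez0_abs//.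
  by rewrite (_ : k - _ = (k %/ n%:Z)%Z * n%:Z) ?dvdz_mull ?dvdzz//; lia.
have upN k (m' : nat) : p k + m'%:Z <= p (k + m'%:Z).
  elim: m' => [|m' IH]; first by rewrite !addr0.
  rewrite (_ : k + m'.+1%:Z = k + m'%:Z + 1); last by lia.
  by have := up (k + m'%:Z); lia.
have le k l : k <= l -> p k + (l - k) <= p l.
  move=> kl; have := upN k (absz (l - k)); rewrite gez0_abs; last by lia.
  by rewrite (_ : k + (l - k) = l)//; lia.
have step k : p (k + 1) = p k + 1.
  case: hp => [[g gK Kg] _].
  have := up k; have := Kg (p k + 1); set l := g _ => lE.
  have [h|h] := leP l k; first by have := le _ _ h; lia.
  have [h'|h'] := leP (k + 1) l; first by have := le _ _ h'; lia.
  by lia.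
have pN (m' : nat) k : p (k + m'%:Z) = p k + m'%:Z.
  elim: m' => [|m' IH]; first by rewrite !addr0.
  rewrite (_ : k + m'.+1%:Z = k + m'%:Z + 1); last by lia.
  by rewrite step IH; lia.
move=> k; have [h|h] := leP 0 k.
  by have := pN (absz k) 0; rewrite gez0_abs// add0r addrC.
have := pN (absz k) k; rewrite lez0_abs; last by lia.
by rewrite subrr => ->; rewrite addrCA subrr addr0.
Qed.

(** Among the permutations of the Coxeter group, these form the standard
    parabolic subgroup of the vertex [i]. *)
Definition preserves i p := forall k, (i%:Z < p k) = (i%:Z < k).

Lemma preserves_tr i j : i != j -> preserves i (tr j).
Proof.
move=> ij k; rewrite /tr; case: ifP => [h|_].
  have : ~~ dv (k - i%:Z).
    by apply: (ndv_eq h (y := j%:Z - i%:Z)); [rewrite dv_ord eq_sym|lia].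
  have : k != i%:Z -> (i%:Z < k + 1) = (i%:Z < k) by lia.
  by move=> H h'; apply: H; apply: contraNneq h' => ->; rewrite subrr dvdz0.
case: ifP => [h|//].
have : ~~ dv (k - 1 - i%:Z).
  by apply: (ndv_eq h (y := j%:Z - i%:Z)); [rewrite dv_ord eq_sym|lia].
have : k != i%:Z + 1 -> (i%:Z < k - 1) = (i%:Z < k) by lia.
by move=> H h'; apply: H; apply: contraNneq h' => ->; rewrite addrK subrr dvdz0.
Qed.

Lemma preserves_word i w : all (predC1 i) w -> preserves i (word_perm w).
Proof.
elim: w => [//|j w IH] /= /andP[ji /IH h] k.
by rewrite preserves_tr ?h// eq_sym.
Qed.

(** Sorting: an admissible permutation is reached from a translation by
    exchanging neighbours which are in the wrong order. *)
Lemma adm_ascending p : adm p -> exists w c,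
  [/\ ascending w, p =1 (fun k => word_perm w k + c) &
      forall i, preserves i p -> all (predC1 i) w].
Proof.
have [N] := ubnP (absz (energy p)); elim: N p => // N IH p hN hp.
have [[i hi]|] := pselect (exists i : 'I_n, p (i%:Z + 1) < p i%:Z); last first.
  move=> /forallNP h; exists [::], (p 0); split=> //; first exact: ascending_nil.
  move=> k /=; apply: adm_no_descent => // i.
  have /negP := h i; rewrite -leNgt le_eqVlt => /orP[/eqP|//].
  by move=> /(bij_inj hp.1); lia.
have hp' := adm_comp hp (adm_tr i).
have := energy_tr hp hi; have := energy_ge0 (p \o tr i) => e1 e2.
have [|w [c [aw pE pw]]] := IH (p \o tr i) _ hp'; first by lia.
exists (rcons w i), c; split.
- apply: ascending_rcons => //.
  have := pE i%:Z; have := pE (i%:Z + 1); rewrite /= tr_l tr_r; lia.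
- by move=> k; rewrite word_perm_rcons -pE /= tr_invol.
- move=> j hj; rewrite all_rcons /=.
  have ij : i != j.
    apply/eqP => ij; subst j; have := hj i%:Z; have := hj (i%:Z + 1); lia.
  rewrite ij pw// => k /=; rewrite hj; apply: preserves_tr.
  by rewrite eq_sym.
Qed.

Lemma ascending_of w : exists x, ascending x /\ word_perm x =1 word_perm w.
Proof.
have [x [c [ax e _]]] := adm_ascending (adm_word w); exists x; split=> // k.
have := charge_word w; rewrite (eq_charge e) charge_shift charge_word.
by rewrite e; nia.
Qed.

Lemma ceq_ctx u v w w' : ceq w w' -> ceq (u ++ w ++ v) (u ++ w' ++ v).
Proof.
move=> h; elim: h u v => {w w'} [w|w w' _ IH|w w' w'' _ IH _ IH'|u' v' i j] u v.
- exact: coxeter_refl.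
- exact/coxeter_sym/IH.
- exact: coxeter_trans (IH u v) (IH' u v).
- have := coxeter_rel m (u ++ u') (v' ++ v) i j.
  by rewrite !catA.
Qed.

Lemma ceq_catl u w w' : ceq w w' -> ceq (u ++ w) (u ++ w').
Proof. by move=> /(ceq_ctx u [::]); rewrite !cats0. Qed.

Lemma ceq_rcons w w' i : ceq w w' -> ceq (rcons w i) (rcons w' i).
Proof. by move=> /(ceq_ctx [::] [:: i]); rewrite !cats1. Qed.

Lemma ceq_sqr i : ceq [:: i; i] [::].
Proof.
have := coxeter_rel m [::] [::] i i.
by rewrite /affineA_matrix eqxx.
Qed.

Lemma ceq_cancel w i : ceq (w ++ [:: i; i]) w.
Proof. by have := ceq_catl w (ceq_sqr i); rewrite cats0. Qed.

Lemma ceq_rev w : ceq (rev w ++ w) [::].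
Proof.
elim: w => [|i w IH]; first exact: coxeter_refl.
rewrite rev_cons -cats1 -catA /=; apply: coxeter_trans IH.
exact: (ceq_ctx (rev w) w (ceq_sqr i)).
Qed.

Lemma ceq_revr w : ceq (w ++ rev w) [::].
Proof. by have := ceq_rev (rev w); rewrite revK. Qed.

Lemma ceq_of_mul w w' : ceq (w ++ rev w') [::] -> ceq w w'.
Proof.
move=> h; apply: coxeter_trans (ceq_ctx [::] w' h).
rewrite /= -catA; apply: coxeter_sym.
by have := ceq_catl w (ceq_rev w'); rewrite cats0.
Qed.

Definition far i j := ~~ dv (i%:Z + 1 - j%:Z) && ~~ dv (j%:Z + 1 - i%:Z).

Lemma ceq_far i j : i != j -> far i j -> ceq [:: i; j] [:: j; i].
Proof.
move=> ij /andP[]; rewrite !dv_ordS => h1 h2.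
apply: ceq_of_mul => /=; rewrite /rev /=.
have := coxeter_rel m [::] [::] i j.
rewrite /affineA_matrix (negbTE ij) (negbTE h1) (negbTE h2) /=.
case: ifP => // /eqP n2.
have aux (a b c : nat) : c = 2%N -> (a < c)%N -> (b < c)%N -> a != b ->
    (a.+1 %% c)%N = b.
  by move=> ->; case: a b => [|[|//]] [|[|//]].
by move: h1; rewrite (aux _ _ _ n2 (ltn_ord i) (ltn_ord j) ij) eqxx.
Qed.

Lemma ceq_braid i j : (2 < n)%N -> dv (i%:Z + 1 - j%:Z) ->
  ceq [:: i; j; i] [:: j; i; j].
Proof.
move=> n3 h; apply: ceq_of_mul => /=; rewrite /rev /=.
have ij : i != j.
  rewrite -dv_ord; have := @dv_neq _ (i%:Z - j%:Z) h; apply; lia.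
have := coxeter_rel m [::] [::] i j.
rewrite /affineA_matrix (negbTE ij) -dv_ordS h /=.
by case: ifP => // /eqP n2; lia.
Qed.

(** Both words end at a descent of the same permutation. If the two descents
    differ, the permutation also has a word ending in the longest element of
    the rank two group they generate, and the relation of that group closes
    the diamond. *)
Lemma ascending_uniq w w' : ascending w -> ascending w' ->
  word_perm w =1 word_perm w' -> ceq w w'.
Proof.
have [N] := ubnP (absz (energy (word_perm w))); elim: N w w' => // N IH w w' hN aw aw' e.
have [p [hp eN pw]] : exists p, [/\ adm p, (absz (energy p) < N.+1)%N & word_perm w =1 p].
  by exists (word_perm w); split=> //; exact: adm_word.
have pw' k : word_perm w' k = p k by rewrite -e pw.
have IHp i u x : p (i%:Z + 1) < p i%:Z -> ascending u -> ascending x ->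
    word_perm u =1 p \o tr i -> word_perm x =1 p \o tr i -> ceq u x.
  move=> hi au ax ue xe; apply: IH => // [|k]; last by rewrite ue xe.
  have := energy_tr hp hi; have := energy_ge0 (p \o tr i).
  rewrite (_ : energy (word_perm u) = energy (p \o tr i)); first by lia.
  by apply: eq_bigr => k _; rewrite ue.
have dsc i u : ascending u -> word_perm u i%:Z < word_perm u (i%:Z + 1) ->
    word_perm (rcons u i) =1 p ->
    p (i%:Z + 1) < p i%:Z /\ word_perm u =1 p \o tr i.
  move=> au ui ue; split; first by rewrite -!ue !word_perm_rcons tr_l tr_r.
  by move=> k /=; rewrite -ue word_perm_rcons tr_invol.
have adj i j u u' : (2 < n)%N -> ascending u -> ascending u' ->
    p (i%:Z + 1) < p i%:Z -> p (j%:Z + 1) < p j%:Z ->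
    word_perm u =1 p \o tr i -> word_perm u' =1 p \o tr j ->
    dv (i%:Z + 1 - j%:Z) -> ceq (rcons u i) (rcons u' j).
  move=> n3 au au' hi hj ue ue' ij.
  have {}ij : dv (j%:Z - (i%:Z + 1)) by rewrite -rpredN opprB.
  have trj k : tr j k = tr (i%:Z + 1) k by exact: tr_congr.
  have ij1 : dv (j%:Z + 1 - (i%:Z + 2)) by dvtac.
  have := adm_dv hp ij; have := adm_dv hp ij1 => pj1 pj.
  have [x [ax xe]] := ascending_of (w ++ [:: i; j; i]).
  have {}xe k : word_perm x k = p (tr i (tr (i%:Z + 1) (tr i k))).
    by rewrite xe word_perm_cat pw /= trj.
  have d0 : dv 0 by exact: dvdz0.
  have t0 : tr (i%:Z + 1) i%:Z = i%:Z by apply: tr_2; dvtac.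
  have t1 : tr i%:Z (i%:Z + 2) = i%:Z + 2 by apply: tr_2; dvtac.
  have t2 : tr (i%:Z + 1) (i%:Z + 1) = i%:Z + 2 by rewrite tr_l -addrA.
  have t3 : tr (i%:Z + 1) (i%:Z + 2) = i%:Z + 1.
    by rewrite -[X in tr _ X]t2 tr_invol.
  have x0 : word_perm x i%:Z = p (i%:Z + 2) by rewrite xe tr_l t2 t1.
  have x1 : word_perm x (i%:Z + 1) = p (i%:Z + 1) by rewrite xe tr_r t0 tr_l.
  have x2 : word_perm x (i%:Z + 2) = p i%:Z by rewrite xe t1 t3 tr_r.
  have ltj y : (word_perm y j%:Z < word_perm y (j%:Z + 1)) =
               (word_perm y (i%:Z + 1) < word_perm y (i%:Z + 2)).
    by rewrite (adm_ltS (adm_word y) ij) -addrA.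
  have a1 : ascending (rcons (rcons x i) j).
    apply: ascending_rcons; first by apply: ascending_rcons => //; lia.
    by rewrite ltj !word_perm_rcons tr_r t1; lia.
  have a2 : ascending (rcons (rcons x j) i).
    apply: ascending_rcons; first by apply: ascending_rcons => //; rewrite ltj; lia.
    by rewrite !word_perm_rcons !trj t0 t2; lia.
  have c1 : ceq u (rcons (rcons x i) j).
    apply: (IHp i) => // k; rewrite !word_perm_rcons xe trj.
    by rewrite tr_invol tr_invol.
  have c2 : ceq u' (rcons (rcons x j) i).
    apply: (IHp j) => // k; rewrite !word_perm_rcons xe !trj /= trj.
    by rewrite tr_braid // !tr_invol.
  apply: coxeter_trans (ceq_rcons i c1) _.
  apply: coxeter_trans _ (coxeter_sym (ceq_rcons j c2)).
  rewrite -!cats1 -!catA; apply/ceq_catl/ceq_braid => //.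
  by rewrite -rpredN opprB.
case: aw pw {hN e} => [|u i au ui] pw.
  case: aw' pw' => [|u i au ui] pw'; first exact: coxeter_refl.
  have [] := dsc _ _ au ui pw'; rewrite -!pw /=; lia.
case: aw' pw' => [|u' j au' uj] pw'.
  have [] := dsc _ _ au ui pw; rewrite -!pw' /=; lia.
have [hi ue] := dsc _ _ au ui pw; have [hj ue'] := dsc _ _ au' uj pw'.
have [ij|ij] := eqVneq i j.
  by subst j; apply/ceq_rcons/(IHp i).
have [hij|] := boolP (far i j).
  have dji : ~~ dv (j%:Z - i%:Z) by rewrite dv_ord eq_sym.
  have /andP[d1 d2] := hij.
  have [x [ax xe]] := ascending_of (rcons u i ++ [:: i; j]).
  have {}xe k : word_perm x k = p (tr i (tr j k)).
    by rewrite xe word_perm_cat pw.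
  have d3 : ~~ dv (i%:Z - j%:Z) by rewrite dv_ord.
  have d4 : ~~ dv (i%:Z - j%:Z - 1).
    by rewrite (_ : _ - 1 = - (j%:Z + 1 - i%:Z)) ?rpredN//; lia.
  have trC k : tr i (tr j k) = tr j (tr i k) by apply: tr_far => //; dvtac.
  have dji1 : ~~ dv (j%:Z - i%:Z - 1).
    by rewrite (_ : _ - 1 = - (i%:Z + 1 - j%:Z)) ?rpredN//; lia.
  have a1 : ascending (rcons x j).
    apply: ascending_rcons => //; rewrite !xe tr_l tr_r !tr_2//; dvtac.
  have a2 : ascending (rcons x i).
    apply: ascending_rcons => //; rewrite !xe !trC tr_l tr_r !tr_2//; dvtac.
  have c1 : ceq u (rcons x j).
    by apply: (IHp i) => // k; rewrite word_perm_rcons xe tr_invol.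
  have c2 : ceq u' (rcons x i).
    by apply: (IHp j) => // k; rewrite word_perm_rcons xe trC tr_invol.
  apply: coxeter_trans (ceq_rcons i c1) _.
  apply: coxeter_trans _ (coxeter_sym (ceq_rcons j c2)).
  rewrite -!cats1 -!catA; apply/ceq_catl/ceq_far; rewrite 1?eq_sym//.
  by rewrite /far andbC.
rewrite negb_and !negbK => hij.
have [n3|n2] := ltnP 2 n.
  case/orP: hij => h; first exact: (adj i j).
  by apply: coxeter_sym; exact: (adj j i).
have {n2} nE : n = 2%N by apply/eqP; rewrite eqn_leq n2 hn.
have dj a b : dv (a + 1 - b) -> p (a + 1) < p a -> p (b + 1) < p b -> False.
  move=> hab pa pb.
  have /(adm_dv hp) : dv (a + 1 - b) by [].
  have /(adm_dv hp) : dv (a + 2 - (b + 1)) by dvtac.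
  have : p (a + 2) = p a + 2.
    by have := adm_add a 1 hp; rewrite mul1r (_ : n%:Z = 2)// nE.
  by lia.
by case/orP: hij => h; [case: (dj i%:Z j%:Z)|case: (dj j%:Z i%:Z)].
Qed.

Lemma ceq_ascending w : exists2 x, ascending x & ceq w x.
Proof.
elim/last_ind: w => [|w i [u au wu]]; first by exists [::]; [exact: ascending_nil|exact: coxeter_refl].
have [h|h] := ltP (word_perm u i%:Z) (word_perm u (i%:Z + 1)).
  by exists (rcons u i); [exact: ascending_rcons|exact: ceq_rcons].
have {}h : word_perm u (i%:Z + 1) < word_perm u i%:Z.
  by rewrite lt_neqAle h andbT; apply/eqP => /(bij_inj (adm_word u).1); lia.
have [x [ax xe]] := ascending_of (rcons u i).
exists x => //; apply: coxeter_trans (ceq_rcons i wu) _.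
have ux : ceq u (rcons x i).
  apply: ascending_uniq => //.
    by apply: ascending_rcons => //; rewrite !xe !word_perm_rcons tr_l tr_r.
  by move=> k; rewrite word_perm_rcons xe word_perm_rcons tr_invol.
apply: coxeter_trans (ceq_rcons i ux) _.
by rewrite -!cats1 -!catA; exact: ceq_cancel.
Qed.

(** Both words can be rewritten as ascending words of their common permutation,
    and ascending words of the same permutation are equal in the group. *)
Lemma coxeter_complete w w' : word_perm w =1 word_perm w' -> ceq w w'.
Proof.
move=> e; have [x ax wx] := ceq_ascending w; have [x' ax' wx'] := ceq_ascending w'.
apply: (coxeter_trans wx); apply: (coxeter_trans _ (coxeter_sym wx')).
apply: ascending_uniq => // k.
by rewrite -(coxeter_sound wx) -(coxeter_sound wx').
Qed.

(** Sorting such a permutation never uses the letter [i], since a descent at [i]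
    moves a point across the end of the half-line. *)
Lemma preserves_parabolic w i : preserves i (word_perm w) ->
  exists2 u, all (predC1 i) u & ceq w u.
Proof.
move=> hw; have [u [c [au ue pu]]] := adm_ascending (adm_word w).
exists u; first exact: pu.
apply: coxeter_complete => k; rewrite ue.
have := charge_word w; rewrite (eq_charge ue) charge_shift charge_word; nia.
Qed.

(** The parabolic subgroup of the vertex [i] is the stabilizer of the half-line
    [> i], so its cosets correspond to the images of that half-line. *)
Lemma coxeter_vertexP w w' i : coxeter_vertex m w i = coxeter_vertex m w' i <->
  preserves i (word_perm (rev w ++ w')).
Proof.
split=> [e|/preserves_parabolic[u ui wu]].
  have : coxeter_vertex m w' i w'.
    by exists [::] => //; rewrite cats0; exact: coxeter_refl.
  rewrite -e => -[u ui /coxeter_sound wu] k.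
  rewrite -[RHS](preserves_word ui); congr (_ < _).
  by rewrite word_perm_cat -wu word_perm_cat word_perm_revK.
have sub w1 w2 u1 : all (predC1 i) u1 -> ceq (w1 ++ u1) w2 ->
    coxeter_vertex m w2 i `<=` coxeter_vertex m w1 i.
  move=> u1i wu1 v [u2 u2i wu2]; exists (u1 ++ u2); first by rewrite all_cat u1i.
  by rewrite catA; apply: coxeter_trans wu2; exact: (ceq_ctx [::] u2 wu1).
have c : ceq w' (w ++ u).
  apply: coxeter_trans _ (ceq_catl w wu); rewrite catA; apply: coxeter_sym.
  exact: (ceq_ctx [::] w' (ceq_revr w)).
rewrite eqEsubset; split.
  apply: (sub _ _ (rev u)); first by rewrite all_rev.
  apply: coxeter_trans (ceq_ctx [::] (rev u) c) _; rewrite /= -catA.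
  by have := ceq_catl w (ceq_revr u); rewrite cats0.
by apply: (sub _ _ u) => //; exact: coxeter_sym.
Qed.

(** For [i] different from [i'], the generator [i'] belongs to the parabolic
    subgroup of the vertex [i] and not to that of the vertex [i']. *)
Lemma coxeter_vertex_type w w' i i' :
  coxeter_vertex m w i = coxeter_vertex m w' i' -> i = i'.
Proof.
move=> e; apply/eqP/negPn/negP => ii'.
have [u1 h1 /coxeter_sound c1] : coxeter_vertex m w' i' w.
  by rewrite -e; exists [::] => //; rewrite cats0; exact: coxeter_refl.
have [u2 h2 /coxeter_sound c2] : coxeter_vertex m w' i' (w ++ [:: i']).
  rewrite -e; exists [:: i']; last exact: coxeter_refl.
  by rewrite /= andbT eq_sym.
have := preserves_word h1 i'%:Z; rewrite ltxx.
have : word_perm u1 i'%:Z = word_perm u2 (i'%:Z + 1).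
  apply: (bij_inj (adm_word w').1); rewrite -!word_perm_cat c1 c2.
  by rewrite word_perm_cat /= tr_r.
move=> ->; rewrite (preserves_word h2); lia.
Qed.

End AffinePermutations.

(** * Uniqueness of Fourier coefficients *)

Section FourierUniqueness.
Variable R : realType.
Local Notation T := (measurableTypeR R).
Local Notation C := R[i].
Local Notation mu := (circle_measure R).
Local Notation leb := (@lebesgue_measure R).
Local Notation D := (`[0, (2 * pi)%R]%classic : set R).

Let mD : measurable (D : set T). Proof. exact: measurable_itv. Qed.

Lemma circle_measureE A : mu A = leb (A `&` D).
Proof. by []. Qed.

Lemma circle_measureC : mu (~` D) = 0.
Proof. by rewrite circle_measureE setICl measure0. Qed.

Lemma circle_integral (A : set T) (f : T -> \bar R) :
  A `<=` D -> (\int[mu]_(x in A) f x = \int[leb]_(x in A) f x)%E.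
Proof.
move=> AD; apply: eq_measure_integral => B mB BA.
by rewrite circle_measureE setIidl//; exact: subset_trans AD.
Qed.

Lemma circle_integralT (u : T -> R) : mu.-integrable setT (EFin \o u) ->
  (\int[mu]_x (u x)%:E = \int[leb]_(x in D) (u x)%:E)%E.
Proof.
move=> iu.
rewrite -circle_integral//.
rewrite (negligible_integral (measurableC mD) measurableT iu (circle_measureC)).
by rewrite setDE setCK setTI.
Qed.

Lemma circle_FTC (f F : R^o -> R^o) : continuous f ->
  (forall x : R^o, is_derive x (1 : R^o) F (f x)) -> mu.-integrable setT (EFin \o f) ->
  (\int[mu]_x f x)%R = F (2 * pi) - F 0.
Proof.
move=> cf dF fi.
have cF x : {for x, continuous F}.
  apply/differentiable_continuous/derivable1_diffP.
  by apply: ex_derive; exact: dF.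
rewrite /Rintegral (circle_integralT fi).
rewrite (@continuous_FTC2 _ f F)//.
- by rewrite mulr_gt0// pi_gt0.
- by apply: continuous_subspaceT.
- split; [|exact/cvg_at_right_filter/cF|exact/cvg_at_left_filter/cF].
  by move=> x _; apply: ex_derive; exact: dF.
- by move=> x _; rewrite derive1E; apply: derive_val; exact: dF.
Qed.

Lemma circle_integrable (f : T -> R) : mu.-integrable setT (EFin \o f) ->
  leb.-integrable D (EFin \o f).
Proof.
move=> fi; have /integrableP[mf lf] : mu.-integrable D (EFin \o f).
  by apply: integrableS fi.
by apply/integrableP; split=> //; rewrite -circle_integral.
Qed.

Lemma circle_ae (P : T -> Prop) : {ae leb, forall x, 0 < x < 2 * pi -> P x} ->
  {ae mu, forall x, P x}.
Proof.
move=> [N [mN N0 sub]].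
have mI : measurable (`]0, (2 * pi)%R[%classic : set T) by exact: measurable_itv.
exists (N `|` ~` `]0, (2 * pi)%R[%classic); split.
- by apply: measurableU => //; exact: measurableC.
- have pi0 : (0 : R) < 2 * pi by rewrite mulr_gt0// pi_gt0.
  have U A B : measurable A -> measurable B -> (leb (A `|` B) <= leb A + leb B)%E.
    by move=> mA mB; exact: measureU2.
  suff : leb ((N `|` ~` `]0, (2 * pi)%R[) `&` D) = 0 by [].
  apply/eqP; rewrite -measure_le0.
  rewrite (_ : _ `&` D = (N `&` D) `|` [set 0; 2 * pi]%classic).
    rewrite (le_trans (U _ _ _ _))//; first exact: measurableI.
      by apply: measurableU; exact: measurable_set1.
    rewrite (_ : leb (N `&` D) = 0) ?add0e; last first.
      apply/eqP; rewrite -measure_le0 -[leRHS]N0.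
      by apply: le_measure; rewrite ?inE//; exact: measurableI.
    rewrite (le_trans (U _ _ _ _))//; try exact: measurable_set1.
    by rewrite !lebesgue_measure_set1 adde0.
  rewrite setIUl; congr (_ `|` _).
  apply/seteqP; split => x /=; rewrite !in_itv/=.
    move=> [/negP + /andP[x0 x2]]; rewrite !lt_neqAle x0 x2 !andbT negb_and !negbK.
    by case/orP => /eqP ->; [left|right].
  by case=> ->; rewrite ltxx ?andbF/= lexx ltW.
- move=> x /= nPx; have [xI|xI] := pselect (0 < x < 2 * pi).
    by left; apply: sub => /(_ xI).
  by right; rewrite in_itv.
Qed.

(** By the Lebesgue differentiation theorem, [u] is almost everywhere the limit
    of its averages over arcs. *)
Lemma arcs_null (u : T -> R) : mu.-integrable setT (EFin \o u) ->
  (forall x d : R, 0 < d -> 0 < x - d -> x + d < 2 * pi ->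
    (\int[mu]_(y in ball x d) (u y)%:E = 0)%E) ->
  {ae mu, forall x, u x = 0}.
Proof.
move=> iu arc; apply: circle_ae.
pose g := u \_ D.
have ig : leb.-integrable setT (EFin \o g).
  have := circle_integrable iu.
  by rewrite integrable_mkcond// /g restrict_EFin.
have := lebesgue_differentiation (open_integrable_locally openT ig).
pose E (x : R) (k : nat) : set R := ball x k.+1%:R^-1.
have hE x : nicely_shrinking x (E x).
  split; first by move=> k; exact: measurable_ball.
  exists (1, fun k => (k.+1%:R^-1)%:pos); split => //=.
    exact: cvg_harmonic.
    by move=> k y.
  by move=> k; rewrite mul1e.
apply: filterS; first exact: (ae_filter_ringOfSetsType leb).
move=> x px /andP[x0 x2].
have := nice_lebesgue_differentiation hE (open_integrable_locally openT ig) px.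
set s := (X in X @ _ --> _) => sg.
have s0 : s @ \oo --> 0%E.
  apply: cvg_near_cst.
  have e0 : 0 < Num.min x (2 * pi - x) by rewrite lt_min x0 subr_gt0.
  near=> k.
  have kx : k.+1%:R^-1 < Num.min x (2 * pi - x).
    by near: k; exact: (near_infty_natSinv_lt (PosNum e0)).
  move: kx; rewrite lt_min => /andP[k1 k2].
  rewrite /s (_ : (\int[_]_(y in _) _ = 0)%E) ?mule0//.
  rewrite -[RHS](arc x k.+1%:R^-1)//; first last.
  - by rewrite -ltrBrDl.
  - by rewrite subr_gt0.
  have sub : ball x k.+1%:R^-1 `<=` D.
    move=> y; rewrite ball_itv /= !in_itv/= => /andP[y1 y2].
    apply/andP; split; apply: ltW.
      by apply: lt_trans y1; rewrite subr_gt0.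
    by apply: lt_trans y2 _; rewrite -ltrBrDl.
  rewrite circle_integral//; apply: eq_integral => y /set_mem yb.
  by rewrite /g patchE mem_set//; exact: sub.
have e : (g x)%:E = 0%E by exact: (cvg_unique (@ereal_hausdorff R) sg s0).
have {}e : g x = 0 by apply/eqP; rewrite -eqe e.
by move: e; rewrite /g patchE mem_set//= in_itv/= !ltW.
Unshelve. all: by end_near. Qed.

(** On [0, 1] these polynomials converge to 1 below [1/2] and to 0 above, so that
    composing them with [bump] gives bounded trigonometric polynomials which
    converge to the indicator function of an arc. *)
Definition step m (t : R) : R := (1 - t ^+ m) ^+ (2 ^ m).

Lemma step_itv m t : 0 <= t <= 1 -> 0 <= step m t <= 1.
Proof.
move=> /andP[t0 t1]; rewrite /step.
have h0 : 0 <= t ^+ m by exact: exprn_ge0.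
have h1 : t ^+ m <= 1 by exact: exprn_ile1.
by rewrite exprn_ge0 ?subr_ge0// exprn_ile1 ?subr_ge0// gerBl.
Qed.

Lemma step_cvg1 t : 0 <= t < 2^-1 -> step m t @[m --> \oo] --> (1 : R).
Proof.
move=> /andP[t0 t1].
apply: (@squeeze_cvgr _ _ _ _ (fun m => 1 - (2 * t) ^+ m) (fun=> 1)); last 2 first.
- rewrite -[X in _ --> X]subr0; apply: cvgB; first exact: cvg_cst.
  by apply: cvg_expr; rewrite ger0_norm ?mulr_ge0//; lra.
- exact: cvg_cst.
apply: nearW => m; have ti : 0 <= t <= 1 by lra.
have /andP[_ ->] := step_itv m ti; rewrite andbT /step exprMn -natrX.
have s0 : 0 <= t ^+ m by exact: exprn_ge0.
have s1 : t ^+ m <= 1 by apply: exprn_ile1; lra.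
elim: (2 ^ m)%N => [|N IH]; first by rewrite mul0r expr0 subr0.
have s2 : 0 <= 1 - t ^+ m by rewrite subr_ge0.
have := ler_wpM2l s2 IH; rewrite exprS -natr1; have : 0 <= N%:R :> R by [].
move: (t ^+ m) ((1 - _) ^+ N) s0 s1 s2 => s P s0 s1 s2; nra.
Qed.

Lemma step_cvg0 t : 2^-1 < t <= 1 -> step m t @[m --> \oo] --> (0 : R).
Proof.
move=> /andP[t0 t1].
apply: (@squeeze_cvgr _ _ _ _ (fun=> 0) (fun m => ((2 * t)^-1) ^+ m)); last 2 first.
- exact: cvg_cst.
- apply: cvg_expr; rewrite ger0_norm ?invr_ge0 ?mulr_ge0//; last by lra.
  by rewrite invf_lt1; lra.
apply: nearW => m; have ti : 0 <= t <= 1 by lra.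
have /andP[-> _] := step_itv m ti; rewrite /= exprVn exprMn -natrX.
have s0 : 0 < t ^+ m by apply: exprn_gt0; lra.
have s1 : t ^+ m <= 1 by apply: exprn_ile1; lra.
have pos : 0 < (2 ^ m)%:R * t ^+ m :> R by rewrite mulr_gt0// ltr0n expn_gt0.
rewrite -[leRHS]mul1r ler_pdivlMr// /step.
apply: (@le_trans _ _ ((1 - t ^+ m) ^+ (2 ^ m) * (1 + (2 ^ m)%:R * t ^+ m))).
  by rewrite ler_wpM2l ?exprn_ge0 ?subr_ge0// lerDr.
elim: (2 ^ m)%N => [|N IH]; first by rewrite mul0r expr0 addr0 mulr1.
apply: le_trans IH; rewrite exprS -natr1 mulrAC [_ * (1 - _) ^+ N]mulrC.
rewrite ler_wpM2l ?exprn_ge0 ?subr_ge0//.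
by have : 0 <= N%:R :> R by []; nra.
Qed.

(** [bump x d] is a trigonometric polynomial which is less than 1/2 exactly
    on the arc of radius [d] around [x]. *)
Definition bump (x d y : R) : R := 2^-1 + (cos d - cos (y - x)) / 4.

Lemma bump_itv x d y : 0 <= bump x d y <= 1.
Proof.
have := cos_le1 d; have := cos_geN1 d.
have := cos_le1 (y - x); have := cos_geN1 (y - x); rewrite /bump; lra.
Qed.

Lemma measurable_bump x d : measurable_fun setT (bump x d : T -> R).
Proof.
apply: measurable_funD; first exact: measurable_cst.
apply: measurable_funM; last exact: measurable_cst.
apply: measurable_funB; first exact: measurable_cst.
apply: (@measurableT_comp _ _ _ _ _ _ (@cos R)).
  by apply: continuous_measurable_fun; exact: continuous_cos.
by apply: measurable_funB; [exact: measurable_id|exact: measurable_cst].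
Qed.

Lemma arc_step (u : T -> R) (x d : R) : mu.-integrable setT (EFin \o u) ->
  0 < d -> 0 < x - d -> x + d < 2 * pi ->
  (forall m, (\int[mu]_y (u y * step m (bump x d y)))%R = 0) ->
  (\int[mu]_(y in ball x d) (u y)%:E = 0)%E.
Proof.
move=> iu d0 xd dx hu.
pose f_ m (y : T) := (u y * step m (bump x d y))%:E.
have mstep m : measurable_fun setT (fun y : T => step m (bump x d y)).
  apply: measurable_funX; apply: measurable_funB; first exact: measurable_cst.
  by apply: measurable_funX; exact: measurable_bump.
have mu_ : measurable_fun setT u by case/integrableP: iu => /measurable_EFinP.
have mf_ m : measurable_fun setT (f_ m).
  by apply/measurable_EFinP; exact: measurable_funM.
have mB : measurable (ball x d : set T) by exact: measurable_ball.
have mf : measurable_fun setT ((EFin \o u) \_ (ball x d)).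
  apply/(measurable_restrictT _ _).1 => //; apply: measurable_funTS.
  exact/measurable_EFinP.
have cvf : {ae mu, forall y, setT y -> f_ ^~ y @ \oo --> ((EFin \o u) \_ (ball x d)) y}.
  apply: circle_ae.
  have : (lebesgue_measure.-negligible [set x - d; x + d] : Prop).
    apply: negligibleU; apply/negligibleP; try exact: measurable_set1.
      exact: lebesgue_measure_set1.
    exact: lebesgue_measure_set1.
  move=> [N [mN N0 sub]]; exists N; split=> //.
  apply: subset_trans sub => y /= /not_implyP[/andP[y0 y2]].
  apply: contra_notP => /not_orP[yd1 yd2] _.
  have lim (l : R) : step m (bump x d y) @[m --> \oo] --> l ->
      f_ ^~ y @ \oo --> (u y * l)%:E.
    move=> h; apply: cvg_EFin; first by exact: nearW.
    by apply: cvgM => //; exact: cvg_cst.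
  have /andP[b0 b1] := bump_itv x d y; have Pi := @pi_gt0 R.
  have c0 : bump x d y < 2^-1 <-> cos d < cos `|y - x|.
    by rewrite cos_norm /bump; split; lra.
  have c1 : 2^-1 < bump x d y <-> cos `|y - x| < cos d.
    by rewrite cos_norm /bump; split; lra.
  rewrite patchE; case: ifPn => [/set_mem|/negP yB].
    rewrite ball_itv /= in_itv /= => /andP[yl yr].
    rewrite /= -[X in X%:E]mulr1; apply: lim; apply: step_cvg1.
    rewrite b0/=; apply/c0; rewrite ltr_cos ?in_itv/=.
    - by rewrite ltr_norml; apply/andP; split; lra.
    - by rewrite ?normr_ge0/= ?ler_norml; apply/andP; split; lra.
    - by rewrite ?normr_ge0/= ?ler_norml; apply/andP; split; lra.
  have dyx : d < `|y - x|.
    rewrite lt_neqAle; apply/andP; split.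
      apply/eqP => e; have [h|h] := leP 0 (y - x).
        by apply: yd2; move: e; rewrite ger0_norm//; lra.
      by apply: yd1; move: e; rewrite ltr0_norm//; lra.
    rewrite leNgt; apply/negP => h; apply: yB; apply/mem_set.
    rewrite ball_itv /= in_itv /=; move: h; rewrite ltr_norml => /andP[h1 h2].
    by apply/andP; split; lra.
  have yx2 : `|y - x| < 2 * pi - d by rewrite ltr_norml; apply/andP; split; lra.
  rewrite -[X in _ --> X]/(0%:E) -(mulr0 (u y)); apply: lim; apply: step_cvg0.
  rewrite b1 andbT; apply/c1.
  have [yp|yp] := leP `|y - x| pi.
    rewrite ltr_cos ?in_itv/= ?yp ?andbT//.
    by apply/andP; split; lra.
  rewrite -(cosN `|y - x|) -cosD2pi mulr2n.
  rewrite ltr_cos ?in_itv/=; first by lra.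
  - by apply/andP; split; lra.
  - by apply/andP; split; lra.
have dom : {ae mu, forall y m, setT y -> (`|f_ m y| <= `|(u y)%:E|)%E}.
  apply: aeW => y m _; rewrite /f_ abse_EFin abse_EFin lee_fin normrM ler_piMr//.
  have /andP[s0 s1] := step_itv m (bump_itv x d y).
  by rewrite ger0_norm.
have [_ _] := dominated_convergence measurableT mf_ mf cvf
  (integrable_abse iu) dom.
rewrite -integral_mkcond => lim.
have z m : (\int[mu]_y f_ m y = 0)%E.
  apply/eqP; rewrite -[X in X == _]fineK; last first.
    apply: integrable_fin_num => //.
    have := integrableMl measurableT iu (mstep m); apply.
    exists 1; split=> // M M1 y _ /=.
    have /andP[s0 s1] := step_itv m (bump_itv x d y).
    by rewrite ger0_norm// (le_trans s1)// ltW.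
  by rewrite eqe; apply/eqP; exact: hu.
have e0 : (fun m => \int[mu]_y f_ m y)%E @ \oo --> 0%E.
  by under eq_fun do rewrite z; exact: cvg_cst.
exact: (cvg_unique (@ereal_hausdorff R) lim e0).
Qed.

Lemma cisD (s t : R) : cis (s + t) = cis s * cis t.
Proof. by rewrite /cis cosD sinD; congr (_ +i* _); rewrite addrC [X in _ + X]mulrC. Qed.

Lemma cis0 : cis (0 : R) = 1.
Proof. by rewrite /cis cos0 sin0. Qed.

Lemma cisN (t : R) : cis (- t) = Num.conj (cis t).
Proof. by rewrite /cis cosN sinN. Qed.

Lemma cis_cos (t : R) : (cos t)%:C = (2^-1)%:C * (cis t + cis (- t)).
Proof.
rewrite cisN /cis; apply/eqP; rewrite eq_complex /=; apply/andP; split.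
  by apply/eqP; field.
by apply/eqP; ring.
Qed.

Lemma CintegrableD (a : C) (f g : T -> C) : Cintegrable f -> Cintegrable g ->
  Cintegrable (fun x => a * f x + g x).
Proof.
case: a => a b [rf jf] [rg jg].
have iZ c (u : T -> R) : mu.-integrable setT (EFin \o u) ->
    mu.-integrable setT (EFin \o (fun x => c * u x)).
  by move=> hu; exact: (integrableZl measurableT c hu).
have iD (u v : T -> R) : mu.-integrable setT (EFin \o u) ->
    mu.-integrable setT (EFin \o v) ->
    mu.-integrable setT (EFin \o (fun x => u x + v x)).
  by move=> hu hv; exact: (integrableD measurableT hu hv).
split.
  rewrite (_ : (fun x => complex.Re ((a +i* b) * f x + g x)) =
    fun x => (a * complex.Re (f x) + (- b) * complex.Im (f x)) + complex.Re (g x)).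
    exact: iD (iD _ _ (iZ _ _ _) (iZ _ _ _)) _.
  by apply/funext => x; case: (f x) (g x) => [u v] [u' v'] /=; rewrite mulNr.
rewrite (_ : (fun x => complex.Im ((a +i* b) * f x + g x)) =
  fun x => (a * complex.Im (f x) + b * complex.Re (f x)) + complex.Im (g x)).
  exact: iD (iD _ _ (iZ _ _ _) (iZ _ _ _)) _.
by apply/funext => x; case: (f x) (g x) => [u v] [u' v'] /=.
Qed.

Lemma integrable_bounded (h u : T -> R) : measurable_fun setT h ->
  (forall x, `|h x| <= 1) -> mu.-integrable setT (EFin \o u) ->
  mu.-integrable setT (EFin \o (fun x => h x * u x)).
Proof.
move=> mh h1 iu; have := integrableMr measurableT mh _ iu; apply.
by exists 1; split=> // M M1 y _ /=; rewrite (le_trans (h1 y))// ltW.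
Qed.

Lemma Cintegrable_cis k (f : T -> C) : Cintegrable f ->
  Cintegrable (fun x => f x * cis (k * x)).
Proof.
have mk : measurable_fun setT (fun x : T => k * x) by exact: measurable_funM.
have mc : measurable_fun setT (fun x : T => cos (k * x)).
  by apply: (@measurableT_comp _ _ _ _ _ _ (@cos R)) => //;
    apply: continuous_measurable_fun; exact: continuous_cos.
have ms : measurable_fun setT (fun x : T => sin (k * x)).
  by apply: (@measurableT_comp _ _ _ _ _ _ (@sin R)) => //;
    apply: continuous_measurable_fun; exact: continuous_sin.
have c1 x : `|cos (k * x)| <= 1 by rewrite ler_norml cos_geN1 cos_le1.
have s1 x : `|sin (k * x)| <= 1 by rewrite ler_norml sin_geN1 sin_le1.
move=> [rf jf]; split.
  have := integrableB measurableT (integrable_bounded mc c1 rf)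
    (integrable_bounded ms s1 jf).
  rewrite (_ : (fun _ => _) =
    EFin \o (fun x => complex.Re (f x * cis (k * x))))//.
  apply/funext => x /=; rewrite -EFinB; congr EFin; case: (f x) => [u v] /=.
  by rewrite mulrC [v * _]mulrC.
have := integrableD measurableT (integrable_bounded ms s1 rf)
  (integrable_bounded mc c1 jf).
rewrite (_ : (fun _ => _) =
  EFin \o (fun x => complex.Im (f x * cis (k * x))))//.
apply/funext => x /=; rewrite -EFinD; congr EFin; case: (f x) => [u v] /=.
by rewrite mulrC [v * _]mulrC.
Qed.

Definition fourier_null (f : T -> C) := Cintegrable f /\
  forall k : int, Cintegral (fun x => f x * cis (k%:~R * x)) = 0.

Lemma fourier_nullD a f g : fourier_null f -> fourier_null g ->
  fourier_null (fun x => a * f x + g x).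
Proof.
move=> [fi f0] [gi g0]; split=> [|k]; first exact: CintegrableD.
have := CintegralD a (Cintegrable_cis k%:~R fi) (Cintegrable_cis k%:~R gi).
rewrite f0 g0 mulr0 addr0 => e; rewrite -[RHS]e.
by congr Cintegral; apply/funext => x; rewrite mulrDl mulrA.
Qed.

Lemma fourier_null_cis j f : fourier_null f ->
  fourier_null (fun x => f x * cis (j%:~R * x)).
Proof.
move=> [fi f0]; split=> [|k]; first exact: Cintegrable_cis.
rewrite -(f0 (j + k)); congr Cintegral; apply/funext => x.
by rewrite -mulrA -cisD -mulrDl intrD.
Qed.

Lemma fourier_null_bump x d f : fourier_null f ->
  fourier_null (fun y => f y * (bump x d y)%:C).
Proof.
move=> hf; have h1 := fourier_null_cis 1 hf; have hN1 := fourier_null_cis (-1) hf.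
have h0 : fourier_null (fun=> 0).
  have := fourier_nullD (-1) hf hf.
  by rewrite (_ : (fun _ => _) = fun=> 0)//; apply/funext => y; rewrite mulN1r addNr.
have := fourier_nullD (- ((8^-1)%:C * cis x)) hN1
  (fourier_nullD (- ((8^-1)%:C * cis (- x))) h1
  (fourier_nullD ((2^-1 + cos d / 4)%:C) hf h0)).
rewrite (_ : (fun _ => _) = fun y => f y * (bump x d y)%:C)//.
apply/funext => y.
have -> : bump x d y = (2^-1 + cos d / 4) - 4^-1 * cos (y - x).
  by rewrite /bump; field.
rewrite rmorphB /= rmorphM /= cis_cos opprB !cisD mulN1r mul1r addr0.
have -> : (8^-1)%:C = (4^-1)%:C * (2^-1)%:C :> C.
  by rewrite -rmorphM /=; congr (_%:C); field.
by ring.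
Qed.

Definition preserves_null (h : T -> R) :=
  forall f, fourier_null f -> fourier_null (fun y => f y * (h y)%:C).

Lemma preserves_nullX h m : preserves_null h -> preserves_null (fun y => h y ^+ m).
Proof.
move=> hh f hf; elim: m => [|m IH].
  by rewrite (_ : (fun _ => _) = f)//; apply/funext => y; rewrite expr0 mulr1.
have := hh _ IH; rewrite (_ : (fun _ => _) = fun y => f y * (h y ^+ m.+1)%:C)//.
by apply/funext => y; rewrite exprSr rmorphM mulrA.
Qed.

Lemma preserves_null1B h : preserves_null h -> preserves_null (fun y => 1 - h y).
Proof.
move=> hh f hf; have := fourier_nullD (-1) (hh _ hf) hf.
rewrite (_ : (fun _ => _) = fun y => f y * (1 - h y)%:C)//.
by apply/funext => y; rewrite rmorphB /= mulrBr mulr1 mulN1r addrC.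
Qed.

Lemma preserves_null_step x d m : preserves_null (fun y => step m (bump x d y)).
Proof.
apply/preserves_nullX/preserves_null1B/preserves_nullX.
exact: fourier_null_bump.
Qed.

Lemma fourier_null_Re f : fourier_null f -> {ae mu, forall x, complex.Re (f x) = 0}.
Proof.
move=> hf; have [[rf _] _] := hf; apply: arcs_null => // x d d0 xd dx.
apply: arc_step => // m; have [_ /(_ 0)] := preserves_null_step x d m hf.
rewrite /Cintegral => -[h _]; rewrite -[RHS]h; congr Rintegral; apply/funext => y.
by rewrite mul0r cis0 mulr1; case: (f y) => a b /=; rewrite mulr0 subr0.
Qed.

(** Fourier coefficients determine an integrable function: its integrals
    over arcs are limits of its integrals against trigonometric polynomials,
    and an integrable function with vanishing integrals over arcs is zero. *)
Lemma fourier_unique f : fourier_null f -> {ae mu, forall x, f x = 0}.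
Proof.
move=> hf; have hr := fourier_null_Re hf.
have hi : {ae mu, forall x, complex.Re (- 'i * f x) = 0}.
  apply: fourier_null_Re.
  have := fourier_nullD (-1 - 'i) hf hf.
  by rewrite (_ : (fun _ => _) = fun x => - 'i * f x)//; apply/funext => y; ring.
apply: filterS2 hr hi => x.
case: (f x) => a b /= -> h; congr (_ +i* _).
by move: h; rewrite mulr0 mulN1r opprK add0r.
Qed.

End FourierUniqueness.

(** * Completeness of the space of square integrable functions *)

Section RieszFischer.
Variable R : realType.
Local Notation T := (measurableTypeR R).
Local Notation C := R[i].
Local Notation mu := (circle_measure R).

Lemma circle_finite : (mu setT < +oo)%E.
Proof.
suff : (@lebesgue_measure R (setT `&` `[0%R, (2 * pi)%R]) < +oo)%E by [].
by rewrite setTI lebesgue_measure_itv/=; case: ifP => _; rewrite ?ltry// -EFinB ltry.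
Qed.

Lemma Lfun2P (h : T -> R) : measurable_fun setT h ->
  (\int[mu]_x ((h x) ^+ 2)%:E < +oo)%E -> h \in Lfun mu 2%:E.
Proof.
move=> mh lt; rewrite inE; apply/andP; split; rewrite inE//=.
rewrite /finite_norm unlock poweR_lty//.
rewrite (eq_integral (fun x => (h x ^+ 2)%:E))// => x _ /=.
by congr EFin; rewrite powR_mulrn// real_normK ?num_real.
Qed.

Lemma Lfun2_measurable (h : T -> R) : h \in Lfun mu 2%:E -> measurable_fun setT h.
Proof. by rewrite inE => /andP[+ _]; rewrite inE. Qed.

Lemma Lfun2_int (h : T -> R) : h \in Lfun mu 2%:E ->
  (\int[mu]_x ((h x) ^+ 2)%:E)%E = ((\int[mu]_x (h x) ^+ 2)%R)%:E.
Proof.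
by move=> /Lfun2_integrable_sqr hh; rewrite fineK//; exact: integrable_fin_num.
Qed.

Lemma Lfun2B (f g : T -> R) : f \in Lfun mu 2%:E -> g \in Lfun mu 2%:E ->
  (fun x => f x - g x) \in Lfun mu 2%:E.
Proof.
move=> hf hg; have := Lfun2D hf (Lfun2Z (-1) hg).
by rewrite (_ : (fun _ => _) = fun x => f x - g x)//; apply/funext => x; rewrite mulN1r.
Qed.

Lemma abs_le_sqr (a x : R) : 0 < a -> `|x| <= (a * x ^+ 2 + a^-1) / 2.
Proof.
move=> a0; rewrite ler_pdivlMr// -(ler_pM2l a0).
have -> : a * (a * x ^+ 2 + a^-1) = (a * `|x|) ^+ 2 + 1.
  by rewrite exprMn real_normK ?num_real//; field; rewrite gt_eqF.
have := sqr_ge0 (a * `|x| - 1); rewrite sqrrB mulr1 expr1n; lra.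
Qed.

Section Cauchy.
Variables (f : nat -> T -> R) (c : R).
Hypothesis Lf : forall k, f k \in Lfun mu 2%:E.
Hypothesis fC : forall k m, (k <= m)%N ->
  (\int[mu]_x (f m x - f k x) ^+ 2)%R <= c * 4^-1 ^+ k.

Let dif k x := f k.+1 x - f k x.

Let mf k : measurable_fun setT (f k). Proof. exact: Lfun2_measurable. Qed.

Let mdif k : measurable_fun setT (dif k). Proof. exact: measurable_funB. Qed.

Let c0 : 0 <= c.
Proof.
have := fC (leqnn 0); rewrite expr0 mulr1; apply: le_trans.
by apply: Rintegral_ge0 => x _; exact: sqr_ge0.
Qed.

Let int_dif k : (\int[mu]_x `|dif k x|%:E <=
  (((c + fine (mu setT)) / 2) * 2^-1 ^+ k)%:E)%E.
Proof.
have a0 : 0 < 2 ^+ k :> R by exact: exprn_gt0.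
apply: (@le_trans _ _ (\int[mu]_x ((2 ^+ k / 2)%:E * (dif k x ^+ 2)%:E +
    ((2^-1 ^+ k) / 2)%:E))%E).
  apply: ge0_le_integral => //.
  - by apply/measurable_EFinP; exact: measurableT_comp.
  - apply: emeasurable_funD; last exact: measurable_cst.
    by apply/measurable_EFinP; apply: measurable_funM => //; exact: measurable_funX.
  - move=> x _; rewrite -EFinM -EFinD lee_fin exprVn (le_trans (abs_le_sqr _ a0))//.
    by rewrite mulrDl mulrAC.
have m2 : measurable_fun setT (fun x => (dif k x ^+ 2)%:E).
  by apply/measurable_EFinP; exact: measurable_funX.
rewrite ge0_integralD//; last 2 first.
- by move=> x _; rewrite -EFinM lee_fin mulr_ge0// ?sqr_ge0// divr_ge0// ltW.
- by apply/measurable_EFinP; apply: measurable_funM => //; exact: measurable_funX.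
rewrite ge0_integralZl//; last by move=> x _; rewrite lee_fin sqr_ge0.
rewrite integral_cst// Lfun2_int; last exact: Lfun2B.
have fm : mu setT \is a fin_num by rewrite ge0_fin_numE//; exact: circle_finite.
rewrite -[X in (_ + _ * X)%E](fineK fm) -!EFinM -EFinD lee_fin.
have := fC (leqnSn k); move: (\int[mu]_x _)%R => I hI.
have -> : (c + fine (mu setT)) / 2 * 2^-1 ^+ k =
    2 ^+ k / 2 * (c * 4^-1 ^+ k) + 2^-1 ^+ k / 2 * fine (mu setT).
  have -> : 2^-1 ^+ k = 2 ^+ k * 4^-1 ^+ k :> R by rewrite -exprMn; congr (_ ^+ _); field.
  by field.
by rewrite lerD2r ler_wpM2l// divr_ge0// ltW.
Qed.

Let cvg_ae : {ae mu, forall x, cvgn (f ^~ x)}.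
Proof.
have fm : mu setT \is a fin_num by rewrite ge0_fin_numE//; exact: circle_finite.
set K := (c + fine (mu setT)) / 2.
have K0 : 0 <= K by rewrite divr_ge0// addr_ge0// fine_ge0.
have geo : (\sum_(k <oo) (K * 2^-1 ^+ k)%:E < +oo :> \bar R)%E.
  apply: (@le_lt_trans _ _ (K * (1 - 2^-1)^-1)%:E); last exact: ltry.
  apply: lime_le.
    by apply: is_cvg_nneseries => k _ _; rewrite lee_fin mulr_ge0 ?exprn_ge0.
  apply: nearW => m; rewrite sumEFin lee_fin.
  have := @geometric_le_lim R m K 2^-1 K0; apply; first by lra.
  by rewrite ger0_norm; lra.
have mS : measurable_fun setT (fun x => (\sum_(k <oo) `|dif k x|%:E)%E).
  apply: ge0_emeasurable_sum => [k x _ _|k _]; first by rewrite lee_fin.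
  by apply/measurable_EFinP; exact: measurableT_comp.
have iS : mu.-integrable setT (fun x => (\sum_(k <oo) `|dif k x|%:E)%E).
  apply/integrableP; split=> //; apply: le_lt_trans geo.
  under eq_integral do rewrite gee0_abs ?nneseries_ge0//.
  rewrite integral_nneseries//.
    apply: lee_nneseries => [k _ _|k _]; last exact: int_dif.
    by apply: integral_ge0 => x _; rewrite lee_fin.
  by move=> k; apply/measurable_EFinP; exact: measurableT_comp.
have := integrable_ae measurableT iS; apply: filterS => x /(_ I) fin.
have cs : cvgn (series (fun k => dif k x : R^o)).
  apply: normed_cvg; apply: nnseries_is_cvg => [k|]; first exact: normr_ge0.
  by rewrite ltey_eq fin.
have -> : f ^~ x = (fun k => f 0%N x + series (fun k => dif k x) k).
  apply/funext => k; rewrite /series /dif /= GRing.telescope_sumr//.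
  by rewrite addrC subrK.
by apply: is_cvgD => //; exact: is_cvg_cst.
Qed.

Let g (x : T) : R := fine (limn_esup (fun k => (f k x)%:E)).

Let mg : measurable_fun setT g.
Proof.
apply: (@measurableT_comp _ _ _ _ _ _ (@fine R)) => //.
by apply: measurable_fun_limn_esup => k; exact/measurable_EFinP.
Qed.

Let gE x : cvgn (f ^~ x) -> f ^~ x @ \oo --> g x.
Proof.
move=> /cvg_ex[l fl]; have h : (fun k => (f k x)%:E) @ \oo --> l%:E.
  by apply: cvg_EFin fl; exact: nearW.
by rewrite /g (cvg_limn_einf_sup h).2.
Qed.

Let dist_le k : (\int[mu]_x ((g x - f k x) ^+ 2)%:E <= (c * 4^-1 ^+ k)%:E)%E.
Proof.
pose F m (x : T) := ((f (k + m)%N x - f k x) ^+ 2)%:E.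
have mF m : measurable_fun setT (F m).
  by apply/measurable_EFinP; apply: measurable_funX; exact: measurable_funB.
have F0 m x : setT x -> (0 <= F m x)%E by rewrite lee_fin sqr_ge0.
have -> : (\int[mu]_x ((g x - f k x) ^+ 2)%:E = \int[mu]_x limn_einf (F ^~ x))%E.
  apply: ge0_ae_eq_integral => //.
  - by apply/measurable_EFinP; apply: measurable_funX; exact: measurable_funB.
  - rewrite /limn_einf; apply: measurableT_comp => //.
    apply: measurable_fun_limn_esup => m; exact: measurableT_comp.
  - by move=> x _; rewrite lee_fin sqr_ge0.
  - move=> x _; rewrite limn_einf_lim; apply: lime_ge; first exact: is_cvg_einfs.
    by apply: nearW => m; apply: le_ereal_inf_tmp => _ [j _ <-]; exact: F0.
  apply: filterS cvg_ae => x /gE fg _.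
  have h : F ^~ x @ \oo --> ((g x - f k x) ^+ 2)%:E.
    rewrite (_ : F ^~ x = fun m =>
      ((f (k + m)%N x - f k x) * (f (k + m)%N x - f k x))%:E) ?expr2; last first.
      by apply/funext => m; rewrite /F expr2.
    apply: cvg_EFin; first exact: nearW.
    have h : (fun m => f (k + m)%N x - f k x) @ \oo --> g x - f k x.
      apply: cvgB; last exact: cvg_cst.
      have := fg; rewrite -(cvg_shiftn k (f ^~ x : R^o ^nat)) /=.
      by under eq_fun do rewrite addnC.
    exact: cvgM.
  by rewrite (cvg_limn_einf_sup h).1.
apply: le_trans (fatou _ measurableT mF F0) _.
rewrite limn_einf_lim; apply: lime_le; first exact: is_cvg_einfs.
apply: nearW => m; apply: le_trans (_ : \int[mu]_x F m x <= _)%E.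
  by apply: ereal_inf_lbound; exists m => /=.
rewrite Lfun2_int ?lee_fin; last exact: Lfun2B.
by apply: fC; exact: leq_addr.
Qed.

(** A sequence which is geometrically Cauchy in the mean converges almost
    everywhere, and Fatou's lemma bounds the distance to the pointwise limit. *)
Lemma Lfun2_complete : exists2 g : T -> R, g \in Lfun mu 2%:E &
  forall k, (\int[mu]_x (g x - f k x) ^+ 2)%R <= c * 4^-1 ^+ k.
Proof.
have L k : (fun x => g x - f k x) \in Lfun mu 2%:E.
  apply: Lfun2P; first exact: measurable_funB.
  exact: le_lt_trans (dist_le k) (ltry _).
exists g => [|k]; last by rewrite -lee_fin -Lfun2_int.
have := Lfun2D (L 0%N) (Lf 0%N).
by rewrite (_ : (fun _ => _) = g)//; apply/funext => x; rewrite subrK.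
Qed.
End Cauchy.

End RieszFischer.

(** * Hilbert space geometry *)

Section Hilbert.
Variables (R : realType) (n : nat).
Local Notation T := (measurableTypeR R).
Local Notation C := R[i].
Local Notation mu := (circle_measure R).
Local Notation H := (L2 R n).
Implicit Types (f g h : H) (a b : C) (t : R) (A : set H).

Lemma inner0l h : inner 0 h = 0.
Proof.
by have := innerDl 1 0 0 h; rewrite scale1r addr0 mul1r -[LHS]addr0 => /addrI.
Qed.

Lemma innerZl a f h : inner (a *: f) h = a * inner f h.
Proof. by rewrite -[a *: f]addr0 innerDl inner0l addr0. Qed.

Lemma innerD f g h : inner (f + g) h = inner f h + inner g h.
Proof. by rewrite -[f]scale1r innerDl mul1r scale1r. Qed.

Lemma innerNl f h : inner (- f) h = - inner f h.
Proof. by rewrite -scaleN1r innerZl mulN1r. Qed.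

Lemma innerBl f g h : inner (f - g) h = inner f h - inner g h.
Proof. by rewrite innerD innerNl. Qed.

Lemma inner_suml I (r : seq I) (P : pred I) (F : I -> H) h :
  inner (\sum_(i <- r | P i) F i) h = \sum_(i <- r | P i) inner (F i) h.
Proof. exact: (big_morph (fun f => inner f h) (fun f g => innerD f g h) (inner0l h)). Qed.

Lemma innerDr f g h : inner h (f + g) = inner h f + inner h g.
Proof. by rewrite ![inner h _]innerC innerD rmorphD. Qed.

Lemma innerZr a f h : inner h (a *: f) = a^* * inner h f.
Proof. by rewrite ![inner h _]innerC innerZl rmorphM. Qed.

Lemma inner_eq0C f g : inner f g = 0 -> inner g f = 0.
Proof. by move=> h; rewrite innerC h rmorph0. Qed.

(** The real part of the inner product makes [H] a real Hilbert space, where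
    distances are estimated. *)
Definition rip f g : R := complex.Re (inner f g).
Definition nsq f : R := rip f f.

Lemma ripC f g : rip f g = rip g f.
Proof. by rewrite /rip innerC; case: (inner g f). Qed.

Lemma ripD f g h : rip (f + g) h = rip f h + rip g h.
Proof. by rewrite /rip innerD; case: (inner f h) (inner g h) => [? ?] []. Qed.

Lemma ripN f h : rip (- f) h = - rip f h.
Proof. by rewrite /rip innerNl; case: (inner f h). Qed.

Lemma ripZ t f h : rip (t%:C *: f) h = t * rip f h.
Proof. by rewrite /rip innerZl; case: (inner f h) => u v /=; rewrite mul0r subr0. Qed.

Lemma ripDr f g h : rip h (f + g) = rip h f + rip h g.
Proof. by rewrite ripC ripD !(ripC h). Qed.

Lemma ripNr f h : rip h (- f) = - rip h f.
Proof. by rewrite ripC ripN (ripC h). Qed.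

Lemma ripZr t f h : rip h (t%:C *: f) = t * rip h f.
Proof. by rewrite ripC ripZ (ripC h). Qed.

Definition ripE := (ripD, ripDr, ripN, ripNr, ripZ, ripZr).

Lemma nsq_ge0 f : 0 <= nsq f.
Proof. by have := inner_ge0 f; rewrite lecE => /andP[]. Qed.

Lemma inner_nsq f : inner f f = (nsq f)%:C.
Proof.
have := inner_ge0 f; rewrite lecE /nsq /rip; case: (inner f f) => a b /= /andP[/eqP e _].
by congr (_ +i* _); lra.
Qed.

Lemma nsq_eq0 f : nsq f = 0 -> f = 0.
Proof. by move=> h; apply: inner_eq0; rewrite inner_nsq h. Qed.

Lemma nsqN f : nsq (- f) = nsq f.
Proof. by rewrite /nsq !ripE opprK. Qed.

Lemma nsqD f g : nsq (f + g) = nsq f + 2 * rip f g + nsq g.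
Proof. by rewrite /nsq !ripE (ripC g f); ring. Qed.

Lemma nsqZ t f : nsq (t%:C *: f) = t ^+ 2 * nsq f.
Proof. by rewrite /nsq !ripE expr2 mulrA. Qed.

Lemma rip_le t f g : 0 < t -> 2 * `|rip f g| <= t * nsq f + t^-1 * nsq g.
Proof.
move=> t0; rewrite -(ler_pM2l t0).
rewrite (_ : t * (t * nsq f + _) = t ^+ 2 * nsq f + nsq g); last first.
  by field; rewrite gt_eqF.
have := nsq_ge0 (t%:C *: f + g); have := nsq_ge0 (t%:C *: f + - g).
rewrite !nsqD nsqN nsqZ !ripE.
by move: (nsq f) (nsq g) (rip f g) => F G r h1 h2; case: ger0P => _; nra.
Qed.

(** The imaginary part of the inner product with [g] is the real part of the one
    with a multiple of [g] by a square root of -1. *)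
Lemma rip_eq0 A f : subspace A -> (forall g, A g -> rip f g = 0) ->
  orthocomplement A f.
Proof.
move=> sA h g Ag; have := h _ Ag; have := h _ (subZ 'i sA Ag).
rewrite /rip innerZr; case: (inner f g) => a b /= e1 e2.
by apply/eqP; rewrite eq_complex /=; apply/andP; split; apply/eqP; lra.
Qed.

Lemma normE f : `|f| = (Num.sqrt (nsq f))%:C.
Proof. by []. Qed.

Lemma norm_lt f (e : R) : 0 < e -> (`|f| < e%:C) = (nsq f < e ^+ 2).
Proof.
move=> e0; rewrite normE ltcR -(@ltr_pXn2r _ 2) ?nnegrE ?sqrtr_ge0 ?ltW//.
by rewrite sqr_sqrtr// nsq_ge0.
Qed.

Definition near_set A f := forall e : R, 0 < e -> exists2 g, A g & nsq (f - g) < e.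

Lemma closureP A f : closure A f <-> near_set A f.
Proof.
split=> [clA e e0|nA B /nbhs_ballP[e /= e0 eB]].
  have s0 : 0 < Num.sqrt e by rewrite sqrtr_gt0.
  have p : 0 < (Num.sqrt e)%:C by rewrite ltcR.
  have [g [Ag]] := clA _ (nbhsx_ballx f _ p).
  by rewrite -ball_normE /= norm_lt// sqr_sqrtr ?ltW// => h; exists g.
have eE : e = (complex.Re e)%:C.
  by case: e {eB} e0 => a b; rewrite ltcE /= => /andP[/eqP h _]; congr (_ +i* _); lra.
have e0' : 0 < complex.Re e by move: e0; rewrite ltcE => /andP[].
have [|g Ag fg] := nA (complex.Re e ^+ 2); first by rewrite exprn_gt0.
by exists g; split=> //; apply: eB; rewrite -ball_normE /= eE norm_lt.
Qed.

Lemma closedP A : closed A <-> forall f, near_set A f -> A f.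
Proof.
split=> [cA f /closureP|h f /closureP]; first exact: cA.
exact: h.
Qed.

Lemma orthocomplement_closed A : closed_subspace (orthocomplement A).
Proof.
split.
  apply/subspaceP; split=> [g _|a f g Af Ag h Ah]; first exact: inner0l.
  by rewrite innerDl Af// Ag// mulr0 addr0.
apply/closedP => f nf g Ag.
have aux (g' : H) : (forall h, orthocomplement A h -> inner h g' = 0) -> rip f g' = 0.
  move=> g'0; apply/eqP/negPn/negP => r0.
  pose s := nsq g' + 1; have s0 : 0 < s by rewrite ltr_wpDl ?nsq_ge0.
  pose r := `|rip f g'|; have r1 : 0 < r by rewrite normr_gt0.
  have [|h /g'0 h0 fh] := nf (r ^+ 2 / s); first by rewrite divr_gt0 ?exprn_gt0.
  have t0 : 0 < s / r by rewrite divr_gt0.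
  have := rip_le (f - h) g' t0.
  rewrite {1}/rip innerBl h0 subr0 -/(rip f g') -/r.
  have : s / r * nsq (f - h) < r.
    by rewrite -ltr_pdivlMl// invf_div (lt_le_trans fh)// expr2 mulrAC.
  have : (s / r)^-1 * nsq g' < r.
    rewrite invf_div mulrAC ltr_pdivrMr//; rewrite ltr_pM2l//.
    by rewrite /s ltrDl.
  lra.
have h1 := aux g (fun h hA => hA g Ag).
have h2 : rip f ('i *: g) = 0.
  by apply: aux => h hA; rewrite innerZr hA// mulr0.
move: h1 h2; rewrite /rip innerZr; case: (inner f g) => a b /= e1 e2.
by apply/eqP; rewrite eq_complex /=; apply/andP; split; apply/eqP; lra.
Qed.

Lemma nsqE (f : L2fun R n) : nsq (\pi_H f) =
  \sum_j ((\int[mu]_x (complex.Re (val f x 0 j)) ^+ 2)%R +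
          (\int[mu]_x (complex.Im (val f x 0 j)) ^+ 2)%R).
Proof.
rewrite /nsq /rip innerE.
rewrite (big_morph (fun z : C => complex.Re z) (id1 := 0) (op1 := +%R))//; last by case=> [? ?] [].
apply: eq_bigr => j _; rewrite /Cintegral /=.
have [rf jf] := L2funP f j.
rewrite -RintegralD//; try exact: Lfun2_integrable_sqr.
congr Rintegral; apply/funext => x; case: (val f x 0 j) => a b /=.
by rewrite mulrN opprK !expr2.
Qed.

Lemma L2_complete (u : nat -> H) (c : R) :
  (forall k m, (k <= m)%N -> nsq (u m - u k) <= c * 4^-1 ^+ k) ->
  exists l c', forall k, nsq (l - u k) <= c' * 4^-1 ^+ k.
Proof.
move=> uC; pose v k : L2fun R n := repr (u k).
have uv k : u k = \pi_H (v k) by rewrite reprK.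
have subE (f g : L2fun R n) : \pi_H f - \pi_H g = \pi_H (f - g).
  by apply: (@addIr _ (\pi_H g)); rewrite subrK -L2_piD subrK.
have piece (F : C -> R) (j : 'I_n) :
    {morph F : x y / x - y} ->
    (forall k, (fun x => F (val (v k) x 0 j)) \in Lfun mu 2%:E) ->
    (forall f : L2fun R n, (\int[mu]_x (F (val f x 0 j)) ^+ 2)%R <= nsq (\pi_H f)) ->
    exists g : T -> R, g \in Lfun mu 2%:E /\
      forall k, (\int[mu]_x (g x - F (val (v k) x 0 j)) ^+ 2)%R <= c * 4^-1 ^+ k.
  move=> FB LF Fle.
  have [k m km|g Lg gd] := @Lfun2_complete R (fun k x => F (val (v k) x 0 j)) c LF.
    apply: le_trans (uC k m km); rewrite !uv subE; apply: le_trans (Fle _).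
    by under eq_Rintegral do rewrite -FB; rewrite le_eqVlt; apply/orP; left; apply/eqP;
       congr Rintegral; apply/funext => x; rewrite !mxE.
  by exists g.
have sqi0 (g : T -> R) : 0 <= (\int[mu]_x (g x) ^+ 2)%R.
  by apply: Rintegral_ge0 => x _; exact: sqr_ge0.
have /choice[gr hr] : forall j : 'I_n, exists g : T -> R, g \in Lfun mu 2%:E /\
      forall k, (\int[mu]_x (g x - complex.Re (val (v k) x 0 j)) ^+ 2)%R <= c * 4^-1 ^+ k.
  move=> j; apply: piece => [[? ?] [? ?]//|k|f]; first by case: (L2funP (v k) j).
  rewrite nsqE (bigD1 j)//= -addrA lerDl addr_ge0// sumr_ge0// => i _.
  by rewrite addr_ge0.
have /choice[gi hi] : forall j : 'I_n, exists g : T -> R, g \in Lfun mu 2%:E /\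
      forall k, (\int[mu]_x (g x - complex.Im (val (v k) x 0 j)) ^+ 2)%R <= c * 4^-1 ^+ k.
  move=> j; apply: piece => [[? ?] [? ?]//|k|f]; first by case: (L2funP (v k) j).
  rewrite nsqE (bigD1 j)//= [X in X + _]addrC -addrA lerDl addr_ge0// sumr_ge0// => i _.
  by rewrite addr_ge0.
pose l0 (x : T) : 'rV[C]_n := \row_j (gr j x +i* gi j x).
have Ll : l0 \in @L2pred R n.
  apply/asboolP => j; split.
    by rewrite (_ : (fun _ => _) = gr j) ?(hr j).1//; apply/funext => x; rewrite mxE.
  by rewrite (_ : (fun _ => _) = gi j) ?(hi j).1//; apply/funext => x; rewrite mxE.
pose l : L2fun R n := exist (fun w => w \in @L2pred R n) l0 Ll.
exists (\pi_H l), (n%:R * (2 * c)) => k; rewrite uv subE nsqE.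
apply: (@le_trans _ _ (\sum_(j < n) (2 * c * 4^-1 ^+ k))).
  apply: ler_sum => j _; rewrite (_ : 2 * c * _ = c * 4^-1 ^+ k + c * 4^-1 ^+ k); last by ring.
  apply: lerD.
    apply: le_trans ((hr j).2 k); rewrite le_eqVlt; apply/orP; left; apply/eqP.
    by congr Rintegral; apply/funext => x; rewrite !mxE; case: (val (v k) x 0 j).
  apply: le_trans ((hi j).2 k); rewrite le_eqVlt; apply/orP; left; apply/eqP.
  by congr Rintegral; apply/funext => x; rewrite !mxE; case: (val (v k) x 0 j).
by rewrite sumr_const card_ord -[leLHS]mulr_natl !mulrA.
Qed.

Lemma geom_le0 (K x : R) : (forall k, x <= K * 2^-1 ^+ k) -> x <= 0.
Proof.
move=> h; rewrite leNgt; apply/negP => x0.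
have : (fun k => K * 2^-1 ^+ k) @ \oo --> (0 : R).
  by apply: (cvg_geometric K); rewrite ger0_norm; lra.
move=> /cvgrPdist_lt/(_ _ x0)[N _ /(_ N (leqnn N))] /=.
by rewrite sub0r normrN; have := h N; have := ler_norm (K * 2^-1 ^+ N); lra.
Qed.

Lemma geom4_lt (K e : R) : 0 < e -> exists k, K * 4^-1 ^+ k < e.
Proof.
move=> e0; have : (fun k => K * 4^-1 ^+ k) @ \oo --> (0 : R).
  by apply: (cvg_geometric K); rewrite ger0_norm; lra.
move=> /cvgrPdist_lt/(_ _ e0)[N _ /(_ N (leqnn N))] /= h; exists N.
by move: h; rewrite sub0r normrN; have := ler_norm (K * 4^-1 ^+ N); lra.
Qed.

(** By the parallelogram identity a minimizing sequence is Cauchy. *)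
Lemma projection A f : closed_subspace A ->
  exists2 g, A g & orthocomplement A (f - g).
Proof.
move=> [sA /closedP cA].
pose D := [set nsq (f - g) | g in A].
have D0 : D !=set0 by exists (nsq (f - 0)), 0 => //; exact: sub0.
have Dlb : has_lbound D by exists 0 => _ [g _ <-]; exact: nsq_ge0.
pose d := inf D.
have dle g : A g -> d <= nsq (f - g) by move=> Ag; apply: ge_inf => //; exists g.
have /choice[u hu] : forall k : nat, exists g, A g /\ nsq (f - g) <= d + 4^-1 ^+ k.
  move=> k; have e0 : 0 < 4^-1 ^+ k :> R by apply: exprn_gt0; lra.
  have [_ [g Ag <-] lt] := inf_adherent e0 (conj D0 Dlb).
  by exists g; split=> //; exact: ltW.
have uC k m : (k <= m)%N -> nsq (u m - u k) <= 4 * 4^-1 ^+ k.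
  move=> km; have [Ak hk] := hu k; have [Am hm] := hu m.
  have mk : 4^-1 ^+ m <= 4^-1 ^+ k :> R by apply: ler_wiXn2l => //; lra.
  have := dle _ (subZ (2^-1)%:C sA (subD sA Am Ak)).
  have -> : u m - u k = (f - u k) + - (f - u m) by rewrite opprB [RHS]addrC addrA subrK.
  have -> : f - (2^-1)%:C *: (u m + u k) = (2^-1)%:C *: ((f - u k) + (f - u m)).
    rewrite addrACA -opprD [RHS]scalerDr scalerN [u k + _]addrC; congr (_ - _).
    rewrite -mulr2n -[f *+ 2]scaler_nat scalerA -[LHS]scale1r; congr (_ *: _).
    by rewrite fmorphV rmorph_nat mulVf ?pnatr_eq0.
  move: hk hm mk; move: (f - u k) (f - u m) => a b.
  rewrite nsqZ !nsqD nsqN ripNr expr2; lra.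
have [l [c' lc]] := L2_complete uC.
exists l.
  apply: cA => e e0; have [k ek] := geom4_lt c' e0.
  by exists (u k); [exact: (hu k).1|exact: le_lt_trans (lc k) ek].
apply: rip_eq0 => // a Aa.
apply/eqP; rewrite -normr_le0; apply: (@geom_le0 ((1 + nsq a + (c' + nsq a)) / 2)) => k.
have t0 : 0 < 2^-1 ^+ k :> R by apply: exprn_gt0; lra.
have tt : 4^-1 ^+ k = 2^-1 ^+ k * 2^-1 ^+ k :> R by rewrite -exprMn; congr (_ ^+ _); field.
have -> : f - l = (f - u k) + - (l - u k) by rewrite opprB addrA subrK.
have [Ak hk] := hu k; have := lc k; rewrite tt => lck; rewrite tt in hk.
have h1 := dle _ (subD sA Ak (subZ (2^-1 ^+ k)%:C sA Aa)).
have h2 := dle _ (subD sA Ak (subZ (- 2^-1 ^+ k)%:C sA Aa)).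
rewrite opprD addrA -scalerN in h1; rewrite opprD addrA -scalerN in h2.
move: h1 h2 lck hk; move: (f - u k) (l - u k) => p q; set s := 2^-1 ^+ k in t0 *.
rewrite !(nsqD p) !nsqZ !nsqN !ripZr !ripNr sqrrN => h1 h2 hq hp.
have s0 : 0 < s^-1 by rewrite invr_gt0.
have := rip_le q a s0; rewrite invrK => h3.
have {}h3 : 2 * `|rip q a| <= s * (c' + nsq a).
  apply: le_trans h3 _; rewrite mulrDr lerD2r.
  by rewrite mulrC ler_pdivrMr// -mulrA mulrC -mulrA.
have h4 : 2 * `|rip p a| <= s * (1 + nsq a).
  rewrite -(ler_pM2l t0); move: (nsq p) (nsq a) (rip p a) hp h1 h2 => P Q r h0 h1' h2'.
  by case: ger0P => _; nra.
rewrite ripD ripN; apply: le_trans (ler_normB _ _) _; lra.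
Qed.

Lemma orth_projP A f : closed_subspace A ->
  A (orth_proj A f) /\ orthocomplement A (f - orth_proj A f).
Proof.
move=> cA; rewrite /orth_proj; case: xgetP => [g _ //|nog].
by have [g Ag og] := projection f cA; case: (nog g).
Qed.

Lemma orth_proj_uniq A f g : closed_subspace A -> A g ->
  orthocomplement A (f - g) -> orth_proj A f = g.
Proof.
move=> cA Ag og; have [Ap op] := orth_projP f cA.
have sA := cA.1.
apply/eqP; rewrite -subr_eq0; apply/eqP/inner_eq0.
set d := _ - g; have Ad : A d by exact: subB.
rewrite (_ : inner d d = inner ((f - g) - (f - orth_proj A f)) d); last first.
  by congr (inner _ _); rewrite /d opprB [RHS]addrC addrA subrK.
by rewrite innerBl og// op// subr0.
Qed.

Lemma orth_proj_linear A : closed_subspace A -> linear (orth_proj A).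
Proof.
move=> cA a f g; have [Af of_] := orth_projP f cA; have [Ag og] := orth_projP g cA.
apply: orth_proj_uniq => //; first exact: subZD cA.1 _ _.
rewrite opprD addrACA -scalerBr => h Ah.
by rewrite innerD innerZl of_// og// mulr0 addr0.
Qed.

Lemma closed_span_closed (S : set H) : closed_subspace (closed_span S).
Proof.
split.
  apply/subspaceP; split=> [B [[sB _] _]|a f g Sf Sg B BS]; first exact: sub0.
  by apply: subZD BS.1.1 _ _; [exact: Sf|exact: Sg].
apply/closedP => f nf B BS; have /closedP := BS.1.2; apply.
by move=> e /nf[g Sg fg]; exists g => //; exact: Sg.
Qed.

Lemma sub_closed_span (S : set H) : S `<=` closed_span S.
Proof. by move=> f Sf B [_ SB]; exact: SB. Qed.

Lemma closed_span_min (S B : set H) : closed_subspace B -> S `<=` B ->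
  closed_span S `<=` B.
Proof. by move=> cB SB f; apply. Qed.

Lemma closed_span_mono (S S' : set H) : S `<=` S' -> closed_span S `<=` closed_span S'.
Proof.
move=> SS'; apply: closed_span_min; first exact: closed_span_closed.
by apply: (subset_trans SS'); exact: sub_closed_span.
Qed.

(** An element of [L] minus its projection to the closed span is an element of
    [L] orthogonal to [S]. *)
Lemma closed_span_total (S L : set H) : closed_subspace L -> S `<=` L ->
  (forall f, L f -> (forall g, S g -> inner f g = 0) -> f = 0) ->
  closed_span S = L.
Proof.
move=> cL SL tot; have cM := closed_span_closed S.
have ML : closed_span S `<=` L by exact: closed_span_min.
rewrite eqEsubset; split=> // f Lf; have [g Mg og] := projection f cM.
have /eqP : f - g = 0.
  apply: tot; first by apply: subB cL.1 Lf _; exact: ML.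
  by move=> h Sh; apply: og; exact: sub_closed_span.
by rewrite subr_eq0 => /eqP ->.
Qed.

Lemma closed_of_projection (B : set H) : subspace B ->
  (forall f, exists2 g, B g & orthocomplement B (f - g)) -> closed B.
Proof.
move=> sB pB; apply/closedP => f nf; have [g Bg og] := pB f.
suff /nsq_eq0/eqP : nsq (f - g) = 0 by rewrite subr_eq0 => /eqP ->.
apply/eqP; rewrite eq_le nsq_ge0 andbT leNgt; apply/negP => /nf[b Bb].
have -> : f - b = (f - g) + (g - b) by rewrite addrA subrK.
rewrite (nsqD (f - g)) /rip og ?mulr0 ?addr0 /=; last exact: subB.
by have := nsq_ge0 (g - b); lra.
Qed.

(** The added line may be taken orthogonal to [A]; the projection to [B] is then
    explicit. *)
Lemma closed_add_line (A B : set H) : closed_subspace A -> subspace B -> A `<=` B ->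
  quotient_dim B A 1 -> closed B.
Proof.
move=> cA sB AB /(qd1P _ cA.1)[u Bu [nAu gen]].
have [v Av] := projection u cA; move wE : (u - v) => w ov.
have Bw : B w by rewrite -wE; apply: subB => //; exact: AB.
have w0 : inner w w != 0.
  apply/eqP => /inner_eq0/eqP; rewrite -wE subr_eq0 => /eqP uv.
  by apply: nAu; rewrite uv.
apply: closed_of_projection => // f; have [g Ag og] := projection f cA.
exists (g + (inner f w / inner w w) *: w).
  by apply: subD => //; [exact: AB|exact: subZ].
move=> b /gen[c Ac].
have -> : b = (b - c *: u + c *: v) + c *: w.
  by rewrite -wE scalerBr -addrA [_ *: v + _]addrCA subrr addr0 subrK.
have Aa : A (b - c *: u + c *: v) by apply: subD cA.1 Ac _; apply: subZ cA.1 _.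
rewrite innerDr opprD addrA innerBl (og _ Aa) innerZl (ov _ Aa) mulr0 subr0 add0r.
rewrite innerZr !innerBl innerZl divfK// (inner_eq0C (ov _ Ag)) subr0.
by rewrite subrr mulr0.
Qed.

Lemma closed_add_finite (A B : set H) p : closed_subspace A -> subspace B -> A `<=` B ->
  quotient_dim B A p -> closed B.
Proof.
elim: p A => [|p IH] A cA sB AB hp.
  by have -> : B = A; [apply/seteqP; split=> //; exact: qd0|exact: cA.2].
have [M [sM AM MB MA1 BMp]] := qd_split cA.1 sB AB hp.
by apply: (IH M) => //; split=> //; exact: closed_add_line MA1.
Qed.

End Hilbert.

(** * Multiplication by the powers of z *)

Section Shift.
Variables (R : realType) (n : nat).
Local Notation T := (measurableTypeR R).
Local Notation C := R[i].
Local Notation mu := (circle_measure R).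
Local Notation H := (L2 R n).
Implicit Types (f g h : H) (a b : C) (k l m : int).

Definition fn f : T -> 'rV[C]_n := val (repr f).

Lemma fn_pi (u : L2fun R n) : {ae mu, forall x, fn (\pi_H u) x = val u x}.
Proof. by apply/L2_eqP; rewrite reprK. Qed.

Lemma fn_eq f g : {ae mu, forall x, fn f x = fn g x} -> f = g.
Proof. by move=> /L2_eqP; rewrite !reprK. Qed.

Lemma fn_CL2 f j : CL2 (fun x => fn f x 0 j).
Proof. exact: L2funP. Qed.

Lemma fnD f g : {ae mu, forall x, fn (f + g) x = fn f x + fn g x}.
Proof.
have -> : f + g = \pi_H (repr f + repr g) by rewrite L2_piD !reprK.
exact: fn_pi.
Qed.

Lemma fnZ a f : {ae mu, forall x, fn (a *: f) x = a *: fn f x}.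
Proof. exact: fn_pi. Qed.

Lemma fn_zpow k f : {ae mu, forall x, fn (zpow k f) x = cis (k%:~R * x) *: fn f x}.
Proof. exact: fn_pi. Qed.

Lemma inner_fn f g :
  inner f g = \sum_j Cintegral (fun x => fn f x 0 j * (fn g x 0 j)^*).
Proof. by []. Qed.

Lemma zpow_linear k : linear (@zpow R n k).
Proof.
move=> a f g; apply: fn_eq.
have h1 := fn_zpow k (a *: f + g); have h2 := fnD (a *: f) g; have h3 := fnZ a f.
have h4 := fnD (a *: zpow k f) (zpow k g); have h5 := fnZ a (zpow k f).
have h6 := fn_zpow k f; have h7 := fn_zpow k g.
near=> x; rewrite (near h1 x)// (near h2 x)// (near h3 x)// (near h4 x)// (near h5 x)//.
by rewrite (near h6 x)// (near h7 x)// scalerDr !scalerA mulrC.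
Unshelve. all: by end_near. Qed.

Lemma zpowD k l f : zpow (k + l) f = zpow k (zpow l f).
Proof.
apply: fn_eq.
have h1 := fn_zpow (k + l) f; have h2 := fn_zpow k (zpow l f); have h3 := fn_zpow l f.
near=> x; rewrite (near h1 x)// (near h2 x)// (near h3 x)//.
by rewrite scalerA -cisD -mulrDl intrD.
Unshelve. all: by end_near. Qed.

Lemma zpow0 f : zpow 0 f = f.
Proof.
apply: fn_eq; have h1 := fn_zpow 0 f.
by near=> x; rewrite (near h1 x)// mul0r cis0 scale1r.
Unshelve. all: by end_near. Qed.

Lemma zpowK k f : zpow (- k) (zpow k f) = f.
Proof. by rewrite -zpowD addNr zpow0. Qed.

Lemma zpowVK k f : zpow k (zpow (- k) f) = f.
Proof. by rewrite -zpowD subrr zpow0. Qed.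

Lemma zpow_inj k : injective (@zpow R n k).
Proof. exact: can_inj (zpowK k). Qed.

Lemma cis_norm (t : R) : cis t * Num.conj (cis t) = 1.
Proof. by rewrite -cisN -cisD subrr cis0. Qed.

Lemma Cint_CL2 (u v w : T -> C) : CL2 u -> CL2 v ->
  {ae mu, forall x, u x * (v x)^* = w x} -> Cintegrable w -> 
  Cintegral (fun x => u x * (v x)^*) = Cintegral w.
Proof. by move=> hu hv uw hw; apply: eq_Cintegral_ae => //; exact: CL2_int. Qed.

Lemma inner_zpow k f g : inner (zpow k f) (zpow k g) = inner f g.
Proof.
rewrite !inner_fn; apply: eq_bigr => j _; apply: Cint_CL2; try exact: fn_CL2.
  have h1 := fn_zpow k f; have h2 := fn_zpow k g.
  near=> x; rewrite (near h1 x)// (near h2 x)// !mxE rmorphM mulrACA.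
  by rewrite cis_norm mul1r.
exact: CL2_int (fn_CL2 _ _) (fn_CL2 _ _).
Unshelve. all: by end_near. Qed.

Lemma inner_zpowl k f g : inner (zpow k f) g = inner f (zpow (- k) g).
Proof. by rewrite -(inner_zpow (- k)) zpowK. Qed.

Lemma CL2_cst (c : C) : CL2 (fun _ : T => c).
Proof.
have L (r : R) : (fun=> r) \in Lfun mu 2%:E.
  apply: Lfun2P; first exact: measurable_cst.
  rewrite integral_cst// lte_mul_pinfty ?lee_fin ?sqr_ge0//.
  exact: circle_finite.
by split; exact: L.
Qed.

Lemma expo_L2 k (j : 'I_n) :
  (fun x : T => cis (k%:~R * x) *: delta_mx 0 j : 'rV[C]_n) \in @L2pred R n.
Proof.
apply/asboolP => i.
rewrite (_ : (fun _ => _) = fun x => cis (k%:~R * x) * (i == j)%:R); last first.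
  by apply/funext => x; rewrite !mxE eqxx.
exact/CL2_cis/CL2_cst.
Qed.

Definition expo k j : H := \pi_H (exist (fun w => w \in @L2pred R n) _ (expo_L2 k j)).

Lemma fn_expo k j : {ae mu, forall x, fn (expo k j) x = cis (k%:~R * x) *: delta_mx 0 j}.
Proof. exact: fn_pi. Qed.

Lemma inner_expo f k j :
  inner f (expo k j) = Cintegral (fun x => fn f x 0 j * cis (- (k%:~R * x))).
Proof.
have i1 : Cintegrable (fun x => fn f x 0 j * cis (- (k%:~R * x))).
  rewrite (_ : (fun _ => _) =
    fun x => cis ((- k%:~R) * x) * fn f x 0 j * (1 : C)^*); last first.
    by apply/funext => x; rewrite rmorph1 mulr1 mulrC mulNr.
  by apply: CL2_int (CL2_cis _ (fn_CL2 _ _)) (CL2_cst _).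
rewrite inner_fn (bigD1 j)//= big1 ?addr0 => [|i ij].
  apply: Cint_CL2; try exact: fn_CL2; last by [].
  have h := fn_expo k j; near=> x; rewrite (near h x)// !mxE !eqxx mulr1.
  by rewrite cisN.
have -> : 0 = Cintegral (fun _ : T => 0).
  by rewrite /Cintegral /= Rintegral_cst// mul0r.
apply: Cint_CL2; try exact: fn_CL2.
  have h := fn_expo k j; near=> x; rewrite (near h x)// !mxE (negbTE ij) andbF.
  by rewrite mulr0 rmorph0 mulr0.
have := CL2_int (CL2_cst 0) (CL2_cst 0).
by rewrite (_ : (fun _ => _) = fun=> 0)//; apply/funext => x; rewrite mul0r.
Unshelve. all: by end_near. Qed.

Lemma fourier_inner f k j : fourier f k j = ((2 * trigo.pi)^-1)%:C * inner f (expo k j).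
Proof. by rewrite inner_expo. Qed.

Lemma fourier0 f k j : (fourier f k j = 0) <-> inner f (expo k j) = 0.
Proof.
rewrite fourier_inner; split=> [/eqP|->]; last by rewrite mulr0.
rewrite mulf_eq0 => /orP[|/eqP//]; rewrite eq_complex /= eqxx andbT invr_eq0.
by rewrite mulf_eq0 pnatr_eq0 /= gt_eqF// pi_gt0.
Qed.

Lemma zpow_expo k l j : zpow k (expo l j) = expo (k + l) j.
Proof.
apply: fn_eq; have h1 := fn_zpow k (expo l j); have h2 := fn_expo l j.
have h3 := fn_expo (k + l) j.
near=> x; rewrite (near h1 x)// (near h2 x)// (near h3 x)//.
by rewrite scalerA -cisD -mulrDl intrD.
Unshelve. all: by end_near. Qed.

Lemma integrable_cos_sin (k : R) :
  mu.-integrable setT (EFin \o (fun x => cos (k * x))) /\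
  mu.-integrable setT (EFin \o (fun x => sin (k * x))).
Proof.
have i1 : Cintegrable (fun _ : T => 1 : R[i]).
  have := CL2_int (CL2_cst 1) (CL2_cst 1).
  by rewrite (_ : (fun _ => _) = fun=> 1)//; apply/funext => x; rewrite mul1r rmorph1.
have := Cintegrable_cis k i1.
by rewrite (_ : (fun _ => _) = fun x => cis (k * x))//; apply/funext => x; rewrite mul1r.
Qed.

Lemma cis_period k : cis (k%:~R * (2 * trigo.pi)) = 1 :> C.
Proof.
have hN (m : nat) : cis (m%:R * (2 * trigo.pi)) = 1 :> C.
  elim: m => [|m IH]; first by rewrite mul0r cis0.
  rewrite -natr1 mulrDl cisD IH mul1r mul1r /cis.
  have -> : 2 * trigo.pi = trigo.pi *+ 2 :> R by rewrite mulr_natl.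
  by rewrite cos2pi sin2pi.
case: k => m; first exact: hN.
by rewrite NegzE mulrNz mulNr cisN hN rmorph1.
Qed.

Lemma Cintegral_cis k : k != 0 -> Cintegral (fun x : T => cis (k%:~R * x)) = 0.
Proof.
move=> k0; have kR : k%:~R != 0 :> R by rewrite intr_eq0.
have [ic is_] := integrable_cos_sin k%:~R.
have cM : continuous (fun x : R => k%:~R * x) by move=> x; exact: mulrl_continuous.
have [cp sp] := cis_period k.
have cc : continuous (fun x : R^o => cos (k%:~R * x) : R^o).
  by move=> x; apply: continuous_comp; [exact: cM|exact: continuous_cos].
have cs : continuous (fun x : R^o => sin (k%:~R * x) : R^o).
  by move=> x; apply: continuous_comp; [exact: cM|exact: continuous_sin].
have ds (x : R^o) : is_derive x (1 : R^o) (fun x => k%:~R^-1 * sin (k%:~R * x) : R^o)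
    (cos (k%:~R * x)).
  by apply: is_derive_eq; rewrite /GRing.scale /=; field.
have dc (x : R^o) : is_derive x (1 : R^o) (fun x => - k%:~R^-1 * cos (k%:~R * x) : R^o)
    (sin (k%:~R * x)).
  by apply: is_derive_eq; rewrite /GRing.scale /=; field.
rewrite /Cintegral /= (circle_FTC cc ds ic) (circle_FTC cs dc is_).
by rewrite !mulr0 cos0 sin0 sp cp !mulr0 !subrr.
Qed.

End Shift.

(** * The index of z and the totality of shift-orthogonal families *)

Section HardySpace.
Variables (R : realType) (n : nat).
Local Notation T := (measurableTypeR R).
Local Notation C := R[i].
Local Notation mu := (circle_measure R).
Local Notation H := (L2 R n).
Local Notation z := (@zpow R n 1).
Implicit Types (f g h : H) (k l m : int) (W : set H).

Lemma HplusP f : Hplus f <-> forall k (j : 'I_n), k < 0 -> inner f (expo R k j) = 0.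
Proof. by split=> hf k j k0; apply/fourier0; exact: hf. Qed.

Lemma Hplus_closed : closed_subspace (@Hplus R n).
Proof.
have -> : Hplus = orthocomplement [set e | exists k (j : 'I_n), k < 0 /\ e = expo R k j] :> set H.
  apply/seteqP; split=> f.
    by move=> /HplusP hf _ [k [j [k0 ->]]]; exact: hf.
  by move=> hf; apply/HplusP => k j k0; apply: hf; exists k, j.
exact: orthocomplement_closed.
Qed.

Let sHp : subspace (@Hplus R n) := Hplus_closed.1.

Lemma zHplus f : Hplus f -> Hplus (z f).
Proof.
move=> /HplusP hf; apply/HplusP => k j k0.
rewrite inner_zpowl zpow_expo hf//; lia.
Qed.

Lemma inner_expo2 k l (i j : 'I_n) : inner (expo R k i) (expo R l j) =
  (i == j)%:R * Cintegral (fun x : T => cis ((k - l)%:~R * x)).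
Proof.
have ci m : Cintegrable (fun x : T => cis (m%:~R * x)).
  have -> : (fun x : T => cis (m%:~R * x)) =
      fun x => cis (m%:~R * x) * 1 * Num.conj (1 : C).
    by apply/funext => x; rewrite rmorph1 !mulr1.
  exact: CL2_int (CL2_cis m%:~R (CL2_cst 1)) (CL2_cst 1).
have c0 : Cintegrable (fun _ : T => 0 : C).
  by split; exact: integrable0.
rewrite inner_expo; have h := fn_expo R k i.
transitivity (Cintegral (fun x : T => (i == j)%:R * cis ((k - l)%:~R * x) + 0)).
  apply: eq_Cintegral_ae; last first.
  - near=> x; rewrite (near h x)// !mxE eqxx /= addr0 [j == i]eq_sym mulrC mulrA.
    by rewrite [RHS]mulrC -cisD -mulNr -mulrDl intrB addrC mulrC.
  - exact: CintegrableD.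
  - rewrite (_ : (fun _ => _) =
      fun x => cis ((- l%:~R) * x) * fn (expo R k i) x 0 j * Num.conj (1 : C)); last first.
      by apply/funext => x; rewrite rmorph1 mulr1 mulrC mulNr.
    by apply: CL2_int (CL2_cis _ (fn_CL2 _ _)) (CL2_cst _).
rewrite CintegralD// (_ : Cintegral (fun=> 0) = 0) ?addr0//.
by rewrite /Cintegral /= Rintegral_cst// mul0r.
Unshelve. all: by end_near. Qed.

Lemma Cintegral1 : Cintegral (fun _ : T => 1) = (2 * trigo.pi)%:C.
Proof.
have p0 : (0 : R) < 2 * pi by rewrite mulr_gt0// pi_gt0.
rewrite /Cintegral /= !Rintegral_cst// mul0r mul1r.
have -> : mu setT = (2 * pi)%:E; last by [].
rewrite circle_measureE setTI lebesgue_measure_itv/= lte_fin p0.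
by rewrite oppr0 adde0.
Qed.

Lemma twopi_neq0 : (2 * trigo.pi : R)%:C != 0.
Proof.
by rewrite eq_complex /= eqxx andbT mulf_eq0 pnatr_eq0 /= gt_eqF// pi_gt0.
Qed.

Lemma inner_expo_eq k l (i j : 'I_n) : inner (expo R k i) (expo R l j) =
  ((i == j) && (k == l))%:R * (2 * trigo.pi)%:C.
Proof.
rewrite inner_expo2; case: (eqVneq i j) => [_|_]; last by rewrite !mul0r.
case: eqVneq => [->|kl] /=; rewrite mul1r ?mul1r ?mul0r.
  rewrite -Cintegral1; congr Cintegral; apply/funext => x.
  by rewrite subrr mul0r cis0.
by apply: Cintegral_cis; rewrite subr_eq0.
Qed.

Lemma Hplus_expo k (j : 'I_n) : 0 <= k -> Hplus (expo R k j).
Proof.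
move=> k0; apply/HplusP => l i l0; rewrite inner_expo_eq [k == l]gt_eqF ?andbF ?mul0r//.
exact: lt_le_trans k0.
Qed.

(** Subtract the constant term of [f] and divide by z. *)
Lemma Hplus_decomp f : Hplus f -> exists c : 'I_n -> C, exists2 g, Hplus g &
  f = \sum_j c j *: expo R 0 j + z g.
Proof.
move=> /HplusP hf; pose c j := inner f (expo R 0 j) / (2 * trigo.pi)%:C.
exists c; pose d := f - \sum_j c j *: expo R 0 j.
exists (zpow (-1) d); last by rewrite zpowVK /d addrCA subrr addr0.
apply/HplusP => k i k0; rewrite inner_zpowl opprK zpow_expo innerBl inner_suml.
rewrite (bigD1 i)//= big1 ?addr0 => [|j ji]; last first.
  by rewrite innerZl inner_expo_eq (negbTE ji) mul0r mulr0.
rewrite innerZl inner_expo_eq eqxx /=; have [->|k1] := eqVneq k (-1).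
  by rewrite subrr eqxx mul1r divfK ?subrr// twopi_neq0.
rewrite (_ : (0 == 1 + k) = false) ?mul0r ?mulr0 ?subr0; last first.
  by apply/negbTE; move: k1; lia.
by apply: hf; move: k1; lia.
Qed.

Lemma Hplus_qd : quotient_dim (@Hplus R n) (z @` Hplus) n.
Proof.
exists (fun j => expo R 0 j); split=> [j|f /Hplus_decomp[c [g hg fE]]|c].
- exact: Hplus_expo.
- by exists c; exists g => //; rewrite fE addrC addKr.
move=> [g /HplusP hg gE] i.
have : inner (z g) (expo R 0 i) = 0 by rewrite inner_zpowl zpow_expo hg.
rewrite gE inner_suml (bigD1 i)//= big1 ?addr0 => [|j ji]; last first.
  by rewrite innerZl inner_expo_eq (negbTE ji) mul0r mulr0.
rewrite innerZl inner_expo_eq !eqxx mul1r => /eqP; rewrite mulf_eq0.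
by rewrite (negbTE twopi_neq0) orbF => /eqP.
Qed.

Lemma qd_functionals W (g : 'I_n -> H) : subspace W ->
  exists q, quotient_dim W (W `&` [set w | forall j, inner w (g j) = 0]) q.
Proof.
move=> sW; apply: (qd_bounded (p := n)).
  apply: subspaceI => //; apply/subspaceP; split=> [j|a u v hu hv j].
    exact: inner0l.
  by rewrite innerDl hu hv mulr0 addr0.
move=> q b [Wb ind]; rewrite leqNgt; apply/negP => nq.
pose M : 'M[C]_(q, n) := \matrix_(i, j) inner (b i) (g j).
have /rowV0Pn[c /sub_kermxP cM c0] : kermx M != 0.
  rewrite -mxrank_eq0 mxrank_ker subn_eq0 -ltnNge.
  exact: leq_ltn_trans (rank_leq_col M) nq.
move/eqP: c0; apply; apply/rowP => i; rewrite [RHS]mxE.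
apply: (ind (fun i => c 0 i)); split.
  by apply: sub_sum => // k _; exact: subZ.
move=> j; rewrite /= inner_suml; have /rowP/(_ j) := cM; rewrite !mxE => E.
rewrite -[RHS]E; apply: eq_bigr => k _; by rewrite innerZl mxE.
Qed.

Local Notation P := (orth_proj (@Hplus R n)).
Local Notation K := (P @^-1` [set 0]).

Let linP : linear P := orth_proj_linear Hplus_closed.
Let linz : linear z := @zpow_linear R n 1.
Let injz : injective z := @zpow_inj R n 1.

Let PP f : Hplus (P f). Proof. by have [] := orth_projP f Hplus_closed. Qed.

(** In general [P (z f)] and [z (P f)] differ by the constant function given by
    the coefficient of index -1 of [f]. *)
Lemma proj_z f : (forall j, inner f (expo R (-1) j) = 0) -> P (z f) = z (P f).
Proof.
move=> f0; apply: orth_proj_uniq; first exact: Hplus_closed.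
  exact/zHplus/PP.
have [_ of_] := orth_projP f Hplus_closed.
move=> _ /Hplus_decomp[c [g hg ->]]; rewrite -(linB linz) innerDr.
rewrite inner_zpow of_// addr0 innerC inner_suml big1 ?rmorph0// => j _.
rewrite innerZl innerC inner_zpowl zpow_expo innerBl f0 sub0r.
by have /HplusP -> := PP f; rewrite ?oppr0 ?rmorph0 ?mulr0.
Qed.

(** The Fredholm index of [P] drops by [n] from [W] to [z W], because [P]
    commutes with [z] up to finite rank; hence z has index [n] on [W]. *)
Lemma Gr_qd W : Gr_nplus W -> quotient_dim W (z @` W) n.
Proof.
move=> [[[sW _] [[k hk] [c hc]] _] zW].
pose W' := W `&` [set w | forall j, inner w (expo R (-1) j) = 0].
have sW' : subspace W'.
  apply: subspaceI => //; apply/subspaceP; split=> [j|a u v hu hv j].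
    exact: inner0l.
  by rewrite innerDl hu hv mulr0 addr0.
have W'W : W' `<=` W by move=> v [].
have s0 := @subspace0 _ H.
have sI (T : H -> H) (A : set H) : linear T -> subspace A -> subspace (T @` A).
  by move=> l s; exact: (subspace_img l s).
have sK : subspace K by exact: subspace_preimg.
have simg (A B : set H) : A `<=` B -> z @` A `<=` z @` B by exact: image_subset.
have s1 : subspace (P @` W) by exact: (sI _ _ linP).
have s2 : subspace (P @` W') by exact: (sI _ _ linP).
have s3 : subspace (z @` W) by exact: (sI _ _ linz).
have s4 : subspace (z @` W') by exact: (sI _ _ linz).
have s5 : subspace (z @` (P @` W)) by exact: (sI _ _ linz).
have s6 : subspace (z @` (P @` W')) by exact: (sI _ _ linz).
have s7 : subspace (P @` (z @` W)) by exact: (sI _ _ linP).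
have s8 : subspace (P @` (z @` W')) by exact: (sI _ _ linP).
have s9 : subspace (z @` @Hplus R n) by exact: (sI _ _ linz).
have [q hq] := qd_functionals (fun j => expo R (-1) j) sW.
have [a [b1 [ha hb1 qE]]] := rank_nullity_conv linP sW sW' W'W hq.
have hqz : quotient_dim (z @` W) (z @` W') q by apply/qd_inj.
have [a' [b2 [ha' hb2 qE']]] :=
  rank_nullity_conv linP s3 s4 (simg _ _ W'W) hqz.
have PzW' : P @` (z @` W') = z @` (P @` W').
  apply/seteqP; split=> [_ [_ [w W'w <-] <-]|_ [_ [w W'w <-] <-]].
    by exists (P w); [exists w|rewrite proj_z//; case: W'w].
  by exists (z w); [exists w|rewrite proj_z//; case: W'w].
have KzW' : z @` W' `&` K = z @` (W' `&` K).
  apply/seteqP; split=> [_ [[w W'w <-]]|_ [w [W'w Kw] <-]].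
    rewrite /= proj_z; last by case: W'w.
    move=> e; exists w => //; split=> //; apply: injz; rewrite /= e.
    by rewrite (lin0 linz).
  split; first by exists w.
  by rewrite /= proj_z; [rewrite Kw (lin0 linz)|case: W'w].
have PWH : P @` W `<=` Hplus by move=> _ [w _ <-]; exact: PP.
have c1 : quotient_dim (z @` Hplus) (z @` (P @` W)) c by exact/qd_inj.
have a1 : quotient_dim (z @` (P @` W)) (z @` (P @` W')) a.
  exact/qd_inj.
have tot1 : quotient_dim (@Hplus R n) (z @` (P @` W')) (n + (c + a)).
  apply: qd_add Hplus_qd _ => //.
  - by apply: simg; apply: subset_trans PWH; exact: image_subset.
  - by move=> _ [f hf <-]; exact: zHplus.
  - apply: qd_add c1 a1 => //; first by apply: simg; exact: image_subset.
    exact: simg.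
have PzWP : P @` (z @` W) `<=` P @` W by exact: image_subset.
have PzW'zW : P @` (z @` W') `<=` P @` (z @` W) by apply: image_subset; exact: simg.
rewrite -PzW' in tot1.
have [r hr] := qd_sub s8 PWH tot1.
have [e he] := qd_quo s8 s7
  PzW'zW hr.
have tot2 : quotient_dim (@Hplus R n) (P @` (z @` W')) (c + (e + a')).
  apply: qd_add hc _ => //; first exact: subset_trans PzWP.
  by apply: qd_add he ha' => //.
have E1 := qd_uniq s8 tot1 tot2.
have sKW : subspace (W `&` K) by exact: subspaceI.
have sKzW : subspace (z @` W `&` K) by exact: subspaceI.
have sKW' : subspace (W' `&` K) by exact: subspaceI.
have z0 (A : set H) : subspace A -> [set 0] `<=` A by move=> sA _ ->; exact: sub0.
have KzWK : z @` W `&` K `<=` W `&` K by move=> f [/zW Wf Kf].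
have [g hg] := qd_quo s0 sKzW (z0 _ sKzW) hk.
have [k2 hk2] := qd_sub s0 KzWK hk.
have KW'K : W' `&` K `<=` W `&` K by move=> f [/W'W Wf Kf].
have [k0 hk0] := qd_sub s0 KW'K hk.
have E2 : k = (g + k2)%N by apply: (qd_uniq s0 hk); apply: qd_add hg hk2 => //; exact: z0.
have E3 : k = (b1 + k0)%N.
  by apply: (qd_uniq s0 hk); apply: qd_add hb1 hk0 => //; exact: z0.
have E4 : k2 = (b2 + k0)%N.
  apply: (qd_uniq s0 hk2); apply: qd_add hb2 _ => //.
  - by rewrite KzW'; exact: sI.
  - by apply: z0; rewrite KzW'; exact: sI.
  - by move=> f [/(simg _ _ W'W) ? ?].
  - rewrite KzW'; have := (qd_inj k0 linz injz sKW' s0).2 hk0.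
    by rewrite image_set1 (lin0 linz).
have := rank_nullity linP sW s3 zW he hg.
by rewrite (_ : (e + g)%N = n)//; lia.
Qed.

Lemma Cintegral_sum I (r : seq I) (F : I -> T -> C) :
  (forall i, Cintegrable (F i)) ->
  Cintegrable (fun x => \sum_(i <- r) F i x) /\
  Cintegral (fun x => \sum_(i <- r) F i x) = \sum_(i <- r) Cintegral (F i).
Proof.
move=> Fi; elim: r => [|i r [IH1 IH2]].
  rewrite big_nil (_ : (fun _ => _) = fun=> 0); last first.
    by apply/funext => x; rewrite big_nil.
  by split; [split; exact: integrable0|rewrite /Cintegral /= !Rintegral_cst// mul0r].
rewrite (_ : (fun x => _) = fun x => 1 * F i x + \sum_(i <- r) F i x); last first.
  by apply/funext => x; rewrite big_cons mul1r.
split; first exact: CintegrableD.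
by rewrite CintegralD// mul1r big_cons IH2.
Qed.

(** The pointwise inner product; its Fourier coefficients are the inner
    products of the shifts. *)
Definition gram f g (x : T) : C := \sum_j fn f x 0 j * Num.conj (fn g x 0 j).

Lemma gram_integrable f g : Cintegrable (gram f g).
Proof.
rewrite /gram; apply: (Cintegral_sum _ _).1 => j.
exact: CL2_int (fn_CL2 _ _) (fn_CL2 _ _).
Qed.

Lemma gram_fourier f g k :
  Cintegral (fun x => gram f g x * cis (k%:~R * x)) = inner (zpow k f) g.
Proof.
pose F (j : 'I_n) x := cis (k%:~R * x) * fn f x 0 j * Num.conj (fn g x 0 j).
have Fi j : Cintegrable (F j) by exact: CL2_int (CL2_cis _ (fn_CL2 _ _)) (fn_CL2 _ _).
transitivity (Cintegral (fun x => \sum_j F j x)).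
  congr Cintegral; apply/funext => x; rewrite /gram mulr_suml; apply: eq_bigr => j _.
  by rewrite /F mulrC mulrA.
rewrite (Cintegral_sum _ Fi).2 inner_fn; apply: eq_bigr => j _; apply/esym.
apply: Cint_CL2 => //; try exact: fn_CL2.
have h := fn_zpow k f; near=> x; by rewrite (near h x)// !mxE.
Unshelve. all: by end_near. Qed.

Lemma gram_const f g : (forall k, k != 0 -> inner (zpow k f) g = 0) ->
  {ae mu, forall x, gram f g x = inner f g / (2 * trigo.pi)%:C}.
Proof.
move=> fg0; set c := _ / _.
have one : Cintegrable (fun _ : T => 1 : C).
  have -> : (fun _ : T => 1 : C) = fun _ => 1 * Num.conj (1 : C).
    by apply/funext => x; rewrite mul1r rmorph1.
  exact: CL2_int (CL2_cst 1) (CL2_cst 1).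
have : fourier_null (fun x => - c * 1 + gram f g x).
  split; first by apply: CintegrableD => //; exact: gram_integrable.
  move=> k.
  rewrite (_ : (fun x => _) = fun x => - c * (1 * cis (k%:~R * x)) +
     gram f g x * cis (k%:~R * x)); last by apply/funext => x; ring.
  rewrite CintegralD; try exact: Cintegrable_cis (gram_integrable _ _);
    last exact: Cintegrable_cis.
  rewrite gram_fourier (_ : (fun x => 1 * _) = fun x => cis (k%:~R * x)); last first.
    by apply/funext => x; rewrite mul1r.
  have [->|k0] := eqVneq k 0; last by rewrite fg0// Cintegral_cis// mulr0 addr0.
  rewrite (_ : (fun x => cis _) = fun=> 1); last first.
    by apply/funext => x; rewrite mul0r cis0.
  by rewrite Cintegral1 zpow0 /c mulNr divfK ?twopi_neq0// addNr.
move=> /fourier_unique; apply: filterS => x /=.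
by rewrite mulr1 addrC => /eqP; rewrite subr_eq0 => /eqP.
Qed.

(** If the [z^k v_i] form an orthogonal family, then for almost every point
    of the circle the values of the [v_i] are an orthogonal basis of [C^n];
    so the family is total. *)
Lemma shift_total (v : 'I_n -> H) (f : H) : (forall i, v i <> 0) ->
  (forall k i j, (k != 0) || (i != j) -> inner (zpow k (v i)) (v j) = 0) ->
  (forall k i, inner (zpow k f) (v i) = 0) -> f = 0.
Proof.
move=> v0 vo fo; pose c i := inner (v i) (v i) / (2 * trigo.pi)%:C.
have c0 i : c i != 0.
  rewrite mulf_neq0 ?invr_eq0 ?twopi_neq0//.
  by apply/eqP => /inner_eq0; exact: v0.
have hv : {ae mu, forall x, forall i j, gram (v i) (v j) x = (i == j)%:R * c i}.
  apply: filter_forall => i; apply: filter_forall => j.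
  have vij k : k != 0 -> inner (zpow k (v i)) (v j) = 0.
    by move=> k0; apply: vo; rewrite k0.
  have := gram_const vij; apply: filterS => x ->; case: eqVneq => [<-|ij]; first by rewrite mul1r.
  by rewrite -(zpow0 (v i)) vo ?ij ?orbT// mul0r mul0r.
have hf : {ae mu, forall x, forall i, gram f (v i) x = 0}.
  apply: filter_forall => i.
  have := @gram_const f (v i) (fun k (_ : k != 0) => fo k i); apply: filterS => x ->.
  by rewrite -(zpow0 f) fo mul0r.
apply: fn_eq; have h0 := fnZ 0 (0 : H).
near=> x.
have -> : fn (0 : H) x = 0.
  by rewrite -[X in fn X](scale0r (0 : H)) (near h0 x)// scale0r.
have hvx i j : gram (v i) (v j) x = (i == j)%:R * c i by rewrite (near hv x).
have hfx i : gram f (v i) x = 0 by rewrite (near hf x).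
pose M : 'M[C]_n := \matrix_(i, j) fn (v i) x 0 j.
pose M' : 'M[C]_n := \matrix_(j, i) Num.conj (fn (v i) x 0 j).
have MM' : M *m M' = diag_mx (\row_i c i).
  apply/matrixP => i j; rewrite !mxE -mulr_natl -hvx.
  by apply: eq_bigr => k _; rewrite !mxE.
have uM' : M' \in unitmx.
  have : M *m M' \in unitmx.
    by rewrite MM' unitmxE det_diag unitfE; apply/prodf_neq0 => i _; rewrite mxE.
  by rewrite unitmx_mul => /andP[].
have : fn f x *m M' = 0.
  apply/rowP => i; rewrite !mxE -[RHS](hfx i).
  by apply: eq_bigr => k _; rewrite !mxE.
by move=> /(congr1 (mulmx^~ (invmx M'))); rewrite mulmxK// mul0mx.
Unshelve. all: by end_near. Qed.

End HardySpace.

(** * Lattices and their types *)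

Section Lattices.
Variables (R : realType) (n : nat).
Local Notation H := (L2 R n).
Implicit Types (L M : set H) (k l : int) (N m : nat).

Definition zs k L : set H := zpow k @` L.

Lemma zsD k l L : zs (k + l) L = zs k (zs l L).
Proof.
apply/seteqP; split=> [_ [f Lf <-]|_ [_ [f Lf <-] <-]].
  by exists (zpow l f); [exists f|rewrite zpowD].
by exists f => //; rewrite zpowD.
Qed.

Lemma zs0 L : zs 0 L = L.
Proof.
apply/seteqP; split=> [_ [f Lf <-]|f Lf]; first by rewrite zpow0.
by exists f; rewrite ?zpow0.
Qed.

Lemma zs_mono k L M : L `<=` M -> zs k L `<=` zs k M.
Proof. exact: image_subset. Qed.

Lemma zsK k L : zs (- k) (zs k L) = L.
Proof. by rewrite -zsD addNr zs0. Qed.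

Lemma zs_monoE k L M : zs k L `<=` zs k M <-> L `<=` M.
Proof.
split=> [h|]; last exact: zs_mono.
by rewrite -(zsK k L) -(zsK k M); exact: zs_mono.
Qed.

Lemma zsP k L f : zs k L f <-> L (zpow (- k) f).
Proof.
split=> [[g Lg <-]|h]; first by rewrite zpowK.
by exists (zpow (- k) f) => //; rewrite zpowVK.
Qed.

Lemma subspace_zs k L : subspace L -> subspace (zs k L).
Proof. exact: subspace_img (zpow_linear k) _. Qed.

Lemma zs_shrink L N k : zs 1 L `<=` L -> zs (k + N%:Z) L `<=` zs k L.
Proof.
move=> zL; elim: N => [|N IH]; first by rewrite addr0.
apply: subset_trans IH; rewrite (_ : k + N.+1%:Z = k + N%:Z + 1); last by lia.
by rewrite zsD; exact: zs_mono.
Qed.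

Lemma zs_le L k l : zs 1 L `<=` L -> k <= l -> zs l L `<=` zs k L.
Proof.
move=> zL kl; have -> : l = k + (absz (l - k))%:Z by rewrite gez0_abs; lia.
exact: zs_shrink.
Qed.

Lemma Gr_subspace L : Gr_nplus L -> subspace L.
Proof. by case=> -[[]]. Qed.

Lemma Gr_qdN L N : (forall k, Gr_nplus (zs k L)) ->
  forall k, quotient_dim (zs k L) (zs (k + N%:Z) L) (n * N).
Proof.
move=> hL; elim: N => [|N IH] k.
  by rewrite addr0 muln0; apply/qd_refl/Gr_subspace.
have zL k' : zs (k' + 1) L `<=` zs k' L.
  by rewrite addrC zsD; case: (hL k').
have zLN k' N' : zs (k' + N'%:Z) L `<=` zs k' L.
  by apply: zs_shrink; have := zL 0; rewrite zs0.
rewrite mulnS addnC (_ : k + N.+1%:Z = k + N%:Z + 1); last by lia.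
apply: qd_add (IH k) _; try exact/Gr_subspace.
- exact: zL.
- exact: zLN.
- by have := Gr_qd (hL (k + N%:Z)); rewrite -/(zs 1 _) -zsD [1 + _]addrC.
Qed.

Section Class.
Variable L0 : set H.
Hypothesis hL0 : forall k, Gr_nplus (zs k L0).

Let zL0 : zs 1 L0 `<=` L0.
Proof. by have := (hL0 0).2; rewrite zs0. Qed.

Let sL0 k : subspace (zs k L0). Proof. exact/Gr_subspace. Qed.

(** The z-stable subspaces commensurable with [L0]. *)
Definition lattice L := [/\ subspace L, zs 1 L `<=` L &
  exists N, zs N%:Z L0 `<=` L /\ L `<=` zs (- N%:Z) L0].

Lemma lattice_sub L : lattice L -> subspace L. Proof. by case. Qed.

Lemma lattice_z L : lattice L -> zs 1 L `<=` L. Proof. by case. Qed.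

Lemma lattice_zle L k l : lattice L -> k <= l -> zs l L `<=` zs k L.
Proof. by move=> /lattice_z; exact: zs_le. Qed.

Lemma lattice_zs L k : lattice L -> lattice (zs k L).
Proof.
move=> [sL zL [N [NL LN]]]; split; first exact: subspace_zs.
  by rewrite -zsD addrC zsD; exact: zs_mono.
exists (N + absz k)%N; split.
  apply: (subset_trans _ (@zs_mono k _ _ NL)); rewrite -zsD; apply: zs_le => //.
  by lia.
apply: (subset_trans (@zs_mono k _ _ LN)); rewrite -zsD; apply: zs_le => //.
by lia.
Qed.

Lemma lattice0 : lattice L0.
Proof.
split=> //; first by have := sL0 0; rewrite zs0.
by exists 0%N; rewrite oppr0 !zs0; split.
Qed.

Lemma lattice_sandwich L M M' : lattice M -> lattice M' -> M `<=` L -> L `<=` M' ->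
  subspace L -> zs 1 L `<=` L -> lattice L.
Proof.
move=> [_ _ [N [NM _]]] [_ _ [N' [_ MN']]] ML LM' sL zL; split=> //.
exists (N + N')%N; split.
  apply: (subset_trans _ ML); apply: (subset_trans _ NM).
  by apply: zs_le => //; lia.
by apply: (subset_trans LM'); apply: (subset_trans MN'); apply: zs_le => //; lia.
Qed.

Lemma lattice_dir L L' : lattice L -> lattice L' -> exists N, zs N%:Z L `<=` L'.
Proof.
move=> [_ _ [N [_ LN]]] [_ _ [N' [NL _]]]; exists (N + N')%N.
apply: (subset_trans (@zs_mono _ _ _ LN)); apply: (subset_trans _ NL).
by rewrite -zsD; apply: zs_le => //; lia.
Qed.

Lemma lattice_dirV L L' : lattice L -> lattice L' -> exists N, L' `<=` zs (- N%:Z) L.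
Proof.
move=> hL hL'; have [N h] := lattice_dir hL' hL; exists N.
by apply/(zs_monoE N%:Z); rewrite -zsD subrr zs0.
Qed.

Lemma latticeI L L' : lattice L -> lattice L' -> lattice (L `&` L').
Proof.
move=> hL hL'; have [N h] := lattice_dir hL hL'.
apply: (lattice_sandwich (lattice_zs N%:Z hL) hL).
- move=> f Nf; split; last exact: h.
  by move: f Nf; rewrite -{2}(zs0 L); apply: lattice_zle hL _.
- by move=> f [].
- by apply: subspaceI; exact: lattice_sub.
- move=> _ [f [Lf L'f] <-]; split.
    by apply: (lattice_z hL); exists f.
  by apply: (lattice_z hL'); exists f.
Qed.

Lemma lattice_sum L L' : lattice L -> lattice L' -> lattice (sumset L L').
Proof.
move=> hL hL'; have [N h] := lattice_dirV hL hL'.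
apply: (lattice_sandwich hL (lattice_zs (- N%:Z) hL)).
- by apply: sumset_ge_l; exact: lattice_sub.
- apply: sumset_le => //; first exact/lattice_sub/lattice_zs.
  by rewrite -{1}(zs0 L); apply: lattice_zle => //; lia.
- by apply: subspace_sum; exact: lattice_sub.
- move=> _ [_ /sumsetP[f [g [Lf L'g ->]]] <-]; apply/sumsetP.
  exists (zpow 1 f), (zpow 1 g); rewrite (linD (zpow_linear 1)); split=> //.
    by apply: (lattice_z hL); exists f.
  by apply: (lattice_z hL'); exists g.
Qed.

Lemma lattice_qd L L' : lattice L -> lattice L' -> L' `<=` L ->
  exists m, quotient_dim L L' m.
Proof.
move=> [sL _ [N [_ LN]]] [sL' _ [N' [NL' _]]] L'L.
have q := @Gr_qdN _ (N + N')%N hL0 (- N%:Z).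
rewrite (_ : - N%:Z + (N + N')%N%:Z = N'%:Z) in q; last by lia.
have [p hp] := qd_sub (sL0 N'%:Z) LN q.
exact: qd_quo (sL0 N'%:Z) sL' NL' hp.
Qed.

(** The conditions defining the Grassmannian are inherited from the translates of
    [L0] between which [L] lies: the smaller one has finite codimension in [L]. *)
Lemma lattice_Gr L : lattice L -> Gr_nplus L.
Proof.
move=> hL; have [sL zL [N [NL LN]]] := hL; split=> //.
have hN k : lattice (zs k L0) by exact/lattice_zs/lattice0.
have [[cA [_ [c hc]] _] _] := hL0 N%:Z.
have [[_ [[d hd] _] co] _] := hL0 (- N%:Z).
have [p hp] := lattice_qd hL (hN N%:Z) NL.
have lP := orth_proj_linear (@Hplus_closed R n).
split.
- by split=> //; exact: closed_add_finite hp.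
- split.
    apply: (qd_sub (subspace0 _) _ hd).
    by move=> f [/LN Lf Pf].
  apply: (qd_quo _ _ _ hc); try exact: subspace_img lP _ _.
  exact: image_subset.
- apply: precompact_subset co; apply: image_subset.
  by move=> f [/LN Lf f1].
Qed.

(** [d] is minus the dimension of [L] relative to [L0], computed through a common
    subspace. *)
Definition has_type L (d : int) := exists N m,
  [/\ zs N%:Z L0 `<=` L, quotient_dim L (zs N%:Z L0) m & d = (n * N)%:Z - m%:Z].

Lemma has_type_ex L : lattice L -> exists d, has_type L d.
Proof.
move=> hL; have [_ _ [N [NL _]]] := hL.
have [m hm] := lattice_qd hL (lattice_zs N%:Z lattice0) NL.
by exists ((n * N)%:Z - m%:Z), N, m.
Qed.

Lemma has_type_shift L N N' m : zs N%:Z L0 `<=` L ->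
  quotient_dim L (zs N%:Z L0) m ->
  quotient_dim L (zs (N + N')%N%:Z L0) (m + n * N').
Proof.
move=> NL hm; apply: qd_add hm _ => //; first by apply: zs_le => //; lia.
by rewrite PoszD; exact: Gr_qdN.
Qed.

Lemma has_type_uniq L d d' : has_type L d -> has_type L d' -> d = d'.
Proof.
move=> [N [m [NL hm ->]]] [N' [m' [NL' hm' ->]]].
have h := has_type_shift N' NL hm; have h' := has_type_shift N NL' hm'.
by rewrite addnC in h'; have := qd_uniq (sL0 _) h h'; lia.
Qed.

Definition ty L : int := xget 0 [set d | has_type L d].

Lemma tyP L : lattice L -> has_type L (ty L).
Proof.
move=> /has_type_ex[d hd]; rewrite /ty; case: xgetP => [d' _ //|/(_ d)].
by case.
Qed.

Lemma ty_eq L d : lattice L -> has_type L d -> ty L = d.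
Proof. by move=> /tyP; exact: has_type_uniq. Qed.

Lemma ty_qd L L' m : lattice L -> lattice L' -> L' `<=` L ->
  quotient_dim L L' m -> ty L' = ty L + m%:Z.
Proof.
move=> hL hL' L'L hm; have [N [p [NL' hp ->]]] := tyP hL'.
rewrite (@ty_eq L ((n * N)%:Z - (m + p)%N%:Z))//; first by lia.
exists N, (m + p)%N; split=> //; first exact: subset_trans L'L.
by apply: qd_add hm hp => //; exact: lattice_sub.
Qed.

Lemma ty_zs L k : lattice L -> ty (zs k L) = ty L + n%:Z * k.
Proof.
move=> hL; have h1 L' : lattice L' -> ty (zs 1 L') = ty L' + n%:Z.
  move=> hL'; apply: ty_qd => //; first exact: lattice_zs.
    exact: lattice_z.
  exact/Gr_qd/lattice_Gr.
have hN N L' : lattice L' -> ty (zs N%:Z L') = ty L' + n%:Z * N%:Z.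
  move=> hL'; elim: N => [|N IH]; first by rewrite zs0 mulr0 addr0.
  by rewrite intS zsD h1 ?IH; [lia|exact: lattice_zs].
case: k => N; first exact: hN.
have := hN N.+1 _ (lattice_zs (Negz N) hL).
by rewrite -zsD NegzE subrr zs0 => ->; lia.
Qed.

Lemma ty_le L L' : lattice L -> lattice L' -> L' `<=` L -> ty L <= ty L'.
Proof.
move=> hL hL' L'L; have [m hm] := lattice_qd hL hL' L'L.
by rewrite (ty_qd hL hL' L'L hm); lia.
Qed.

Lemma ty_le_eq L L' : lattice L -> lattice L' -> L' `<=` L -> ty L' <= ty L -> L = L'.
Proof.
move=> hL hL' L'L; have [m hm] := lattice_qd hL hL' L'L.
rewrite (ty_qd hL hL' L'L hm) => m0; have m0' : m = 0%N by lia.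
by move: hm; rewrite m0' => /qd0 LL'; apply/seteqP.
Qed.

Lemma ty_qd_eq L L' m : lattice L -> lattice L' -> L' `<=` L ->
  ty L' = ty L + m%:Z -> quotient_dim L L' m.
Proof.
move=> hL hL' L'L; have [p hp] := lattice_qd hL hL' L'L.
by rewrite (ty_qd hL hL' L'L hp) => /addrI[<-].
Qed.

(** What allows a chain of lattices of [F] to be refined inside [F]. *)
Definition interpolating (F : set (set H)) := forall L L', F L -> F L' ->
  L' `<=` L -> ty L < ty L' ->
  exists M, [/\ F M, L' `<=` M, M `<=` L & ty M = ty L + 1].

(** z acts nilpotently on [L / L'], so it stabilizes a hyperplane. *)
Lemma lattice_interpolating : interpolating lattice.
Proof.
move=> L L' hL hL' L'L tL; have sL := lattice_sub hL.
pose S := sumset L' (zs 1 L).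
have hS : lattice S by apply: lattice_sum => //; exact: lattice_zs.
have SL : S `<=` L by apply: sumset_le => //; exact: lattice_z.
have [[|m] hm] := lattice_qd hL hS SL; last first.
  have [M [sM SM ML hM]] := qd_hyperplane (lattice_sub hS) sL SL hm.
  have zM : zs 1 M `<=` M.
    apply: (subset_trans _ SM); apply: (subset_trans (@zs_mono 1 _ _ ML)).
    by apply: sumset_ge_r; exact: lattice_sub hL'.
  have hM' : lattice M by exact: lattice_sandwich hS hL SM ML sM zM.
  exists M; split=> //; last exact: ty_qd hM.
  apply: (subset_trans _ SM); apply: sumset_ge_l.
  exact/lattice_sub/lattice_zs.
exfalso; have LS := qd0 hm.
have LN N : L `<=` sumset L' (zs N%:Z L).
  elim: N => [|N IH] f Lf.
    by apply: sumset_ge_r; [exact: lattice_sub|rewrite zs0].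
  have /sumsetP[a [b [La Lb ->]]] := IH f Lf.
  move/zsP: Lb => /LS/sumsetP[c [d [Lc Ld bE]]].
  apply/sumsetP; exists (a + zpow N%:Z c), (zpow N%:Z d); split.
  - apply: subD La _; first exact: lattice_sub.
    have := zs_le (lattice_z hL') (_ : 0 <= N%:Z); rewrite zs0; apply=> //.
    by exists c.
  - rewrite (_ : N.+1%:Z = N%:Z + 1); last by lia.
    by rewrite zsD; exists d.
  - rewrite -addrA -(linD (zpow_linear _)) -bE zpowVK//.
have [N NL'] := lattice_dir hL hL'.
have : L `<=` L'.
  apply: (subset_trans (LN N)); apply: sumset_le => //; exact: lattice_sub.
by move=> /(ty_le hL' hL); lia.
Qed.

End Class.

End Lattices.

(** * Chains of lattices *)

Section Flags.
Variables (R : realType) (n : nat).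
Local Notation H := (L2 R n).
Variable L0 : set H.
Hypothesis hL0 : forall k, Gr_nplus (zs k L0).
Implicit Types (A B L : set H) (k l q : int) (S : set (set H)) (V : int -> set H).
Local Notation lattice := (lattice L0).
Local Notation ty := (ty L0).

Lemma chain_le V k l : (forall k, V (k + 1) `<=` V k) -> k <= l -> V l `<=` V k.
Proof.
move=> h kl; have -> : l = k + (absz (l - k))%:Z by rewrite gez0_abs; lia.
elim: (absz _) => [|N IH]; first by rewrite addr0.
rewrite (_ : k + N.+1%:Z = k + N%:Z + 1); last by lia.
exact: subset_trans IH.
Qed.

Lemma chain_zs V k q : (forall k, zs 1 (V k) = V (k + n%:Z)) ->
  zs q (V k) = V (k + q * n%:Z).
Proof.
move=> h.
have hN (N : nat) l : zs N%:Z (V l) = V (l + N%:Z * n%:Z).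
  elim: N => [|N IH]; first by rewrite zs0 mul0r addr0.
  by rewrite intS zsD IH h; congr V; lia.
case: q => N; first exact: hN.
rewrite -[RHS](zsK N.+1%:Z) hN NegzE; congr (zs _ (V _)); lia.
Qed.

Lemma tyz L k : lattice L -> ty (zs k L) = ty L + n%:Z * k.
Proof. exact: ty_zs. Qed.

Section Family.
Variable M : set (set H).
Hypothesis Mlat : M `<=` lattice.
Hypothesis Mzs : forall k L, M L -> M (zs k L).

(** The flags with members in [M], as sets of members. *)
Definition mflag S := [/\ S !=set0, S `<=` M,
  forall A B, S A -> S B -> A `<=` B \/ B `<=` A &
  forall k A, S A -> S (zs k A)].

Lemma mflag_le S A B : mflag S -> S A -> S B -> ty A <= ty B -> B `<=` A.
Proof.
move=> [_ SM tot _] SA SB AB; case: (tot _ _ SA SB) => // A_B.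
by rewrite (ty_le_eq hL0 (Mlat (SM _ SB)) (Mlat (SM _ SA)) A_B AB).
Qed.

Lemma mflag_eq S A B : mflag S -> S A -> S B -> ty A = ty B -> A = B.
Proof. by move=> hS SA SB e; apply/seteqP; split; apply: (mflag_le hS); rewrite ?e. Qed.

(** The full flags, indexed by the types of their members. *)
Definition tchain V := [/\ forall k, M (V k), forall k, ty (V k) = k,
  forall k, V (k + 1) `<=` V k & forall k, zs 1 (V k) = V (k + n%:Z)].

Lemma tchain_le V k l : tchain V -> k <= l -> V l `<=` V k.
Proof. by case=> _ _ Vle _; exact: chain_le. Qed.

Lemma tchain_zs V k q : tchain V -> zs q (V k) = V (k + q * n%:Z).
Proof. by case=> _ _ _ Vz; exact: chain_zs. Qed.

Lemma tchain_mflag V : tchain V -> mflag (range V).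
Proof.
move=> hV; split.
- by exists (V 0), 0.
- by move=> _ [k _ <-]; case: hV.
- move=> _ _ [k _ <-] [l _ <-]; have [kl|lk] := leP k l.
    by right; exact: tchain_le.
  by left; apply: tchain_le => //; exact: ltW.
- by move=> q _ [k _ <-]; rewrite (tchain_zs _ _ hV); exists (k + q * n%:Z).
Qed.

Lemma tchain_range V L : tchain V -> range V L -> L = V (ty L).
Proof. by move=> hV [k _ <-]; case: hV => _ -> _ _. Qed.

Lemma tchain_inj V : tchain V -> injective V.
Proof. by move=> [_ h _ _] k l /(congr1 ty); rewrite !h. Qed.

Lemma mflag_max S : mflag S -> exists S',
  [/\ mflag S', S `<=` S' & forall S'', mflag S'' -> S' `<=` S'' -> S'' `<=` S'].
Proof.
move=> hS; pose P S' := mflag (S `|` S').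
have [|S' [hS' max]] := @Zorn_bigcup _ P.
  move=> F FP tot; have [[A SA] SM Stot Szs] := hS.
  have FM X : F X -> mflag (S `|` X) by exact: FP.
  split.
  - by exists A; left.
  - move=> B [SB|[X FX XB]]; first exact: SM.
    by have [_ h _ _] := FM _ FX; apply: h; right.
  - move=> B C [SB|[X FX XB]] [SC|[Y FY YC]].
    + exact: Stot.
    + by have [_ _ h _] := FM _ FY; apply: h; [left|right].
    + by have [_ _ h _] := FM _ FX; apply: h; [right|left].
    + case: (tot _ _ FX FY) => sub.
        by have [_ _ h _] := FM _ FY; apply: h; right => //; exact: sub.
      by have [_ _ h _] := FM _ FX; apply: h; right => //; exact: sub.
  - move=> k B [SB|[X FX XB]]; first by left; exact: Szs.
    have [_ _ _ h] := FM _ FX; case: (h k B); first by right.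
      by left.
    by move=> XkB; right; exists X.
exists (S `|` S'); split=> // S'' hS'' sub L S''L; right.
apply: contrapT => nS'L; apply: (max S'').
  by split; [move=> B SB; apply: sub; right|move=> h; apply: nS'L; exact: h].
rewrite /P (_ : S `|` S'' = S'')//; apply/setUidPr => B SB; apply: sub; by left.
Qed.

Lemma mflag_insert S C : mflag S -> M C ->
  (forall X, S X -> X `<=` C \/ C `<=` X) -> mflag (S `|` [set zs q C | q in setT]).
Proof.
move=> [[L SL] SM Stot Szs] MC cmp0.
have cmp X q : S X -> X `<=` zs q C \/ zs q C `<=` X.
  move=> SX; case: (cmp0 _ (Szs (- q) X SX)) => h; [left|right].
    by rewrite -[X](zsK (- q)) opprK; apply: zs_mono.
  by rewrite -[X](zsK (- q)) opprK; apply: zs_mono.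
split; first by exists L; left.
- by move=> X [/SM//|[q _ <-]]; exact: Mzs.
- move=> X Y [SX|[q _ <-]] [SY|[r _ <-]].
  + exact: Stot.
  + exact: cmp.
  + by case: (cmp Y q SY); [right|left].
  + have [qr|rq] := leP q r.
      by right; apply: lattice_zle (Mlat MC) qr.
    by left; apply: lattice_zle (Mlat MC) (ltW rq).
- move=> r X [SX|[q _ <-]]; first by left; exact: Szs.
  by right; exists (r + q) => //; rewrite zsD.
Qed.

Hypothesis hn : (2 <= n)%N.

Lemma mflag_gap S k : mflag S -> exists A B, [/\ S A, S B, ty A <= k, k < ty B &
  forall X, S X -> A `<=` X \/ X `<=` B].
Proof.
move=> hS; have [[L SL] SM Stot Szs] := hS.
have Slat X : S X -> lattice X by move=> /SM/Mlat.
pose Pa (m : nat) := `[< exists2 A, S A & ty A = k - m%:Z >].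
pose Pb (m : nat) := `[< exists2 B, S B & ty B = k + 1 + m%:Z >].
have exa : exists m, Pa m.
  pose q : int := - (absz (ty L - k))%:Z; exists (absz (k - (ty L + n%:Z * q))%R).
  apply/asboolP; exists (zs q L); first exact: Szs.
  by rewrite tyz; [rewrite /q; nia|exact: Slat].
have exb : exists m, Pb m.
  pose q : int := (absz (ty L - (k + 1))%R)%:Z.
  exists (absz ((ty L + n%:Z * q) - (k + 1))%R).
  apply/asboolP; exists (zs q L); first exact: Szs.
  by rewrite tyz; [rewrite /q; nia|exact: Slat].
case: (ex_minnP exa) => a /asboolP[A SA tA] mina.
case: (ex_minnP exb) => b /asboolP[B SB tB] minb.
exists A, B; split=> //; [by lia|by lia|move=> X SX].
have [h|h] := leP (ty X) k.
  left; apply: (mflag_le hS) => //; rewrite tA.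
  have := mina (absz (k - ty X)); rewrite /Pa.
  have -> : k - (absz (k - ty X))%:Z = ty X by lia.
  by move=> /(_ (asboolT (ex_intro2 _ _ X SX erefl))); lia.
right; apply: (mflag_le hS) => //; rewrite tB.
have := minb (absz (ty X - (k + 1))%R); rewrite /Pb.
have -> : k + 1 + (absz (ty X - (k + 1))%R)%:Z = ty X by lia.
by move=> /(_ (asboolT (ex_intro2 _ _ X SX erefl))); lia.
Qed.

(** Otherwise the translates of [C] could be added to the chain. *)
Lemma max_gap S A B C : mflag S ->
  (forall S', mflag S' -> S `<=` S' -> S' `<=` S) ->
  (forall X, S X -> A `<=` X \/ X `<=` B) -> M C -> B `<=` C -> C `<=` A -> S C.
Proof.
move=> hS max gap MC BC CA; apply: (max _ (mflag_insert hS MC _)).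
- move=> X SX; case: (gap X SX) => h; first by right; exact: subset_trans h.
  by left; exact: subset_trans BC.
- by move=> X; left.
- by right; exists 0 => //; rewrite zs0.
Qed.

Hypothesis Mint : interpolating L0 M.

Definition full S := forall k, exists2 L, S L & ty L = k.

Lemma max_full S : mflag S ->
  (forall S', mflag S' -> S `<=` S' -> S' `<=` S) -> full S.
Proof.
move=> hS max k; have [A [B [SA SB tA tB gap]]] := mflag_gap k hS.
have [_ SM _ _] := hS.
have [tAk|tAk] := eqVneq (ty A) k; first by exists A.
have BA : B `<=` A by apply: (mflag_le hS) => //; lia.
have [|C [MC BC CA tC]] := Mint (SM _ SA) (SM _ SB) BA; first by lia.
have SC := max_gap hS max gap MC BC CA.
have [] := gap C SC => h.
  by have := ty_le hL0 (Mlat MC) (Mlat (SM _ SA)) h; lia.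
by have := ty_le hL0 (Mlat (SM _ SB)) (Mlat MC) h; lia.
Qed.

Lemma full_tchain S : mflag S -> full S -> exists2 V, tchain V & S = range V.
Proof.
move=> hS fS; have /choice[V hV] : forall k, exists L, S L /\ ty L = k.
  by move=> k; have [L ? ?] := fS k; exists L.
have [_ SM _ Szs] := hS.
have SV k : S (V k) by case: (hV k).
have tV k : ty (V k) = k by case: (hV k).
exists V.
  split=> // [k|k|k]; first exact: SM.
    by apply: (mflag_le hS) => //; rewrite !tV; lia.
  apply: (mflag_eq hS) => //; first exact: Szs.
  by rewrite tyz ?tV ?mulr1//; exact/Mlat/SM.
apply/seteqP; split=> [L SL|_ [k _ <-]//].
by exists (ty L) => //; apply: (mflag_eq hS).
Qed.

Lemma mflag_ext S : mflag S -> exists2 V, tchain V & S `<=` range V.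
Proof.
move=> hS; have [S' [hS' SS' max]] := mflag_max hS.
have [V hV e] := full_tchain hS' (max_full hS' max).
by exists V => //; rewrite -e.
Qed.

End Family.

Lemma mflag_sub (M M' : set (set H)) S : M `<=` M' -> mflag M S -> mflag M' S.
Proof. by move=> MM' [? SM ? ?]; split=> //; exact: subset_trans MM'. Qed.

Let lat_zs k L : lattice L -> lattice (zs k L).
Proof. exact: lattice_zs. Qed.

Let lat_int := lattice_interpolating hL0.

(** The index [k] is given to the member of largest type at most [k]: a member is
    repeated over the types which do not occur. *)
Lemma mflag_flag (hn : (2 <= n)%N) S : mflag lattice S -> flag S.
Proof.
move=> hS; have [V hV SV] := mflag_ext (fun _ h => h) lat_zs hn lat_int hS.
have [[L SL] SM _ Szs] := hS; have [VM tV Vle Vz] := hV.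
have /choice[g hg] : forall k, exists l,
    [/\ l <= k, S (V l) & forall l', l < l' -> l' <= k -> ~ S (V l')].
  move=> k; pose P (m : nat) := `[< S (V (k - m%:Z)) >].
  have exP : exists m, P m.
    pose q : int := - (absz (ty L - k))%:Z.
    have SqL : S (zs q L) by exact: Szs.
    exists (absz (k - (ty L + n%:Z * q))%R); apply/asboolP.
    have -> : k - (absz (k - (ty L + n%:Z * q))%R)%:Z = ty (zs q L).
      by rewrite tyz; [rewrite /q; nia|exact: SM].
    by rewrite -(tchain_range hV (SV _ SqL)).
  case: (ex_minnP exP) => m /asboolP Sm minm; exists (k - m%:Z); split=> //; first by lia.
  move=> l' h1 h2 Sl'; have := minm (absz (k - l')); rewrite /P.
  have -> : k - (absz (k - l'))%:Z = l' by lia.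
  by move=> /(_ (asboolT Sl')); lia.
have gu k l : l <= k -> S (V l) -> (forall l', l < l' -> l' <= k -> ~ S (V l')) -> g k = l.
  move=> lk Sl hl; have [gk Sg hgk] := hg k; apply/eqP; rewrite eq_le.
  apply/andP; split; rewrite leNgt; apply/negP => h.
    exact: hl h gk Sg.
  exact: hgk h lk Sl.
have Szs' l q : S (V l) <-> S (V (l + q * n%:Z)).
  split=> h; first by rewrite -(tchain_zs _ _ hV); exact: Szs.
  by have := Szs (- q) _ h; rewrite (tchain_zs _ _ hV) mulNr addrK.
have gn k : g (k + n%:Z) = g k + n%:Z.
  have [gk Sg hgk] := hg k; apply: gu; first by rewrite lerD2r.
    by have := (Szs' (g k) 1).1 Sg; rewrite mul1r.
  move=> l' h1 h2 Sl'; apply: (hgk (l' - n%:Z)); rewrite ?ltrBrDr ?lerBlDr//.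
  by have := (Szs' l' (-1)).1 Sl'; rewrite mulN1r.
exists (V \o g); last first.
  apply/seteqP; split=> [X SX|_ [k _ <-]]; last by case: (hg k).
  exists (ty X) => //=; rewrite (gu _ (ty X))//.
  - exact/esym/(tchain_range hV)/SV.
  - by rewrite -(tchain_range hV (SV _ SX)).
  - by move=> l' h1 h2; have := lt_le_trans h1 h2; rewrite ltxx.
split=> k /=.
- by apply: (lattice_Gr hL0); exact: VM.
- apply: (tchain_le hV); have [h1 _ h2] := hg k; have [_ _ h4] := hg (k + 1).
  by have [_ Sg _] := hg k; rewrite leNgt; apply/negP => /h4; apply=> //; lia.
- by rewrite gn; exact: Vz.
Qed.

Lemma flag_mflag S : flag S -> S `<=` lattice -> mflag lattice S.
Proof.
move=> [W [_ Wle Wz] ->] SM; split=> //; first by exists (W 0), 0.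
  move=> _ _ [k _ <-] [l _ <-]; have [kl|lk] := leP k l.
    by right; exact: chain_le.
  by left; apply: chain_le => //; exact: ltW.
by move=> q _ [k _ <-]; rewrite (chain_zs _ _ Wz); exists (k + q * n%:Z).
Qed.

End Flags.

(** * Complexes of chains *)

Section Complex.
Variables (R : realType) (n : nat).
Hypothesis hn : (2 <= n)%N.
Local Notation H := (L2 R n).
Variable L0 : set H.
Hypothesis hL0 : forall k, Gr_nplus (zs k L0).
Implicit Types (L : set H) (k l q : int) (S : set (set H)) (V : int -> set H).
Local Notation lattice := (lattice L0).
Local Notation ty := (ty L0).
Local Notation dv x := ((n%:Z %| x)%Z).

(** The elementary flag of a lattice. *)
Definition orb L : set (set H) := [set zs k L | k in [set: int]].

Lemma orb_refl L : orb L L.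
Proof. by exists 0 => //; rewrite zs0. Qed.

Lemma orb_zs k L : orb (zs k L) = orb L.
Proof.
apply/seteqP; split=> [_ [q _ <-]|_ [q _ <-]].
  by exists (q + k) => //; rewrite zsD.
by exists (q - k) => //; rewrite -zsD subrK.
Qed.

Lemma orb_eq L L' : orb L = orb L' -> exists k, L' = zs k L.
Proof. by move=> e; have := orb_refl L'; rewrite -e => -[k _ <-]; exists k. Qed.

Section Family.
Variable M : set (set H).
Hypothesis Mlat : M `<=` lattice.
Hypothesis Mzs : forall k L, M L -> M (zs k L).

Lemma orb_sub S L : mflag M S -> (orb L `<=` S <-> S L).
Proof.
move=> [_ _ _ Szs]; split=> [|SL _ [k _ <-]]; first by apply; exact: orb_refl.
exact: Szs.
Qed.

Lemma flag_simplexE S : mflag M S -> flag_simplex S = orb @` S.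
Proof.
move=> hS; apply/seteqP; split=> [E [[L _ EL] ES]|_ [L SL <-]].
  exists L; last by rewrite EL.
  by apply: ES; rewrite EL; exact: orb_refl.
split; last exact/(orb_sub _ hS).
exists L => //; apply: (lattice_Gr hL0); apply: Mlat.
by have [_ h _ _] := hS; exact: h.
Qed.

Lemma simplex_orb S L : mflag M S -> (flag_simplex S (orb L) <-> S L).
Proof.
move=> hS; rewrite flag_simplexE//; split=> [[L' SL' /orb_eq[k ->]]|SL].
  by have [_ _ _ h] := hS; exact: h.
by exists L.
Qed.

Lemma simplex_sub S S' : mflag M S -> mflag M S' ->
  (flag_simplex S `<=` flag_simplex S' <-> S `<=` S').
Proof.
move=> hS hS'; split=> [h L SL|h E [E1 E2]]; last first.
  by split=> //; exact: subset_trans h.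
by apply/(simplex_orb _ hS'); apply: h; apply/simplex_orb.
Qed.

Lemma simplex_inj S S' : mflag M S -> mflag M S' ->
  flag_simplex S = flag_simplex S' -> S = S'.
Proof.
move=> hS hS' e; apply/seteqP.
by split; apply/simplex_sub => //; rewrite e.
Qed.

Lemma simplex_face S t : mflag M S -> t `<=` flag_simplex S -> t !=set0 ->
  exists S', [/\ mflag M S', S' `<=` S & t = flag_simplex S'].
Proof.
move=> hS tS [E tE]; pose S' := [set L | S L /\ t (orb L)].
have [_ SM Stot Szs] := hS; rewrite (flag_simplexE hS) in tS.
have hS' : mflag M S'.
  split.
  - by have [L SL EL] := tS _ tE; exists L; split=> //; rewrite EL.
  - by move=> L [/SM].
  - by move=> A B [SA _] [SB _]; exact: Stot.
  - by move=> k L [SL tL]; split; [exact: Szs|rewrite orb_zs].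
exists S'; split=> //; first by move=> L [].
rewrite flag_simplexE//; apply/seteqP; split=> [E' tE'|_ [L [_ tL] <-]//].
by have [L SL EL] := tS _ tE'; exists L => //; split=> //; rewrite EL.
Qed.

Local Notation KM := (flag_complex (mflag M)).

Lemma orb_mflag L : M L -> mflag M (orb L).
Proof.
move=> ML; split.
- by exists L; exact: orb_refl.
- by move=> _ [k _ <-]; exact: Mzs.
- move=> _ _ [k _ <-] [l _ <-]; have [kl|lk] := leP k l.
    by right; apply: lattice_zle (Mlat ML) kl.
  by left; apply: lattice_zle (Mlat ML) (ltW lk).
- by move=> q _ [k _ <-]; exists (q + k) => //; rewrite zsD.
Qed.

Lemma vertexP E : KM [set E] <-> exists2 L, M L & E = orb L.
Proof.
split=> [[S hS e]|[L ML ->]].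
  have [[L SL] SM _ _] := hS; exists L; first exact: SM.
  by have := (simplex_orb L hS).2 SL; rewrite e => ->.
exists (orb L); first exact: orb_mflag.
rewrite flag_simplexE; last exact: orb_mflag.
apply/seteqP; split=> [_ [_ [k _ <-] <-]|_ ->]; first by rewrite orb_zs.
by exists L => //; exact: orb_refl.
Qed.

Lemma tchain_orb_eq V k l : tchain L0 M V -> orb (V k) = orb (V l) <-> dv (l - k).
Proof.
move=> hV; split=> [/orb_eq[q]|/dvdzP[q lk]].
  rewrite (tchain_zs _ _ hV) => /(tchain_inj hV) ->; apply/dvdzP; exists q.
  by rewrite addrC addKr.
have -> : l = k + q * n%:Z by lia.
by rewrite -(tchain_zs _ _ hV) orb_zs.
Qed.

Lemma tchain_simplex V : tchain L0 M V ->
  flag_simplex (range V) = [set orb (V k) | k in [set: int]].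
Proof.
move=> hV; rewrite flag_simplexE; last exact: tchain_mflag hV.
apply/seteqP; split=> [_ [_ [k _ <-] <-]|_ [k _ <-]]; first by exists k.
by exists (V k) => //; exists k.
Qed.

Lemma tchain_card V : tchain L0 M V -> (flag_simplex (range V) #= `I_n)%card.
Proof.
move=> hV; rewrite tchain_simplex//.
have -> : [set orb (V k) | k in [set: int]] = (fun i : nat => orb (V i%:Z)) @` `I_n.
  apply/seteqP; split=> [_ [k _ <-]|_ [i _ <-]]; last by exists i%:Z.
  have k0 : 0 <= (k %% n%:Z)%Z by rewrite modz_ge0//; lia.
  exists (absz (k %% n%:Z)%Z) => /=.
    by rewrite -ltz_nat gez0_abs// ltz_pmod//; lia.
  apply/tchain_orb_eq => //; rewrite gez0_abs//; apply/dvdzP.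
  by exists (k %/ n%:Z)%Z; have := divz_eq k n%:Z; lia.
apply: inj_card_eq => i j /set_mem/= i_n /set_mem/= j_n /(tchain_orb_eq _ _ hV) h.
have := @dv_neq n hn 0 (j%:Z - i%:Z) (dvdz0 _); rewrite h.
have [->//|ij] := eqVneq i j; move=> F; suff: ~~ true by [].
by apply: F; lia.
Qed.

Lemma tchain_simplex_inj V V' : tchain L0 M V -> tchain L0 M V' ->
  flag_simplex (range V) = flag_simplex (range V') -> V = V'.
Proof.
move=> hV hV' /simplex_inj e; apply/funext => k.
have {}e := e (tchain_mflag hV) (tchain_mflag hV').
have : range V' (V k) by rewrite -e; exists k.
by move=> /(tchain_range hV'); case: (hV) => _ -> _ _.
Qed.

Lemma complex_simplicial : (forall S, mflag M S -> exists2 V, tchain L0 M V & S `<=` range V) ->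
  simplicial_complex KM.
Proof.
move=> ext _ [S hS <-]; split.
- have [V hV SV] := ext _ hS.
  have /(sub_finite_set) := (simplex_sub hS (tchain_mflag hV)).2 SV; apply.
  by exists n; exact: tchain_card.
- by have [[L SL] _ _ _] := hS; exists (orb L); apply/simplex_orb.
- move=> t tS t0; have [S' [hS' _ ->]] := simplex_face hS tS t0.
  by exists S'.
Qed.

Hypothesis Mint : interpolating L0 M.

Let ext S : mflag M S -> exists2 V, tchain L0 M V & S `<=` range V.
Proof. exact: (mflag_ext hL0 Mlat Mzs hn Mint). Qed.

(** A chain can be refined until it has a member of each type, and then no
    further. *)
Lemma chamberP c : chamber KM c <-> exists2 V, tchain L0 M V & c = flag_simplex (range V).
Proof.
split=> [[[S hS <-] max]|[V hV ->]].
  have [V hV SV] := ext hS; exists V => //; apply/esym/max.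
    by exists (range V) => //; exact: tchain_mflag hV.
  by apply/simplex_sub => //; exact: tchain_mflag hV.
have hR := tchain_mflag hV.
split=> [|_ [S hS <-] /(simplex_sub hR hS) RS]; first by exists (range V).
congr flag_simplex; apply/seteqP; split=> // L SL.
exists (ty L) => //; apply: (mflag_eq hL0 Mlat hS) => //.
  by apply: RS; exists (ty L).
by case: hV => _ -> _ _.
Qed.

Lemma complex_axioms : (forall c d, chamber KM c -> chamber KM d -> gallery KM c d) ->
  chamber_complex KM.
Proof.
move=> gal; split=> //; first exact: complex_simplicial.
  move=> _ [S hS <-]; have [V hV SV] := ext hS.
  exists (flag_simplex (range V)); first by apply/chamberP; exists V.
  by apply/simplex_sub => //; exact: tchain_mflag hV.
by exists n => _ /chamberP[V hV ->]; exact: tchain_card.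
Qed.

Lemma tchain_simplexD1 V k : tchain L0 M V ->
  flag_simplex (range V) `\ orb (V k) = [set orb (V l) | l in [set l | ~~ dv (l - k)]].
Proof.
move=> hV; rewrite tchain_simplex//; apply/seteqP; split=> [_ [[l _ <-] ne]|_ [l lk <-]].
  exists l => //=; apply/negP => lk; apply: ne; apply/tchain_orb_eq => //.
  by rewrite -rpredN opprB.
split; first by exists l.
by move=> /= /(tchain_orb_eq _ _ hV); rewrite -rpredN opprB (negbTE lk).
Qed.

Lemma tchain_adjacent V V' k : tchain L0 M V -> tchain L0 M V' ->
  (forall l, ~~ dv (l - k) -> V l = V' l) ->
  adjacent (flag_simplex (range V)) (flag_simplex (range V')).
Proof.
move=> hV hV' e; exists (orb (V k)), (orb (V' k)); split.
- by rewrite tchain_simplex//; exists k.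
- by rewrite tchain_simplex//; exists k.
- rewrite !tchain_simplexD1//; apply: eq_imagel => l lk.
  by rewrite e.
Qed.

Lemma panelP s : panel KM s -> exists V k,
  tchain L0 M V /\ s = flag_simplex (range V) `\ orb (V k).
Proof.
move=> [c [x [/chamberP[V hV ->]]]]; rewrite {1}tchain_simplex// => -[k _ <-] ->.
by exists V, k.
Qed.

Lemma panel_sub V V' k : tchain L0 M V -> tchain L0 M V' ->
  (flag_simplex (range V) `\ orb (V k) `<=` flag_simplex (range V')) <->
  (forall l, ~~ dv (l - k) -> V' l = V l).
Proof.
move=> hV hV'; rewrite tchain_simplexD1//; split=> [h l lk|e _ [l lk <-]].
  have /(simplex_orb _ (tchain_mflag hV')) : flag_simplex (range V') (orb (V l)).
    by apply: h; exists l.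
  by move=> /(tchain_range hV'); case: hV => _ -> _ _.
by rewrite -(e l lk) tchain_simplex//; exists l.
Qed.

(** Replacing one lattice also replaces its translates, which are the lattices of
    the chain whose types are congruent to [k]. *)
Lemma tchain_update V k L : tchain L0 M V -> M L -> ty L = k ->
  V (k + 1) `<=` L -> L `<=` V (k - 1) ->
  exists V', [/\ tchain L0 M V', V' k = L & forall l, ~~ dv (l - k) -> V' l = V l].
Proof.
move=> hV ML tL VL LV; have [VM tV Vle Vz] := hV.
have n0 : n%:Z != 0 by lia.
pose V' l := if dv (l - k) then zs ((l - k) %/ n%:Z)%Z L else V l.
have E q : V' (k + q * n%:Z) = zs q L.
  by rewrite /V' addrC addKr dvdz_mull ?dvdzz// mulzK.
exists V'; split; last first.
- by move=> l; rewrite /V' => /negbTE ->.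
- by have := E 0; rewrite mul0r addr0 zs0.
split=> l.
- by rewrite /V'; case: ifP => // _; exact: Mzs.
- have [/dvdzP[q lk]|h] := boolP (dv (l - k)); last by rewrite /V' (negbTE h).
  have -> : l = k + q * n%:Z by lia.
  by rewrite E (tyz hL0) ?tL; [lia|exact: Mlat].
- have [/dvdzP[q lk]|h] := boolP (dv (l - k)).
    have -> : l = k + q * n%:Z by lia.
    rewrite E (_ : V' _ = zs q (V (k + 1))); first exact: zs_mono.
    rewrite (tchain_zs _ _ hV) /V' ifN.
      by congr V; lia.
    have := @dv_neq n hn (q * n%:Z) (q * n%:Z + 1) (dvdz_mull _ (dvdzz _)).
    by rewrite (_ : k + _ + 1 - k = q * n%:Z + 1); [apply; lia|lia].
  have [/dvdzP[q lk]|h'] := boolP (dv (l + 1 - k)).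
    have -> : l + 1 = k + q * n%:Z by lia.
    rewrite E (_ : V' l = zs q (V (k - 1))); first exact: zs_mono.
    by rewrite /V' (negbTE h) (tchain_zs _ _ hV); congr V; lia.
  by rewrite /V' (negbTE h) (negbTE h'); exact: Vle.
- have [/dvdzP[q lk]|h] := boolP (dv (l - k)).
    have -> : l = k + q * n%:Z by lia.
    rewrite E -zsD (_ : k + q * n%:Z + n%:Z = k + (1 + q) * n%:Z) ?E//; last by lia.
  rewrite /V' (negbTE h) ifN ?Vz// (_ : _ - k = (l - k) + n%:Z); last by lia.
  by rewrite rpredDr ?dvdzz.
Qed.

End Family.

End Complex.

(** * The flags of a compatibility class *)

Section Class.
Variables (R : realType) (n : nat).
Hypothesis hn : (2 <= n)%N.
Local Notation H := (L2 R n).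

(** Compatibility with a flag containing the translates of [L0] means that each
    member lies between two of these translates. *)
Lemma class_lattice (F : set (set (set H))) : compatibility_class F ->
  exists2 L0, (forall k, Gr_nplus (zs k L0)) & F = mflag (lattice L0).
Proof.
move=> [_ [W hW ->] ->]; have [WG Wle Wz] := hW; exists (W 0).
  by move=> k; rewrite (chain_zs _ _ Wz).
have hL0 k : Gr_nplus (zs k (W 0)) by rewrite (chain_zs _ _ Wz).
have sand A k l : Gr_nplus A -> W k `<=` A -> A `<=` W l -> lattice (W 0) A.
  move=> [GA zA] kA Al; split=> //; first by case: GA => -[].
  exists (absz k + absz l)%N; rewrite !(chain_zs _ _ Wz); split.
    by apply: (subset_trans _ kA); apply: chain_le => //; nia.
  by apply: (subset_trans Al); apply: chain_le => //; nia.
have hSW : mflag (lattice (W 0)) (range W).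
  by apply: flag_mflag; [exists W|move=> _ [k _ <-]; exact: (sand _ k k)].
have sub S S' : mflag (lattice (W 0)) S -> mflag (lattice (W 0)) S' ->
    forall A, S A -> (exists2 B, S' B & B `<=` A) /\ (exists2 B, S' B & A `<=` B).
  move=> [_ SM _ _] [[B SB] SM' _ Szs] A SA.
  have [N hN] := lattice_dir hL0 (SM' _ SB) (SM _ SA).
  have [N' hN'] := lattice_dirV hL0 (SM' _ SB) (SM _ SA).
  split; [exists (zs N%:Z B)|exists (zs (- N'%:Z) B)] => //; exact: Szs.
apply/seteqP; split=> [S [fS [_ c]]|S hS].
  apply: flag_mflag => // A SA.
  have [[_ [k _ <-] kA] [_ [l _ <-] Al]] := c A SA; apply: sand kA Al.
  by case: fS SA => W' [WG' _ _] -> [j _ <-].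
split; first exact: mflag_flag hL0 hn _ hS.
by split; exact: sub.
Qed.

End Class.

(** * Bases of chains *)

Section FiniteSpans.
Variables (K : fieldType) (E : lmodType K) (I : Type).
Implicit Types (u : I -> E) (X Y : set I) (A B : set E).

(** The algebraic span, as an intersection: an inclusion of it in a subspace is
    then checked on the generators. *)
Definition fin u X : set E :=
  [set f | forall A, subspace A -> (forall a, X a -> A (u a)) -> A f].

Lemma fin_subspace u X : subspace (fin u X).
Proof.
apply/subspaceP; split=> [A sA _|c f g Xf Xg A sA h]; first exact: sub0.
by apply: subZD => //; [exact: Xf|exact: Xg].
Qed.

Lemma fin_gen u X a : X a -> fin u X (u a).
Proof. by move=> Xa A _; exact. Qed.

Lemma fin_min u X A : subspace A -> (forall a, X a -> A (u a)) -> fin u X `<=` A.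
Proof. by move=> sA h f; exact. Qed.

Lemma fin_mono u X Y : X `<=` Y -> fin u X `<=` fin u Y.
Proof.
by move=> XY; apply: fin_min => [|a /XY]; [exact: fin_subspace|exact: fin_gen].
Qed.

Lemma finU u X Y : fin u (X `|` Y) `<=` sumset (fin u X) (fin u Y).
Proof.
apply: fin_min; first by apply: subspace_sum; exact: fin_subspace.
move=> a [Xa|Ya].
  by apply: sumset_ge_l; [exact: fin_subspace|exact: fin_gen].
by apply: sumset_ge_r; [exact: fin_subspace|exact: fin_gen].
Qed.

Lemma fin1 u a f : fin u [set a] f -> exists c, f = c *: u a.
Proof.
move=> h; apply: (h [set f | exists c, f = c *: u a]) => [|_ ->].
  2: by exists 1; rewrite scale1r.
apply/subspaceP; split=> [|c _ _ [d ->] [e ->]]; first by exists 0; rewrite scale0r.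
by exists (c * d + e); rewrite scalerDl scalerA.
Qed.

Lemma qd1_step A B x f : subspace B -> quotient_dim A B 1 -> A x -> ~ B x -> A f ->
  exists c, B (f - c *: x).
Proof.
move=> sB /(qd1P _ sB)[v Av [nBv gen]] Ax nBx Af.
have [c Bc] := gen _ Af; have [d Bd] := gen _ Ax.
have d0 : d != 0 by apply: contra_notN nBx => /eqP d0; rewrite d0 scale0r subr0 in Bd.
exists (c / d); rewrite (_ : _ - _ = (f - c *: v) - (c / d) *: (x - d *: v)).
  by apply: subB => //; exact: subZ.
by rewrite scalerBr scalerA divfK// opprB addrA subrK.
Qed.

End FiniteSpans.

Section Bases.
Variables (R : realType) (n : nat).
Hypothesis hn : (2 <= n)%N.
Local Notation H := (L2 R n).
Variable L0 : set H.
Hypothesis hL0 : forall k, Gr_nplus (zs k L0).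
Implicit Types (L : set H) (k l q : int) (X Y : set int) (V : int -> set H).
Implicit Types (u : int -> H).
Local Notation lattice := (lattice L0).
Local Notation ty := (ty L0).
Local Notation tchain := (tchain L0).

(** The index sets of lattices: the first condition is stability under z, the two
    others are commensurability with the half-lines. *)
Definition nset X := [/\ forall a, X a -> X (a + n%:Z),
  exists N, forall a, N <= a -> X a & exists N, forall a, X a -> N <= a].

Definition tail k : set int := [set l | k <= l].

Lemma nset_tail k : nset (tail k).
Proof. by rewrite /tail; split=> [a /= ?||]; [lia|exists k|exists k]. Qed.

Lemma nsetI X Y : nset X -> nset Y -> nset (X `&` Y).
Proof.
move=> [Xn [N hN] [M hM]] [Yn [N' hN'] _]; split.
- by move=> a [/Xn ? /Yn].
- by exists (Num.max N N') => a; rewrite ge_max => /andP[/hN ? /hN'].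
- by exists M => a [/hM].
Qed.

Lemma nsetU X Y : nset X -> nset Y -> nset (X `|` Y).
Proof.
move=> [Xn [N hN] [M hM]] [Yn _ [M' hM']]; split.
- by move=> a [/Xn ?|/Yn]; [left|right].
- by exists N => a /hN; left.
- by exists (Num.min M M') => a; rewrite ge_min => -[/hM ->|/hM' ->] //; rewrite orbT.
Qed.

Definition shift q X : set int := [set a | X (a - q * n%:Z)].

Lemma nset_shift q X : nset X -> nset (shift q X).
Proof.
move=> [Xn [N hN] [M hM]]; rewrite /shift; split.
- by move=> a /= /Xn; rewrite addrAC.
- by exists (N + q * n%:Z) => a /= ?; apply: hN; lia.
- by exists (M + q * n%:Z) => a /= /hM; lia.
Qed.

Definition spn u X : set H := closed_span (u @` X).

Definition latts u : set (set H) := spn u @` nset.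

(** An equivariant family with one vector of order [k] in the chain for each [k].
    The condition on closed spans does not follow from the others: when [n = 1],
    for [V k = z^k H^+] and [u k = z^k (z - 1/2)], the closed span is smaller
    than [V k]. *)
Definition basis V u := [/\ tchain lattice V, forall k, zpow 1 (u k) = u (k + n%:Z),
  forall k, V k (u k), forall k, ~ V (k + 1) (u k) & forall k, V k = spn u (tail k)].

Lemma basis_zpow u q k : (forall k, zpow 1 (u k) = u (k + n%:Z)) ->
  zpow q (u k) = u (k + q * n%:Z).
Proof.
move=> h.
have hN (N : nat) l : zpow N%:Z (u l) = u (l + N%:Z * n%:Z).
  elim: N => [|N IH]; first by rewrite zpow0 mul0r addr0.
  by rewrite intS zpowD IH h; congr u; lia.
case: q => N; first exact: hN.
rewrite -[RHS](zpowK N.+1%:Z) hN NegzE; congr (zpow _ (u _)); lia.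
Qed.

Lemma tchain_step V k (x f : H) : tchain lattice V -> V k x -> ~ V (k + 1) x -> V k f ->
  exists c, V (k + 1) (f - c *: x).
Proof.
move=> [Vl tV Vle _]; apply: qd1_step; first exact: lattice_sub (Vl _).
by apply: (ty_qd_eq hL0) => //; rewrite !tV.
Qed.

Section Basis.
Variables (V : int -> set H) (u : int -> H).
Hypothesis hB : basis V u.

Let hV : tchain lattice V. Proof. by case: hB. Qed.
Let Vl k : lattice (V k). Proof. by case: hV. Qed.
Let sV k : subspace (V k). Proof. exact: lattice_sub (Vl k). Qed.
Let Vu k : V k (u k). Proof. by case: hB. Qed.
Let nVu k : ~ V (k + 1) (u k). Proof. by case: hB. Qed.
Let VE k : V k = spn u (tail k). Proof. by case: hB. Qed.
Let uz q k : zpow q (u k) = u (k + q * n%:Z).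
Proof. by apply: basis_zpow => k'; case: hB. Qed.
Let Vle k l : k <= l -> V l `<=` V k. Proof. exact: (tchain_le hV). Qed.

Let subKr' (f s : H) : f - (f - s) = s. Proof. by rewrite opprB addrC subrK. Qed.

Lemma basis_step k f : V k f -> exists c, V (k + 1) (f - c *: u k).
Proof. exact: tchain_step. Qed.

Lemma fin_tail X k : X `<=` tail k -> fin u X `<=` V k.
Proof. by move=> h; apply: fin_min => // a /h ka; apply: (Vle ka). Qed.

(** The vectors have distinct orders, so that the term of lowest order of a
    combination cannot be cancelled. *)
Lemma fin_lead X M a f : X `<=` tail M -> fin u X f -> V a f ->
  fin u (X `&` tail a) f.
Proof.
move=> XM Xf; have [h|h] := leP a M.
  by move=> _; apply: fin_mono Xf => b Xb; split=> //; apply: (le_trans h (XM b Xb)).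
have -> : a = M + (absz (a - M))%:Z by lia.
elim: (absz _) => [|m IH] Vf.
  by apply: fin_mono Xf => b Xb; split=> //; rewrite addr0; exact: XM.
move eb : (M + m%:Z) IH => b IH; have eb1 : M + m.+1%:Z = b + 1 by lia.
rewrite eb1 in Vf *.
have {}IH := IH (Vle _ Vf); have {IH} Xbf : fin u (X `&` tail b) f by apply: IH; lia.
have [Xb|nXb] := pselect (X b); last first.
  apply: fin_mono Xbf => c [Xc bc]; split=> //; rewrite /tail /=.
  by have : c != b; [apply: contra_notN nXb => /eqP <-|rewrite /tail/= in bc; lia].
have Ubf : fin u ([set b] `|` (X `&` tail (b + 1))) f.
  apply: fin_mono Xbf => c [Xc]; rewrite /tail /= => bc.
  have [->|cb] := eqVneq c b; first by left.
  by right; split=> //; rewrite /tail /=; lia.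
have /sumsetP[l [g [Xl Xg fE]]] := finU Ubf; have [d lE] := fin1 Xl; subst l.
have Vg : V (b + 1) g by apply: (fin_tail _ Xg) => c [].
have [d0|d0] := eqVneq d 0; first by rewrite fE d0 scale0r add0r.
case: (@nVu b); rewrite -[u b](scalerK d0); apply: subZ => //.
by apply: (subDl (sV _) Vg); rewrite -fE.
Qed.

Lemma fin_approx N M f : V N f -> N <= M -> exists2 s, fin u (tail N) s & V M (f - s).
Proof.
move=> Vf NM; have -> : M = N + (absz (M - N))%:Z by lia.
elim: (absz _) => [|m [s Xs Vs]].
  by exists 0; [exact: (sub0 (fin_subspace _ _))|rewrite addr0 subr0].
have [c Vc] := basis_step Vs; exists (s + c *: u (N + m%:Z)).
  apply: (subD (fin_subspace u (tail N)) Xs).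
  apply: (subZ c (fin_subspace u (tail N))); apply: (@fin_gen _ _ _ u (tail N)).
  by rewrite /tail /=; lia.
by rewrite opprD addrA (_ : N + m.+1%:Z = N + m%:Z + 1)//; lia.
Qed.

(** The closure of [fin u X] for the filtration [V] instead of the norm. It can
    be handled by finite computations, and for index sets it is the closed span. *)
Definition approx X : set H := [set f | forall N, exists2 s, fin u X s & V N (f - s)].

Lemma approx_subspace X : subspace (approx X).
Proof.
apply/subspaceP; split=> [N|c f g Xf Xg N].
  by exists 0; [exact: (sub0 (fin_subspace _ _))|rewrite subr0; exact: sub0].
have [s Xs Vs] := Xf N; have [t Xt Vt] := Xg N; exists (c *: s + t).
  exact: (subZD _ (fin_subspace u _) Xs Xt).
by rewrite opprD addrACA -scalerBr; exact: subZD.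
Qed.

Lemma approx_gen X : u @` X `<=` approx X.
Proof.
move=> _ [a Xa <-] N; exists (u a); first exact: fin_gen.
by rewrite subrr; exact: sub0.
Qed.

Lemma approx_zpow X q f : approx X f -> approx (shift q X) (zpow q f).
Proof.
move=> Xf N; have [s Xs Vs] := Xf (N - q * n%:Z); exists (zpow q s).
  apply: (Xs (zpow q @^-1` fin u (shift q X))).
    by apply: subspace_preimg (zpow_linear q) _ _; exact: fin_subspace.
  by move=> a Xa /=; rewrite uz; apply: fin_gen; rewrite /shift /= addrK.
rewrite -(linB (zpow_linear q)) -[N](subrK (q * n%:Z)) -(tchain_zs _ q hV).
by exists (f - s).
Qed.

Lemma approx_tail X N : nset X -> (forall a, N <= a -> X a) -> V N `<=` approx X.
Proof.
move=> hX hN f Vf M; have [h|h] := leP N M.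
  have [s Ns Vs] := fin_approx Vf h; exists s => //.
  by apply: fin_mono Ns => a; exact: hN.
exists 0; first exact: (sub0 (fin_subspace _ _)).
by rewrite subr0; apply: Vle Vf; exact: ltW.
Qed.

Lemma approx_le X M : X `<=` tail M -> approx X `<=` V M.
Proof.
move=> XM f /(_ M)[s Xs Vs]; rewrite -[f](subrK s); apply: subD => //.
exact: fin_tail Xs.
Qed.

Lemma approx_lattice X : nset X -> lattice (approx X).
Proof.
move=> hX; have [Xn [N hN] [M hM]] := hX.
apply: (lattice_sandwich hL0 (Vl N) (Vl M)).
- exact: approx_tail.
- by apply: approx_le => a /hM.
- exact: approx_subspace.
- move=> _ [f Xf <-] k; have [s Xs Vs] := approx_zpow 1 Xf k; exists s => //.
  apply: fin_mono Xs => a; rewrite /shift /= mul1r => /Xn.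
  by rewrite subrK.
Qed.

(** [approx X] is closed because it is a lattice. *)
Lemma spnE X : nset X -> spn u X = approx X.
Proof.
move=> hX; have [_ [N hN] _] := hX; apply/seteqP; split.
  apply: closed_span_min; last exact: approx_gen.
  by have [[]] := lattice_Gr hL0 (approx_lattice hX).
have [sS _] := closed_span_closed (u @` X).
move=> f /(_ N)[s Xs Vs]; rewrite -[f](subrK s); apply: (subD sS).
  move: Vs; rewrite VE; apply: closed_span_mono => _ [a Na <-].
  by exists a => //; exact: hN.
by apply: Xs => // a Xa; apply: sub_closed_span; exists a.
Qed.

Lemma spn_lattice X : nset X -> lattice (spn u X).
Proof. by move=> hX; rewrite spnE//; exact: approx_lattice. Qed.

Lemma shiftK q X : shift (- q) (shift q X) = X.
Proof. by apply/seteqP; split=> a; rewrite /shift /= mulNr opprK addrK. Qed.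

Lemma spn_zs q X : nset X -> zs q (spn u X) = spn u (shift q X).
Proof.
move=> hX; rewrite (spnE hX) (spnE (nset_shift q hX)); apply/seteqP; split.
  by move=> _ [f Xf <-]; exact: approx_zpow.
move=> f Xf; apply/zsP; rewrite -[X](shiftK q); exact: approx_zpow.
Qed.

(** The index set is recovered from the lattice and the chain, as the set of
    orders of the elements of the lattice. *)
Lemma spn_head X a : nset X ->
  X a <-> exists f, [/\ spn u X f, V a f & ~ V (a + 1) f].
Proof.
move=> hX; split=> [Xa|[f [Xf Vf nVf]]].
  by exists (u a); split=> //; apply: sub_closed_span; exists a.
apply: contrapT => nXa; apply: nVf.
have [_ _ [M hM]] := hX.
move: Xf; rewrite spnE// => /(_ (a + 1))[s Xs Vs].
rewrite -[f](subrK s); apply: subD => //.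
have Vas : V a s.
  rewrite -[s](subKr' f); apply: (subB (sV a)) => //.
  by apply: (@Vle a (a + 1) _ _ Vs); lia.
apply: (@fin_tail (X `&` tail a) (a + 1)); last by apply: (@fin_lead X M a s _ Xs Vas) => b /hM.
move=> b [Xb]; rewrite /tail /= => ab.
by have : b != a; [apply: contra_notN nXa => /eqP <-|lia].
Qed.

Lemma spn_sub X Y : nset X -> nset Y -> (spn u X `<=` spn u Y <-> X `<=` Y).
Proof.
move=> hX hY; split=> [h a|h]; last first.
  by apply: closed_span_mono => _ [a Xa <-]; exists a => //; exact: h.
by move=> /(spn_head _ hX)[f [/h Yf Vf nVf]]; apply/(spn_head _ hY); exists f.
Qed.

Lemma spn_inj X Y : nset X -> nset Y -> spn u X = spn u Y -> X = Y.
Proof. by move=> hX hY e; apply/seteqP; split; apply/spn_sub; rewrite // e. Qed.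

Lemma spnU X Y : nset X -> nset Y -> spn u (X `|` Y) = sumset (spn u X) (spn u Y).
Proof.
move=> hX hY; have hXY := nsetU hX hY; have [_ [N hN] _] := hX; apply/seteqP; split.
  rewrite (spnE hXY) => f /(_ N)[s Us Vs]; have /sumsetP[s1 [s2 [Xs Ys sE]]] := finU Us.
  apply/sumsetP; exists (f - s + s1), s2; split.
  - rewrite spnE//; apply: (subD (approx_subspace X)).
      exact: (approx_tail hX hN).
    apply: Xs; first exact: approx_subspace.
    by move=> a Xa; apply: approx_gen; exists a.
  - apply: Ys; first exact: (closed_span_closed _).1.
    by move=> a Ya; apply: sub_closed_span; exists a.
  - by rewrite sE -addrA subrK.
apply: sumset_le; first exact: (closed_span_closed _).1.
  by apply/spn_sub => // a; left.
by apply/spn_sub => // a; right.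
Qed.

Lemma spnI_tail X t : nset X -> spn u X `&` V t = spn u (X `&` tail t).
Proof.
move=> hX; have hXt := nsetI hX (nset_tail t); have [_ [N hN] [M hM]] := hX.
apply/seteqP; split=> [f [Xf Vf]|f Xf]; last first.
  split; first by move: f Xf; apply/spn_sub => // a [].
  by rewrite VE; move: f Xf; apply/(spn_sub hXt (nset_tail t)) => a [].
pose N' := Num.max N t.
move: Xf; rewrite !spnE// => /(_ N')[s Xs Vs].
have Vts : V t s.
  rewrite -[s](subKr' f); apply: (subB (sV t)) => //.
  by apply: (@Vle t N' _ _ Vs); rewrite /N' le_max lexx orbT.
rewrite -[f](subrK s); apply: (subD (approx_subspace _)).
  apply: (@approx_tail _ N' _ _ _ Vs) => // a; rewrite /N' ge_max => /andP[/hN ? ?].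
  by split.
apply: (@fin_lead _ M _ s _ Xs Vts); [by move=> b /hM|exact: approx_subspace|].
by move=> a Xa; apply: approx_gen; exists a.
Qed.

End Basis.
End Bases.

(** * The lattices of an apartment *)

Lemma int_switch (P : int -> Prop) (k l : int) : k <= l -> P k -> ~ P l ->
  exists a, P a /\ ~ P (a + 1).
Proof.
move=> kl Pk; have -> : l = k + (absz (l - k))%:Z by lia.
elim: (absz _) => [|m IH] nP; first by case: nP; rewrite addr0.
have [Pm|nPm] := pselect (P (k + m%:Z)); last exact: IH.
by exists (k + m%:Z); split=> // h; apply: nP; rewrite (_ : k + m.+1%:Z = k + m%:Z + 1)//; lia.
Qed.

Section Bases.
Variables (R : realType) (n : nat).
Hypothesis hn : (2 <= n)%N.
Local Notation H := (L2 R n).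
Variable L0 : set H.
Hypothesis hL0 : forall k, Gr_nplus (zs k L0).
Implicit Types (L : set H) (k l q : int) (X Y : set int) (V : int -> set H).
Implicit Types (u : int -> H) (p : int -> int).
Local Notation lattice := (lattice L0).
Local Notation ty := (ty L0).
Local Notation tchain := (tchain L0).
Local Notation nset := (nset n).
Local Notation latts := (@latts R n).
Local Notation basis := (@basis R n L0).
Local Notation adm := (admissible n).

Lemma periodic_dist p : (forall k, p (k + n%:Z) = p k + n%:Z) ->
  exists D : int, forall k, `|p k - k| <= D.
Proof.
move=> hp; exists (\sum_(i < n) `|p i%:Z - i%:Z|) => k.
have k0 : 0 <= (k %% n%:Z)%Z by rewrite modz_ge0//; lia.
have hk : (absz (k %% n%:Z)%Z < n)%N by rewrite -ltz_nat gez0_abs// ltz_pmod//; lia.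
have -> : p k - k = p (Ordinal hk)%:Z - (Ordinal hk)%:Z.
  have kE : k = (k %% n%:Z)%Z + (k %/ n%:Z)%Z * n%:Z by rewrite addrC -divz_eq.
  by rewrite {1 2}kE (periodic_add hn _ _ hp) /= gez0_abs//; lia.
rewrite (bigD1 (Ordinal hk))//= lerDl; exact: sumr_ge0.
Qed.

Lemma adm_inv p : adm p -> exists g, [/\ cancel p g, cancel g p & adm g].
Proof.
move=> [[g gK Kg] pn]; exists g; split=> //; split=> [|k]; first by exists p.
by apply: (can_inj gK); rewrite pn !Kg.
Qed.

Lemma nset_perm p X : adm p -> nset X -> nset (p @` X).
Proof.
move=> hp [Xn [N hN] [M hM]]; have [D hD] := periodic_dist hp.2.
have [g [gK Kg hg]] := adm_inv hp; split.
- by move=> _ [a Xa <-]; exists (a + n%:Z); [exact: Xn|case: hp].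
- exists (N + D) => a Na; exists (g a); last exact: Kg.
  by apply: hN; have := hD (g a); rewrite Kg; lia.
- by exists (M - D) => _ [a /hM aM <-]; have := hD a; lia.
Qed.

Lemma spn_perm u p X : spn (u \o p) X = spn u (p @` X).
Proof. by rewrite /spn image_comp. Qed.

Lemma latts_perm u p : adm p -> latts (u \o p) = latts u.
Proof.
move=> hp; have [g [gK Kg hg]] := adm_inv hp; apply/seteqP; split=> _ [X hX <-].
  by rewrite spn_perm; exists (p @` X) => //; exact: nset_perm.
exists (g @` X); first exact: nset_perm.
rewrite spn_perm image_comp; congr (spn u _).
by apply/seteqP; split=> [_ [a Xa <-] /=|a Xa]; rewrite ?Kg//; exists a => //=; rewrite Kg.
Qed.

Section Basis.
Variables (V : int -> set H) (u : int -> H).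
Hypothesis hB : basis V u.

Let hV : tchain lattice V. Proof. by case: hB. Qed.
Let Vu k : V k (u k). Proof. by case: hB. Qed.
Let nVu k : ~ V (k + 1) (u k). Proof. by case: hB. Qed.

Lemma latts_lattice : latts u `<=` lattice.
Proof. by move=> _ [X hX <-]; exact: (spn_lattice hn hL0 hB). Qed.

Lemma latts_zs k L : latts u L -> latts u (zs k L).
Proof.
move=> [X hX <-]; rewrite (spn_zs hn hL0 hB)//; exists (shift n k X) => //.
exact: (nset_shift hn).
Qed.

Lemma basis_tchain : tchain (latts u) V.
Proof.
have [[_ tV Vle Vz] _ _ _ VE] := hB; split=> // k; rewrite VE.
by exists (tail k) => //; exact: (nset_tail hn).
Qed.

Lemma spn_mem X a : nset X -> (spn u X (u a) <-> X a).
Proof.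
move=> hX; split=> [Xa|Xa]; last by apply: sub_closed_span; exists a.
by apply/(spn_head hn hL0 hB _ hX); exists (u a).
Qed.

Lemma spn_D1 X a : nset X -> X a -> nset (X `\ a) ->
  quotient_dim (spn u X) (spn u (X `\ a)) 1.
Proof.
move=> hX Xa hZ; have sZ : subspace (spn u (X `\ a)) := (closed_span_closed _).1.
apply/(qd1P _ sZ); exists (u a); first exact/spn_mem.
split=> [/(spn_mem _ hZ)[_ na]|f Xf]; first exact: na.
have [_ [N hN] _] := hZ; move: Xf; rewrite (spnE hn hL0 hB hX) => /(_ N)[s Xs Vs].
have Us : fin u ([set a] `|` (X `\ a)) s.
  by apply: fin_mono Xs => b Xb; have [->|/eqP ba] := eqVneq b a; [left|right].
have /sumsetP[l [t [Xl Xt sE]]] := finU Us; have [c lE] := fin1 Xl; subst l.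
exists c; have -> : f - c *: u a = f - s + t by rewrite sE opprD addrA subrK.
rewrite (spnE hn hL0 hB hZ); apply: (subD (approx_subspace hB (X `\ a))).
  exact: (approx_tail hn hL0 hB hZ hN).
apply: Xt; first exact: approx_subspace hB _.
by move=> b Xb; apply: (approx_gen hB); exists b.
Qed.

(** Remove from [X] its smallest index [a] outside [Y]. The rest is stable:
    an index [a - n] of [X] would belong to [Y], and so would [a]. *)
Lemma latts_interpolating : interpolating L0 (latts u).
Proof.
move=> _ _ [X hX <-] [Y hY <-] /(spn_sub hn hL0 hB hY hX) YX tXY.
have [_ _ [M hM]] := hX; have [Yn [N hN] _] := hY.
pose P (m : nat) := `[< X (M + m%:Z) /\ ~ Y (M + m%:Z) >].
have exP : exists m, P m.
  apply: contrapT => nex; have XY : X `<=` Y.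
    move=> a Xa; apply: contrapT => nYa; apply: nex; exists (absz (a - M)).
    rewrite /P (_ : M + (absz (a - M))%:Z = a); last by have := hM _ Xa; lia.
    exact: asboolT.
  by move: tXY; rewrite (_ : X = Y) ?ltxx//; apply/seteqP.
case: (ex_minnP exP) => m /asboolP[]; move ea : (M + m%:Z) => a Xa nYa min.
have {}min b : X b -> b < a -> Y b.
  move=> Xb ba; apply: contrapT => nYb; have := min (absz (b - M)).
  rewrite /P (_ : M + (absz (b - M))%:Z = b); last by have := hM _ Xb; lia.
  by move=> /(_ (asboolT (conj Xb nYb))); have := hM _ Xb; lia.
have [Xn _ _] := hX.
have hZ : nset (X `\ a).
  split.
  - move=> b [Xb /= ba]; split; first exact: Xn.
    move=> /= bna; apply: nYa; rewrite -bna; apply: Yn; apply: min => //; lia.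
  - exists N => b /hN Yb; split; first exact: YX.
    by move=> /= ba; apply: nYa; rewrite -ba.
  - by exists M => b [/hM].
have YZ : Y `<=` X `\ a by move=> b Yb; split; [exact: YX|move=> /= ba; apply: nYa; rewrite -ba].
have ZX : spn u (X `\ a) `<=` spn u X by apply/(spn_sub hn hL0 hB hZ hX) => b [].
exists (spn u (X `\ a)); split=> //.
- by exists (X `\ a).
- exact/(spn_sub hn hL0 hB hY hZ).
- apply: (ty_qd hL0) => //; try exact: (spn_lattice hn hL0 hB).
  exact: spn_D1.
Qed.

(** Each step of the chain drops a single index [p k], and each index is present
    at the beginning of the chain and absent at the end. *)
Lemma tchain_perm V' : tchain (latts u) V' -> exists p,
  adm p /\ basis V' (u \o p).
Proof.
move=> hV'; have [Vl' tV' Vle' Vz'] := hV'.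
have hV'l : tchain lattice V' by split=> // k; exact/latts_lattice.
have /choice[X hX] : forall k, exists X, nset X /\ spn u X = V' k.
  by move=> k; have [X ? ?] := Vl' k; exists X.
have nX k : nset (X k) by case: (hX k).
have XE k : spn u (X k) = V' k by case: (hX k).
have sub k l : V' l `<=` V' k -> X l `<=` X k.
  by rewrite -!XE => /(spn_sub hn hL0 hB (nX l) (nX k)).
have Xle k l : k <= l -> X l `<=` X k by move=> kl; apply: sub; exact: (tchain_le hV').
have mem k a : V' k (u a) <-> X k a by rewrite -XE; exact: spn_mem.
have ex k : exists a, X k a /\ ~ X (k + 1) a.
  apply: contrapT => nex; have : V' k = V' (k + 1).
    rewrite -!XE; congr spn; apply/seteqP; split; last by apply: Xle; lia.
    by move=> a Xa; apply: contrapT => nXa; apply: nex; exists a.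
  by move=> /(congr1 ty); rewrite !tV'; lia.
have uniq0 k a b : X k a -> ~ X (k + 1) a -> X k b -> ~ X (k + 1) b -> ~ a < b.
  move=> Xa nXa Xb nXb ab; apply: nXa.
  have [|||c Vc] := @tchain_step _ _ _ hL0 _ k (u b) (u a) hV'l.
  - exact/mem.
  - by move=> /mem.
  - exact/mem.
  have sV l : subspace (V l) by apply: lattice_sub; case: hV => h _ _ _; exact: h.
  have Vab : V (a + 1) (u b) by apply: (tchain_le hV _ (Vu b)); lia.
  apply/(spn_head hn hL0 hB _ (nX _)); exists (u a - c *: u b); rewrite XE; split=> //.
    apply: (subB (sV a)) => //; apply: (subZ _ (sV a)).
    by apply: (tchain_le hV _ Vab); lia.
  move=> h; apply: (@nVu a); apply: (subDl (sV _) _ h).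
  exact/(subN (sV _))/(subZ _ (sV _)).
have uniq k a b : X k a -> ~ X (k + 1) a -> X k b -> ~ X (k + 1) b -> a = b.
  move=> Xa nXa Xb nXb; apply/eqP; rewrite eq_le !leNgt; apply/andP.
  by split; apply/negP; exact: (uniq0 k).
have [p hp] := choice ex.
have Xn k : X (k + n%:Z) = shift n 1 (X k).
  apply: (spn_inj hn hL0 hB) => //; first exact: (nset_shift hn).
  by rewrite -(spn_zs hn hL0 hB)// !XE Vz'.
have pn k : p (k + n%:Z) = p k + n%:Z.
  have [Xp nXp] := hp k; have [Xp' nXp'] := hp (k + n%:Z).
  apply: (uniq (k + n%:Z)) => //; rewrite 1?(addrAC k) Xn /shift /= mul1r addrK//.
have pinj : injective p.
  have h k l : k < l -> p k <> p l.
    move=> kl e; have [_ nX1] := hp k; apply: nX1; rewrite e.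
    by apply: (@Xle (k + 1) l); [lia|case: (hp l)].
  move=> k l e; apply/eqP; rewrite eq_le !leNgt; apply/andP.
  by split; apply/negP => /h; rewrite e.
have psurj a : exists k, p k = a.
  have [Vl _ _ _] := hV; have Vl0 := latts_lattice (Vl' 0).
  have [N] := lattice_dirV hL0 Vl0 (Vl a).
  have [M] := lattice_dir hL0 Vl0 (Vl (a + 1)).
  rewrite !(tchain_zs _ _ hV') !add0r => hM hN.
  have [|||k [Xk nXk]] := @int_switch (X^~ a) (- N%:Z * n%:Z) (M%:Z * n%:Z).
  - by nia.
  - by apply/mem; exact: hN.
  - by move=> /mem/hM; exact: nVu.
  - by exists k; have [? ?] := hp k; exact: (uniq k).
have [g gK] := choice psurj; exists p; split.
  by split=> //; exists g => // k; apply: pinj; rewrite gK.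
have XE' k : X k = p @` tail k.
  apply/seteqP; split=> [a Xa|_ [l kl <-]]; last first.
    by apply: (@Xle k l) => //; case: (hp l).
  exists (g a); last exact: gK.
  rewrite /tail /= leNgt; apply/negP => h; have [_ nX1] := hp (g a).
  by apply: nX1; rewrite gK; apply: (@Xle _ k) => //; lia.
split=> //.
- by move=> k /=; rewrite pn; case: hB.
- by move=> k; apply/mem; case: (hp k).
- by move=> k /mem; case: (hp k).
- by move=> k; rewrite -XE XE' spn_perm.
Qed.

End Basis.
End Bases.

(** * Existence of bases and common apartments *)

Section Existence.
Variables (R : realType) (n : nat).
Hypothesis hn : (2 <= n)%N.
Local Notation H := (L2 R n).
Variable L0 : set H.
Hypothesis hL0 : forall k, Gr_nplus (zs k L0).
Implicit Types (L : set H) (k l q r : int) (X Y : set int) (V : int -> set H).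
Implicit Types (u v : int -> H) (p : int -> int).
Local Notation lattice := (lattice L0).
Local Notation ty := (ty L0).
Local Notation tchain := (tchain L0).
Local Notation basis := (@basis R n L0).
Local Notation dv x := ((n%:Z %| x)%Z).

Lemma periodic_choice (P : int -> H -> Prop) : (forall k, exists x, P k x) ->
  (forall q k x, P k x -> P (k + q * n%:Z) (zpow q x)) ->
  exists u, (forall k, zpow 1 (u k) = u (k + n%:Z)) /\ forall k, P k (u k).
Proof.
move=> /choice[e he] Pz; have n0 : n%:Z != 0 by lia.
exists (fun k => zpow (k %/ n%:Z)%Z (e (k %% n%:Z)%Z)); split=> k.
  rewrite -zpowD modzDr; congr (zpow _ _).
  by rewrite addrC divzDr ?dvdzz// divzz n0.
by have := Pz (k %/ n%:Z)%Z _ _ (he (k %% n%:Z)%Z); rewrite addrC -divz_eq.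
Qed.

Lemma tchain_ex V k : tchain lattice V -> exists x, V k x /\ ~ V (k + 1) x.
Proof.
move=> hV; apply: contrapT => nex; have : V k = V (k + 1).
  apply/seteqP; split; last by apply: (tchain_le hV); lia.
  by move=> x Vx; apply: contrapT => nVx; apply: nex; exists x.
by have [_ tV _ _] := hV; move=> /(congr1 ty); rewrite !tV; lia.
Qed.

Lemma tchain_zpow V k q x : tchain lattice V -> V k x <-> V (k + q * n%:Z) (zpow q x).
Proof.
move=> hV; rewrite -(tchain_zs _ q hV); split=> [Vx|/zsP]; first by exists x.
by rewrite zpowK.
Qed.

(** Choose [u k] in [V k] orthogonal to [V (k + 1)]: this gives an orthogonal
    family to which [shift_total] applies. An element of [V k] orthogonal to the
    [u l], [l >= k], belongs to all the [V l], so it is orthogonal to the whole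
    family. *)
Lemma basis_exists V : tchain lattice V ->
  exists u, basis V u /\ closed_span (range u) = setT.
Proof.
move=> hV; have [Vl tV _ _] := hV; have sV k := lattice_sub (Vl k).
have cV k : closed_subspace (V k) by have [[]] := lattice_Gr hL0 (Vl k).
have [|q k x [Vx nVx ox]|u [uz hu]] := @periodic_choice (fun k x =>
    [/\ V k x, ~ V (k + 1) x & orthocomplement (V (k + 1)) x]).
- move=> k; have [x [Vx nVx]] := tchain_ex k hV.
  have [g Vg og] := projection x (cV (k + 1)); exists (x - g); split=> //.
    by apply: (subB (sV k)) => //; apply: (tchain_le hV _ Vg); lia.
  by move=> h; apply: nVx; rewrite -[x](subrK g); exact: (subD (sV _)).
- rewrite (addrAC k); split.
  + by have := (tchain_zpow k q x hV).1 Vx.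
  + by move=> h; apply: nVx; exact: (tchain_zpow _ q _ hV).2 h.
  + rewrite -(tchain_zs _ q hV) => _ [f Vf <-]; rewrite inner_zpow; exact: ox.
have Vu k : V k (u k) by case: (hu k).
have nVu k : ~ V (k + 1) (u k) by case: (hu k).
have ou k : orthocomplement (V (k + 1)) (u k) by case: (hu k).
have uq q k : zpow q (u k) = u (k + q * n%:Z) by exact: (basis_zpow hn).
have oul k l : k < l -> inner (u k) (u l) = 0.
  by move=> kl; apply: ou; apply: (tchain_le hV _ (Vu l)); lia.
have oukl k l : k != l -> inner (u k) (u l) = 0.
  move=> kl; have [h|h] := ltP k l; first exact: oul.
  by apply: inner_eq0C; apply: oul; lia.
have u0 k : u k <> 0 by move=> e; apply: (@nVu k); rewrite e; exact: sub0.
have tot f : (forall l, inner f (u l) = 0) -> f = 0.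
  move=> of_; apply: (@shift_total _ _ (fun i : 'I_n => u i%:Z)) => [i|k i j kij|k i].
  - exact: u0.
  - rewrite uq; apply: oukl; apply/eqP => e.
    have ij : i = j.
      apply/eqP; rewrite -(dv_ord hn); apply/dvdzP; exists (- k); lia.
    by subst j; move: kij; rewrite eqxx orbF => /eqP; nia.
  - rewrite -(inner_zpow (- k)) zpowK uq; exact: of_.
exists u; split; last first.
  apply: closed_span_total => [|//|f _ of_].
    by split; [apply/subspaceP|exact: closedT].
  by apply: tot => l; apply: of_; exists l.
split=> // k; apply/esym/closed_span_total => //.
  by move=> _ [l kl <-]; exact: (tchain_le hV kl).
move=> f Vf of_.
have Vfl (m : nat) : V (k + m%:Z) f.
  elim: m => [|m IH]; first by rewrite addr0.
  have [c Vc] := tchain_step hL0 hV (Vu _) (@nVu _) IH.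
  have := ou _ _ Vc; rewrite (_ : k + m.+1%:Z = k + m%:Z + 1); last by lia.
  move=> /inner_eq0C; rewrite innerBl innerZl of_ ?sub0r; last first.
    by exists (k + m%:Z) => //; rewrite /tail /=; lia.
  move=> /eqP; rewrite oppr_eq0 mulf_eq0 => /orP[/eqP c0|/eqP/inner_eq0/u0//].
  by rewrite c0 scale0r subr0 in Vc.
apply: tot => l; apply: inner_eq0C; apply: ou.
by apply: (tchain_le hV _ (Vfl (absz (l + 1 - k)%R))); lia.
Qed.

Lemma basis_total V u : basis V u -> closed_span (range u) = setT.
Proof.
move=> [hV _ _ _ VE]; have [u' [[_ _ Vu' _ _] tot]] := basis_exists hV.
apply/seteqP; split=> // f; rewrite -tot; apply: closed_span_min.
  exact: closed_span_closed.
move=> _ [k _ <-]; have := Vu' k; rewrite VE; apply: closed_span_mono.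
by move=> _ [l _ <-]; exists l.
Qed.

(** The indices of the vectors whose addition to [v r] changes neither its order
    nor its translates. *)
Definition off r : set int := [set j | r < j /\ ~~ dv (j - r)].

Lemma fin_zpow u X q f : (forall k, zpow 1 (u k) = u (k + n%:Z)) ->
  fin u X f -> fin u (shift n q X) (zpow q f).
Proof.
move=> uz Xf; apply: (Xf (zpow q @^-1` fin u (shift n q X))).
  by apply: subspace_preimg (zpow_linear q) _ _; exact: fin_subspace.
move=> a Xa /=; rewrite (basis_zpow hn)//; apply: fin_gen.
by rewrite /shift /= addrK.
Qed.

(** The combination added to [v r] only involves vectors which are kept, so that
    [v r] and its translates remain in the spans. *)
Lemma basis_replace V v r w : basis V v -> fin v (off r) (w - v r) ->
  exists v', [/\ basis V v', v' r = w & forall j, ~~ dv (j - r) -> v' j = v j].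
Proof.
move=> hB wr; have [hV vz Vv nVv VE] := hB; have n0 : n%:Z != 0 by lia.
have [Vl _ _ _] := hV; have sV k := lattice_sub (Vl k).
have vq q k := basis_zpow hn q k vz.
have Vw : V (r + 1) (w - v r).
  by apply: (fin_tail hB _ wr) => j [rj _]; rewrite /tail /=; lia.
pose v' j := if dv (j - r) then zpow ((j - r) %/ n%:Z)%Z w else v j.
have E q : v' (r + q * n%:Z) = zpow q w.
  by rewrite /v' addrC addKr dvdz_mull ?dvdzz// mulzK.
have v'j j : ~~ dv (j - r) -> v' j = v j by rewrite /v' => /negbTE ->.
exists v'; split=> //; last by have := E 0; rewrite mul0r addr0 zpow0.
have V'v k : V (k + 1) (v' k - v k).
  have [/dvdzP[q kr]|h] := boolP (dv (k - r)); last first.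
    by rewrite v'j// subrr; exact: sub0.
  have -> : k = r + q * n%:Z by lia.
  rewrite E -vq -(linB (zpow_linear q)) addrAC.
  exact: (tchain_zpow _ q _ hV).1.
have Vv' k : V k (v' k).
  rewrite -[v' k](subrK (v k)); apply: (subD (sV k)) => //.
  by apply: (tchain_le hV _ (V'v k)); lia.
split=> // [k|k|k].
- have [/dvdzP[q kr]|h] := boolP (dv (k - r)).
    have -> : k = r + q * n%:Z by lia.
    rewrite E -zpowD (_ : r + q * n%:Z + n%:Z = r + (1 + q) * n%:Z) ?E; [by []|lia].
  rewrite !v'j ?vz// (_ : k + n%:Z - r = (k - r) + n%:Z); last by lia.
  by rewrite rpredDr ?dvdzz.
- move=> h; apply: (nVv k); rewrite -[v k](subrK (v' k)).
  by apply: (subD (sV _)) => //; rewrite -opprB; apply: (subN (sV _)).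
apply/seteqP; split; last first.
  apply: closed_span_min.
    by have [[]] := lattice_Gr hL0 (Vl k).
  by move=> _ [l kl <-]; exact: (tchain_le hV kl).
have [sS _] := closed_span_closed (v' @` tail k).
have in' l : k <= l -> spn v' (tail k) (v' l).
  by move=> kl; apply: sub_closed_span; exists l.
rewrite VE; apply: closed_span_min; first exact: closed_span_closed.
move=> _ [l kl <-]; rewrite /tail /= in kl.
have [/dvdzP[q lr]|h] := boolP (dv (l - r)); last by rewrite -v'j//; exact: in'.
have lE : l = r + q * n%:Z by lia.
have := @fin_zpow v (off r) q _ vz wr; rewrite (linB (zpow_linear q)) vq -lE.
move=> /(_ _ sS) h; apply: (subDl sS _ (_ : spn v' (tail k) (v l + (zpow q w - v l)))).
  apply: h => a []; rewrite /= => ra ar.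
  have ar' : ~~ dv (a - r).
    rewrite (_ : a - r = (a - q * n%:Z - r) + q * n%:Z); last by lia.
    by rewrite rpredDr ?dvdz_mull ?dvdzz.
  by rewrite -v'j//; apply: in'; lia.
by rewrite addrC subrK -E -lE; exact: in'.
Qed.

(** Expand a multiple of [x] along the basis, starting from [v r]; finitely many
    terms suffice because [A] contains [V N0]. A multiple of a translate
    [z^q v r] may not be added to [w]: add the same multiple of [z^q w] to both
    sides. On the side of [w] this leaves a combination of the other vectors,
    on the side of [x] it changes nothing modulo [A], which contains [z x]. *)
Lemma basis_approach V v r (A : set H) N0 x : basis V v -> subspace A ->
  (forall f, A f -> A (zpow 1 f)) -> V N0 `<=` A ->
  V r x -> ~ V (r + 1) x -> A (zpow 1 x) ->
  exists w c, fin v (off r) (w - v r) /\ A (w - c *: x).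
Proof.
move=> hB sA Az VA Vx nVx Axz; have [hV vz Vv nVv VE] := hB.
have [Vl _ _ _] := hV; have sV k := lattice_sub (Vl k).
have sF := fin_subspace v (off r).
have vq q k := basis_zpow hn q k vz.
have AzN (m : nat) f : A f -> A (zpow m%:Z f).
  by elim: m => [|m IH] Af; rewrite ?zpow0// intS zpowD; exact/Az/IH.
suff h (m : nat) : exists w s c, [/\ fin v (off r) (w - v r),
    A (s - c *: x) & V (r + 1 + m%:Z) (w - s)].
  have [w [s [c [wr As Vs]]]] := h (absz (N0 - (r + 1))%R).
  exists w, c; split=> //; rewrite -[w](subrK s) -addrA; apply: (subD sA) => //.
  by apply: VA; apply: (tchain_le hV _ Vs); lia.
elim: m => [|m [w [s [c [wr As Vs]]]]].
  have [d Vd] := tchain_step hL0 hV Vx nVx (Vv r).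
  exists (v r), (d *: x), d; rewrite !subrr addr0; split=> //; exact: sub0.
have [b Vb] := basis_step hL0 hB Vs.
move eN : (r + 1 + m%:Z) Vs Vb => N Vs Vb.
have -> : r + 1 + m.+1%:Z = N + 1 by lia.
have [/dvdzP[q Nr]|Nr] := boolP (dv (N - r)); last first.
  exists (w - b *: v N), s, c; split=> //.
    rewrite addrAC; apply: (subB sF) => //; apply: (subZ _ sF).
    by apply: fin_gen; split=> //; lia.
  by rewrite addrAC.
have q0 : 0 < q by nia.
have NE : N = r + q * n%:Z by lia.
exists (w + b *: zpow q (w - v r)), (s + b *: zpow q s), c; split.
- rewrite addrAC; apply: (subD sF) => //; apply: (subZ _ sF).
  apply: (fin_mono _ (@fin_zpow v (off r) q _ vz wr)) => j [/= rj jr]; split; first by nia.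
  rewrite (_ : j - r = (j - q * n%:Z - r) + q * n%:Z); last by lia.
  by rewrite rpredDr ?dvdz_mull ?dvdzz.
- rewrite addrAC; apply: (subD sA) => //; apply: (subZ _ sA).
  rewrite -[s](subrK (c *: x)) (linD (zpow_linear q)) (linZ (zpow_linear q)).
  have -> : q = (absz (q - 1)%R)%:Z + 1 by lia.
  apply: (subD sA); last first.
    by apply: (subZ _ sA); rewrite zpowD; exact: AzN.
  by rewrite zpowD; exact/AzN/Az.
- have -> : w + b *: zpow q (w - v r) - (s + b *: zpow q s) =
      (w - s - b *: v N) + b *: zpow q (w - s).
    rewrite NE -vq !(linB (zpow_linear q)) !scalerBr opprD addrACA.
    by rewrite [_ - _ - b *: zpow q s]addrAC -[RHS]addrA [- _ + _]addrC.
  apply: (subD (sV _)) => //; apply: (subZ _ (sV _)).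
  have := (tchain_zpow _ q _ hV).1 Vs; apply: (tchain_le hV).
  by rewrite -eN; nia.
Qed.

(** The relative position of two chains: [l] is the largest index such that
    [V' l] contains an element of order exactly [k] for [V]. *)
Definition position V V' k l :=
  (exists x, [/\ V k x, ~ V (k + 1) x & V' l x]) /\
  forall l' x, V k x -> ~ V (k + 1) x -> V' l' x -> l' <= l.

Lemma position_ex V V' k : tchain lattice V -> tchain lattice V' ->
  exists l, position V V' k l.
Proof.
move=> hV hV'; have [Vl _ _ _] := hV; have [Vl' _ _ _] := hV'.
pose P l := exists x, [/\ V k x, ~ V (k + 1) x & V' l x].
have [N] := lattice_dirV hL0 (Vl' 0) (Vl k).
have [M] := lattice_dir hL0 (Vl' 0) (Vl (k + 1)).
rewrite !(tchain_zs _ _ hV') !add0r => hM hN.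
have [x [Vx nVx]] := tchain_ex k hV.
have [|||l [Pl nPl]] := @int_switch P (- N%:Z * n%:Z) (M%:Z * n%:Z).
- by nia.
- by exists x; split=> //; exact: hN.
- by move=> [y [_ nVy /hM]].
exists l; split=> // l' y Vy nVy V'y; rewrite leNgt; apply/negP => ll'.
by apply: nPl; exists y; split=> //; apply: (tchain_le hV' _ V'y); lia.
Qed.

Lemma position_add V V' k l : tchain lattice V -> tchain lattice V' ->
  position V V' k l -> position V V' (k + n%:Z) (l + n%:Z).
Proof.
move=> hV hV' [[x [Vx nVx V'x]] max].
have z1 W j y : tchain lattice W -> W j y <-> W (j + n%:Z) (zpow 1 y).
  by move=> hW; have := tchain_zpow j 1 y hW; rewrite mul1r.
split.
  exists (zpow 1 x); split; [exact: (z1 _ _ _ hV).1| |exact: (z1 _ _ _ hV').1].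
  by rewrite addrAC => h; apply: nVx; exact: (z1 _ _ _ hV).2 h.
move=> l' y; rewrite -[y](zpowVK 1) addrAC -[l'](subrK n%:Z) => Vy nVy V'y.
rewrite lerD2r; apply: (max _ (zpow (- 1) y)).
- exact: (z1 _ _ _ hV).2 Vy.
- by move=> h; apply: nVy; exact: (z1 _ _ _ hV).1 h.
- exact: (z1 _ _ _ hV').2 V'y.
Qed.

(** One replacement for each residue modulo [n] brings [v k] into [V' (p k)], where
    [p] is the relative position. An element of order [a] of [V' l] has
    [l <= p a], so that subtracting a multiple of [v a] keeps it in [V' l]: the
    elements of [V' l] only involve the [v a] with [l <= p a]. *)
Lemma common_apartment V V' : tchain lattice V -> tchain lattice V' ->
  exists u, basis V u /\ tchain (latts u) V'.
Proof.
move=> hV hV'.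
have [Vl _ _ _] := hV; have [Vl' tV' Vle' Vz'] := hV'.
have /choice[p hp] : forall k, exists l, position V V' k l.
  by move=> k; exact: position_ex.
have pn k : p (k + n%:Z) = p k + n%:Z.
  have [[x [Vx nVx V'x]] max] := hp (k + n%:Z).
  have [[y [Vy nVy V'y]] max'] := position_add hV hV' (hp k).
  apply/eqP; rewrite eq_le; apply/andP; split; [exact: max' V'x|exact: max V'y].
have good (m : nat) : (m <= n)%N ->
    exists v, basis V v /\ forall j : nat, (j < m)%N -> V' (p j%:Z) (v j%:Z).
  elim: m => [_|m IH mn]; first by have [v [hv _]] := basis_exists hV; exists v.
  have [|v [hB hv]] := IH; first by lia.
  have [_ vz _ _ _] := hB.
  pose r := m%:Z; have [[x [Vx nVx V'x]] _] := hp r.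
  pose A := V (r + 1) `&` V' (p r + 1).
  have lA : lattice A by exact: latticeI.
  have sA := lattice_sub lA.
  have Az f : A f -> A (zpow 1 f) by move=> Af; apply: (lattice_z lA); exists f.
  have [N] := lattice_dir hL0 (Vl 0) lA; rewrite (tchain_zs _ _ hV) => VA.
  have Ax : A (zpow 1 x).
    split.
      have := (tchain_zpow _ 1 _ hV).1 Vx; apply: (tchain_le hV); lia.
    have := (tchain_zpow _ 1 _ hV').1 V'x; apply: (tchain_le hV'); lia.
  have [w [c [wr Aw]]] := basis_approach hB sA Az VA Vx nVx Ax.
  have [v' [hB' v'r v'j]] := basis_replace hB wr.
  exists v'; split=> // j; rewrite ltnS leq_eqVlt => /predU1P[->|jm].
    rewrite -/r v'r -[w](subrK (c *: x)).
    apply: (subD (lattice_sub (Vl' _))); last exact: (subZ _ (lattice_sub (Vl' _))).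
    by apply: (tchain_le hV' _ Aw.2); lia.
  rewrite v'j; first exact: hv.
  apply: (dv_neq hn (dvdz0 _)); rewrite /r; lia.
have [v [hB hv]] := good n (leqnn n).
have [_ vz Vv nVv VE] := hB.
have pq k q := periodic_add hn k q pn.
have V'v k : V' (p k) (v k).
  have k0 : 0 <= (k %% n%:Z)%Z by rewrite modz_ge0//; lia.
  have hk : (absz (k %% n%:Z)%Z < n)%N by rewrite -ltz_nat gez0_abs// ltz_pmod//; lia.
  rewrite (divz_eq k n%:Z) addrC pq -(basis_zpow hn)// -(gez0_abs k0).
  by apply: (tchain_zpow _ _ _ hV').1; exact: hv.
exists v; split=> //; split=> // l.
pose X : set int := [set a | l <= p a].
have [D hD] := periodic_dist hn pn.
have hX : nset n X.
  split.
  - by move=> a; rewrite /X /= pn; lia.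
  - by exists (l + D) => a; rewrite /X /=; have := hD a; lia.
  - by exists (l - D) => a; rewrite /X /=; have := hD a; lia.
exists X => //; apply/seteqP; split.
  apply: closed_span_min; first by have [[]] := lattice_Gr hL0 (Vl' l).
  by move=> _ [a la <-]; apply: (tchain_le hV' la).
rewrite (spnE hn hL0 hB hX) => f V'f.
have sV' := lattice_sub (Vl' l).
have [N hN] := lattice_dirV hL0 (Vl 0) (Vl' l).
move: hN; rewrite (tchain_zs _ _ hV) => /(_ _ V'f); set M := (X in V X f) => VMf.
have step (m : nat) : exists2 s, fin v X s & (V (M + m%:Z) `&` V' l) (f - s).
  elim: m => [|m [s Xs [Vs V's]]].
    exists 0; first exact: (sub0 (fin_subspace _ _)).
    by rewrite addr0 subr0.
  have eM : M + m.+1%:Z = M + m%:Z + 1 by lia.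
  have [Vs1|nVs1] := pselect (V (M + m%:Z + 1) (f - s)).
    by exists s; rewrite ?eM.
  have [c Vc] := basis_step hL0 hB Vs.
  have Xm : X (M + m%:Z) by have [_ max] := hp (M + m%:Z); exact: max Vs nVs1 V's.
  exists (s + c *: v (M + m%:Z)).
    apply: (subD (fin_subspace v X) Xs); apply: (subZ c (fin_subspace v X)).
    exact: (@fin_gen _ _ _ v X).
  rewrite opprD addrA eM; split=> //; apply: (subB sV') => //.
  by apply: (subZ _ sV'); exact: (tchain_le hV' Xm).
move=> N'; have [s Xs [Vs _]] := step (absz (N' - M)); exists s => //.
by apply: (tchain_le hV _ Vs); lia.
Qed.

End Existence.

(** * Apartments and bases *)

Section Apartments.
Variables (R : realType) (n : nat).
Hypothesis hn : (2 <= n)%N.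
Local Notation H := (L2 R n).
Variable L0 : set H.
Hypothesis hL0 : forall k, Gr_nplus (zs k L0).
Implicit Types (L : set H) (k l q r : int) (X Y : set int) (V W U : int -> set H).
Implicit Types (u v w : int -> H) (p : int -> int) (S : set (set H)).
Local Notation lattice := (lattice L0).
Local Notation ty := (ty L0).
Local Notation tchain := (tchain L0).
Local Notation basis := (@basis R n L0).

Definition line (x : H) : set H := [set c *: x | c in [set: R[i]]].

Lemma line_subspace x : subspace (line x).
Proof.
apply/subspaceP; split=> [|c _ _ [d _ <-] [e _ <-]]; first by exists 0; rewrite ?scale0r.
by exists (c * d + e); rewrite // scalerDl scalerA.
Qed.

Lemma line_gen x : line x x. Proof. by exists 1; rewrite ?scale1r. Qed.

Lemma line_min x (A : set H) : subspace A -> A x -> line x `<=` A.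
Proof. by move=> sA Ax _ [c _ <-]; exact: subZ. Qed.

Lemma zs_line q x : zs q (line x) = line (zpow q x).
Proof.
apply/seteqP; split=> [_ [_ [c _ <-] <-]|_ [c _ <-]].
  by exists c; rewrite ?(linZ (zpow_linear q)).
by exists (c *: x); [exists c|rewrite (linZ (zpow_linear q))].
Qed.

Lemma lineP (A : set H) : subspace A ->
  quotient_dim A [set 0] 1 <-> exists2 x, x <> 0 & A = line x.
Proof.
move=> sA; have s0 := @subspace0 _ H; split=> [/(qd1P _ s0)[x Ax [x0 gen]]|[x x0 ->]].
  exists x => //; apply/seteqP; split; last exact: line_min.
  by move=> f /gen[c /eqP]; rewrite subr_eq0 => /eqP ->; exists c.
apply/(qd1P _ s0); exists x; first exact: line_gen.
by split=> // _ [c _ <-]; exists c; rewrite /= subrr.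
Qed.

Lemma span_lines w X : closed_span (\bigcup_(l in X) line (w l)) = spn w X.
Proof.
have c A := @closed_span_closed R n A.
apply/seteqP; split; apply: closed_span_min; try exact: c.
  move=> f [l Xl]; apply: line_min; first exact: (c _).1.
  by apply: sub_closed_span; exists l.
by move=> _ [l Xl <-]; apply: sub_closed_span; exists l => //; exact: line_gen.
Qed.

Lemma shift_tail p k q : admissible n p ->
  shift n q (p @` tail k) = p @` tail (k + q * n%:Z).
Proof.
move=> hp; apply/seteqP; split=> [a [l kl pl]|_ [l kl <-]]; rewrite /tail /= in kl.
  exists (l + q * n%:Z); first by rewrite /tail /=; lia.
  by rewrite (adm_add hn)// pl subrK.
exists (l - q * n%:Z); first by rewrite /tail /=; lia.
by have := adm_add hn (l - q * n%:Z) q hp; rewrite subrK => ->; rewrite addrK.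
Qed.

Lemma adm_conj p c : admissible n p -> admissible n (fun l => p (l + c) - c).
Proof.
move=> [[g gK Kg] pn]; split.
  exists (fun l => g (l + c) - c) => l; first by rewrite subrK gK addrK.
  by rewrite subrK Kg addrK.
by move=> l; rewrite addrAC pn addrAC.
Qed.

Lemma adm_addr p c : admissible n p -> admissible n (fun l => p l + c).
Proof.
move=> [[g gK Kg] pn]; split.
  exists (fun l => g (l - c)) => l; first by rewrite addrK gK.
  by rewrite Kg subrK.
by move=> l; rewrite pn addrAC.
Qed.

(** Every chain of lattices of [latts u] refines to a full one, which is the image
    of [V] under a permutation. *)
Lemma apartment_basis V u c W U : basis V u -> (forall k, W k = V (k + c)) ->
  (forall k, U k = line (u (k + c))) -> apartment W U = mflag (latts u).
Proof.
move=> hB WE UE; have [hV _ _ _ VE] := hB; have [Vl tV Vle Vz] := hV.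
have pmE p k : permuted_member U p k = spn u ((fun l => p l + c) @` tail k).
  rewrite -spn_perm -span_lines /permuted_member; congr closed_span.
  by apply: eq_bigcupr => l _; rewrite UE.
have WV : range W = range V.
  apply/seteqP; split=> _ [k _ <-]; first by exists (k + c) => //; rewrite WE.
  by exists (k - c) => //; rewrite WE subrK.
apply/seteqP; split=> [_ [p [S [hp fS SW ->]]]|S' hS'].
  have hpc := adm_addr c hp.
  have hS : mflag lattice S.
    apply: flag_mflag => // A /SW; rewrite WV => -[k _ <-]; exact: Vl.
  have [[A SA] SM _ Szs] := hS; split.
  - have [k _ kA] := SW _ SA.
    by exists (permuted_member U p k); exists k => //=; rewrite kA.
  - move=> _ [k _ <-]; rewrite pmE; exists ((fun l => p l + c) @` tail k) => //.
    exact/(nset_perm hn hpc)/(nset_tail hn).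
  - move=> _ _ [k _ <-] [l _ <-]; rewrite !pmE /spn; have [kl|lk] := leP k l.
      right; apply: closed_span_mono; do 2 apply: image_subset.
      by move=> a; exact: le_trans.
    left; apply: closed_span_mono; do 2 apply: image_subset.
    by move=> a; apply: le_trans; exact: ltW.
  - move=> q _ [k /= Sk <-]; exists (k + q * n%:Z) => /=.
      rewrite WE addrAC -(tchain_zs _ _ hV) -WE; exact: Szs.
    rewrite !pmE (spn_zs hn hL0 hB) ?shift_tail//.
    exact/(nset_perm hn hpc)/(nset_tail hn).
have lz := fun k L => @latts_zs _ _ hn _ hL0 _ _ hB k L.
have [V' hV' S'V'] := mflag_ext hL0 (latts_lattice hn hL0 hB) lz hn
  (latts_interpolating hn hL0 hB) hS'.
have [p [hp [_ _ _ _ V'E]]] := tchain_perm hn hL0 hB hV'.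
have [S'0 S'M S'tot S'zs] := hS'.
pose S := V @` [set k | S' (V' k)].
have SV k : S (V k) <-> S' (V' k).
  by split=> [[l /= S'l /(tchain_inj hV) <-]|]; last exists k.
exists (fun l => p (l + c) - c), S; split.
- exact: adm_conj.
- apply: (mflag_flag hL0 hn); split.
  + have [A S'A] := S'0; exists (V (ty A)); apply/SV.
    by rewrite -(tchain_range hV' (S'V' _ S'A)).
  + by move=> _ [k _ <-]; exact: Vl.
  + move=> _ _ [k _ <-] [l _ <-]; have [kl|lk] := leP k l.
      by right; exact: (tchain_le hV).
    by left; apply: (tchain_le hV); exact: ltW.
  + move=> q _ [k S'k <-]; rewrite (tchain_zs _ _ hV); apply/SV.
    by rewrite -(tchain_zs _ _ hV'); exact: S'zs.
- by rewrite WV => _ [k _ <-]; exists k.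
have pV k : permuted_member U (fun l => p (l + c) - c) k = V' (k + c).
  rewrite pmE V'E spn_perm; congr (spn u _); apply/seteqP.
  split=> [_ [l kl <-]|_ [l kl <-]]; rewrite /tail /= in kl.
    by exists (l + c); rewrite /tail /=; [lia|rewrite subrK].
  by exists (l - c); rewrite /tail /=; [lia|rewrite !subrK].
apply/seteqP; split=> [A S'A|_ [k /= Sk <-]]; last first.
  by rewrite pV; apply/SV; rewrite -WE.
have AE := tchain_range hV' (S'V' _ S'A).
exists (ty A - c); last by rewrite pV subrK.
by rewrite /= WE subrK; apply/SV; rewrite -AE.
Qed.

Lemma basis_frame V u : basis V u ->
  [/\ full_flag V, frame (line \o u) & normal_frame V (line \o u)].
Proof.
move=> hB; have [hV uz Vu nVu VE] := hB; have [Vl tV Vle Vz] := hV.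
have sV k := lattice_sub (Vl k).
have u0 k : u k <> 0 by move=> e; apply: (@nVu k); rewrite e; exact: sub0.
split.
- split; first by split=> // k; exact: (lattice_Gr hL0).
  by move=> k; apply: (ty_qd_eq hL0) => //; rewrite !tV.
- split=> [k|k|] /=.
  + by split; [exact: line_subspace|apply/lineP; [exact: line_subspace|exists (u k)]].
  + by rewrite -uz; exact/esym/zs_line.
  + have := basis_total hn hL0 hB; rewrite -/(spn u setT) -span_lines.
    by move=> <-.
- move=> k; split; apply/seteqP; split.
  + move=> f /(basis_step hL0 hB)[c Vc]; apply/sumsetP.
    by exists (f - c *: u k), (c *: u k); rewrite subrK; split=> //; exists c.
  + apply: sumset_le => //.
    exact: line_min.
  + move=> f [Vf [c _ cf]] /=; have [c0|c0] := eqVneq c 0.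
      by rewrite -cf c0 scale0r.
    case: (@nVu k); rewrite -[u k](scalerK c0) cf; exact: (subZ _ (sV _) Vf).
  + move=> _ ->; split; first exact: sub0.
    by exists 0; rewrite ?scale0r.
Qed.

(** The assumption on the apartment is applied to the identity permutation. The
    closed span of the [U l], [l >= k], is then a lattice, so it contains some
    [W (k + m)], and the missing lines are among the [U l]. *)
Lemma frame_basis W U : full_flag W -> range W `<=` lattice -> frame U ->
  normal_frame W U -> apartment W U `<=` mflag lattice ->
  exists V u, basis V u /\ apartment W U = mflag (latts u).
Proof.
move=> [[WG Wle Wz] W1] Wlat [Uline Uz _] hN aF.
have Wl k : lattice (W k) by apply: Wlat; exists k.
have sW k := lattice_sub (Wl k).
have tW k : ty (W (k + 1)) = ty (W k) + 1 by rewrite (ty_qd hL0 (Wl _) (Wl _) (Wle k) (W1 k)).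
have [|q k x [x0 xU]|u [uz hu]] := @periodic_choice _ _ hn (fun k x => x <> 0 /\ U k = line x).
- by move=> k; have [sU /(lineP sU)[x x0 Ux]] := Uline k; exists x.
- split; first by move=> e; apply: x0; apply: (@zpow_inj R n q); rewrite e (lin0 (zpow_linear q)).
  by rewrite -zs_line -xU -(chain_zs _ q (V := U)).
have u0 k : u k <> 0 by case: (hu k).
have UE k : U k = line (u k) by case: (hu k).
have Wu k : W k (u k).
  have [-> _] := hN k; apply/sumsetP; exists 0, (u k); rewrite add0r.
  by split=> //; [exact: sub0|rewrite UE; exact: line_gen].
have nWu k : ~ W (k + 1) (u k).
  move=> h; have [_ e] := hN k; apply: (u0 k).
  by have : [set 0] (u k); [rewrite -e; split=> //; rewrite UE; exact: line_gen|].
pose c := ty (W 0).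
have tWc k : ty (W k) = k + c.
  have hm (m : nat) l : ty (W (l + m%:Z)) = ty (W l) + m%:Z.
    elim: m => [|m IH]; first by rewrite !addr0.
    have -> : l + m.+1%:Z = l + m%:Z + 1 by lia.
    by rewrite tW IH; lia.
  case: k => m; first by have := hm m 0; rewrite add0r => ->; rewrite addrC.
  by have := hm m.+1 (- m.+1%:Z); rewrite addNr NegzE /c => ->; rewrite addrC addrK.
pose V k := W (k - c); pose v k := u (k - c).
have WV k : W k = V (k + c) by rewrite /V addrK.
have aid k : lattice (spn u (tail k)).
  have fW : flag (range W) by exists W.
  have : apartment W U (permuted_member U id @` [set k | range W (W k)]).
    by exists id, (range W); split=> //; split=> //; exists id.
  move=> /aF[_ h _ _]; apply: h; exists k; first by exists k.
  rewrite /permuted_member -span_lines; congr closed_span.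
  by apply: eq_bigcupr => l _.
have hV : tchain lattice V.
  split=> k; rewrite /V.
  - exact: Wl.
  - by rewrite tWc subrK.
  - by rewrite addrAC; exact: Wle.
  - by rewrite addrAC; exact: Wz.
have Wcle k l : k <= l -> W l `<=` W k by apply: chain_le.
have WE k : W k = spn u (tail k).
  have [N] := lattice_dir hL0 (Wl k) (aid k); rewrite (chain_zs _ _ Wz) => WN.
  have [sS _] := closed_span_closed (u @` tail k).
  have h (m : nat) : W k `<=` sumset (W (k + m%:Z)) (spn u (tail k)).
    elim: m => [|m IH]; first by rewrite addr0; exact: sumset_ge_l.
    have sT := subspace_sum (sW (k + m.+1%:Z)) sS.
    apply: (subset_trans IH); apply: (sumset_le sT); last first.
      by apply: sumset_ge_r; exact: sW.
    have [-> _] := hN (k + m%:Z); apply: (sumset_le sT).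
      rewrite (_ : k + m%:Z + 1 = k + m.+1%:Z); last by lia.
      exact: sumset_ge_l.
    rewrite UE; apply: (line_min sT); apply: sumset_ge_r; first exact: sW.
    by apply: sub_closed_span; exists (k + m%:Z) => //; rewrite /tail /=; lia.
  apply/seteqP; split.
    apply: (subset_trans (h (N * n)%N)); apply: (sumset_le sS) => //.
  apply: closed_span_min; first by have [[]] := WG k.
  by move=> _ [l kl <-]; exact: (Wcle _ _ kl).
have hB : basis V v.
  split=> // k; rewrite /V /v.
  - by rewrite uz addrAC.
  - exact: Wu.
  - by rewrite addrAC; exact: nWu.
  - rewrite WE /spn; congr closed_span; apply/seteqP.
    split=> _ [l kl <-]; rewrite /tail /= in kl.
      by exists (l + c); rewrite ?addrK// /tail /=; lia.
    by exists (l - c); rewrite // /tail /=; lia.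
exists V, v; split=> //; apply: (apartment_basis hB WV) => k.
by rewrite /v addrK.
Qed.

Lemma apartmentsP A : apartments (mflag lattice) A <->
  exists V u, basis V u /\ A = flag_complex (mflag (latts u)).
Proof.
split=> [[W [U [[fW [_ Wlat _ _]] [fU nU] aF ->]]]|[V [u [hB ->]]]].
  have [V [u [hB ->]]] := frame_basis fW Wlat fU nU aF.
  by exists V, u.
have [fV fU nU] := basis_frame hB.
have aE : apartment V (line \o u) = mflag (latts u).
  by apply: (apartment_basis (c := 0) hB) => k; rewrite addr0.
exists V, (line \o u); split=> //; last by rewrite aE.
- by split=> //; have [hV _ _ _ _] := hB; exact: tchain_mflag hV.
- rewrite aE => S; apply: mflag_sub; exact: (latts_lattice hn hL0 hB).
Qed.

End Apartments.

(** * Apartments as thin chamber complexes *)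

Section Buildings.
Variables (R : realType) (n : nat).
Hypothesis hn : (2 <= n)%N.
Local Notation H := (L2 R n).
Variable L0 : set H.
Hypothesis hL0 : forall k, Gr_nplus (zs k L0).
Implicit Types (L : set H) (k l q r a : int) (X Y : set int) (V W : int -> set H).
Implicit Types (u v w : int -> H) (p : int -> int) (S : set (set H)).
Local Notation lattice := (lattice L0).
Local Notation ty := (ty L0).
Local Notation tchain := (tchain L0).
Local Notation basis := (@basis R n L0).
Local Notation dv x := ((n%:Z %| x)%Z).
Local Notation KM M := (flag_complex (mflag M)).

Definition perm_chain u p k : set H := spn u (p @` tail k).

Lemma nset_perm_tail p k : admissible n p -> nset n (p @` tail k).
Proof. by move=> hp; exact/(nset_perm hn hp)/(nset_tail hn). Qed.

Lemma perm_tail p k : admissible n p -> p @` tail (k + 1) = p @` tail k `\ p k.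
Proof.
move=> [/bij_inj pI _]; apply/seteqP; split=> [_ [l kl <-]|_ [[l kl <-] lk]].
  rewrite /tail /= in kl; split; first by exists l; rewrite // /tail /=; lia.
  by move=> /= /pI; lia.
exists l => //; rewrite /tail /= in kl *.
by have : l != k; [apply: contra_notN lk => /eqP ->|lia].
Qed.

Lemma perm_mem p k l : admissible n p -> (p @` tail k) (p l) -> k <= l.
Proof. by move=> [/bij_inj pI _] [l' kl' /pI <-]. Qed.

Section Basis.
Variables (V : int -> set H) (u : int -> H).
Hypothesis hB : basis V u.

Let hV : tchain lattice V. Proof. by case: hB. Qed.
Let VE k : V k = spn u (tail k). Proof. by case: hB. Qed.

Lemma perm_chain_ty p k : admissible n p ->
  ty (perm_chain u p (k + 1)) = ty (perm_chain u p k) + 1.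
Proof.
move=> hp; have hX := nset_perm_tail k hp; have hX1 := nset_perm_tail (k + 1) hp.
apply: (ty_qd hL0); try exact: (spn_lattice hn hL0 hB).
  by apply/(spn_sub hn hL0 hB hX1 hX); rewrite perm_tail// => a [aX _].
rewrite /perm_chain perm_tail//; apply: (spn_D1 hn hL0 hB) => //.
  by exists k => //; rewrite /tail /=.
by rewrite -perm_tail.
Qed.

Lemma perm_chain_tyE p k l : admissible n p ->
  ty (perm_chain u p k) = ty (perm_chain u p l) + (k - l).
Proof.
move=> hp.
have hm (m : nat) a : ty (perm_chain u p (a + m%:Z)) = ty (perm_chain u p a) + m%:Z.
  elim: m => [|m IH]; first by rewrite !addr0.
  have -> : a + m.+1%:Z = a + m%:Z + 1 by lia.
  by rewrite perm_chain_ty// IH; lia.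
have [h|h] := leP l k.
  have e : l + (absz (k - l))%:Z = k by lia.
  by have := hm (absz (k - l)) l; rewrite e; lia.
have e : k + (absz (l - k))%:Z = l by lia.
by have := hm (absz (l - k)) k; rewrite e; lia.
Qed.

(** Consecutive lattices of the chain differ by one index, so one type determines
    the others. *)
Lemma basis_perm p k0 : admissible n p -> ty (perm_chain u p k0) = k0 ->
  basis (perm_chain u p) (u \o p).
Proof.
move=> hp t0; have [_ uz _ _ _] := hB.
have nP k := nset_perm_tail k hp.
split=> [|k|k|k|k].
- split=> k; first exact: (spn_lattice hn hL0 hB).
  + by rewrite (perm_chain_tyE k k0)// t0; lia.
  + by apply/(spn_sub hn hL0 hB) => //; rewrite perm_tail// => a [aX _].
  + rewrite /perm_chain (spn_zs hn hL0 hB)// shift_tail// mul1r.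
    by [].
- by rewrite /= uz; congr u; case: hp.
- by apply: sub_closed_span; exists (p k) => //; exists k => //; rewrite /tail /=.
- by move=> /(spn_mem hn hL0 hB _ (nP _))/(perm_mem hp); lia.
- by rewrite spn_perm.
Qed.

Lemma tr_tail a l : ~~ dv (l - a - 1) -> tr n a @` tail l = tail l.
Proof.
move=> h; have sub : tr n a @` tail l `<=` tail l.
  move=> _ [k lk <-]; rewrite /tail /= in lk *; rewrite /tr; case: ifP => _; first by lia.
  case: ifP => // hk; have : k != l by apply: contraTneq hk => ->.
  lia.
apply/seteqP; split=> // k lk; exists (tr n a k); last exact: (tr_invol hn).
by apply: sub; exists k.
Qed.

Lemma swap_chain a : [/\ basis (perm_chain u (tr n a)) (u \o tr n a),
  forall l, ~~ dv (l - (a + 1)) -> perm_chain u (tr n a) l = V l &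
  perm_chain u (tr n a) (a + 1) <> V (a + 1)].
Proof.
have e l : ~~ dv (l - (a + 1)) -> perm_chain u (tr n a) l = V l.
  by move=> h; rewrite /perm_chain tr_tail ?VE// -addrA -opprD.
have ea : ~~ dv (a - (a + 1)).
  by apply: (dv_neq hn (dvdz0 _)); lia.
split=> //; first by apply: (basis_perm (k0 := a)); [exact: (adm_tr hn)|rewrite e//; case: hV].
rewrite VE => /(spn_inj hn hL0 hB) h.
have {}h := h (nset_perm_tail _ (adm_tr hn a)) (nset_tail hn _).
have : (tail (a + 1)) (tr n a (a + 1)).
  by rewrite -h; exists (a + 1) => //; rewrite /tail /=.
by rewrite (tr_r hn) /tail /=; lia.
Qed.

End Basis.

Lemma flag_complexS (M M' : set (set H)) : M `<=` M' -> KM M `<=` KM M'.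
Proof. by move=> MM' _ [S hS <-]; exists S => //; exact: mflag_sub hS. Qed.

Lemma tchain_eq M V V' k : tchain M V -> tchain M V' -> V k = V' k ->
  (forall l, ~~ dv (l - k) -> V l = V' l) -> V = V'.
Proof.
move=> hV hV' ek e; apply/funext => l.
have [/dvdzP[q lk]|h] := boolP (dv (l - k)); last exact: e.
have -> : l = k + q * n%:Z by lia.
by rewrite -(tchain_zs _ _ hV) -(tchain_zs _ _ hV') ek.
Qed.

Section Apartment.
Variables (V0 : int -> set H) (u0 : int -> H).
Hypothesis hB0 : basis V0 u0.
Local Notation M := (latts u0).

Let Mlat : M `<=` lattice. Proof. exact: (latts_lattice hn hL0 hB0). Qed.
Let Mzs k L : M L -> M (zs k L). Proof. exact: (latts_zs hn hL0 hB0). Qed.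
Let Mint : interpolating L0 M. Proof. exact: (latts_interpolating hn hL0 hB0). Qed.
Let MP := chamberP hn hL0 Mlat Mzs Mint.

Lemma apartment_chain V : tchain M V -> exists u, basis V u /\ latts u = M.
Proof.
move=> /(tchain_perm hn hL0 hB0)[p [hp hB]]; exists (u0 \o p); split=> //.
exact: (latts_perm hn).
Qed.

(** Sort the permutation relating the two chambers: exchanging two neighbours
    crosses a panel. *)
Lemma apartment_gallery c d : chamber (KM M) c -> chamber (KM M) d ->
  gallery (KM M) c d.
Proof.
move=> /MP[V hV ->] /MP[V' hV' ->].
have [u [hB uM]] := apartment_chain hV.
have [p [hp hB']] : exists p, admissible n p /\ basis V' (u \o p).
  by apply: (tchain_perm hn hL0 hB); rewrite uM.
have [N] := ubnP (absz (energy n p)).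
elim: N p V' hV' hp hB' => // N IH p V' hV' hp hB' hN.
have [[i hi]|] := pselect (exists i : 'I_n, p (i%:Z + 1) < p i%:Z).
  have [hB'' e _] := swap_chain hB' i%:Z; set V'' := perm_chain _ _ in hB'' e.
  have hp' := adm_comp hp (adm_tr hn i%:Z).
  have hV'' : tchain M V''.
    rewrite -uM -(latts_perm hn u hp'); exact: (basis_tchain hn hB'').
  have := energy_tr hn hp hi; have := energy_ge0 n (p \o tr n i) => e1 e2.
  have [|m [g [g0 gm gc ga]]] := IH _ _ hV'' hp' hB''; first by lia.
  exists m.+1, (fun j => if (j <= m)%N then g j else flag_simplex (range V')).
  split=> [//||j|j]; rewrite ?ltnn//.
    move=> _; case: leqP => jm; first exact: gc.
    by apply/MP; exists V'.
  rewrite ltnS => jm; rewrite jm; have [jm'|jm'] := ltnP j m; first exact: ga.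
  have -> : j = m by lia.
  by rewrite gm; apply: (tchain_adjacent hn hL0 Mlat hV'' hV' e).
move=> /forallNP nd; have pE k : p k = k + p 0.
  apply: (adm_no_descent hn hp) => i.
  have /negP := nd i; rewrite -leNgt le_eqVlt => /orP[/eqP|//].
  by move=> /(bij_inj hp.1); lia.
have VV' k : V' k = V (k + p 0).
  have [_ _ _ _ ->] := hB'; have [_ _ _ _ ->] := hB.
  rewrite spn_perm; congr (spn u _); apply/seteqP; split=> [_ [l kl <-]|l kl].
    by rewrite /tail /= (pE l) in kl *; lia.
  exists (l - p 0); first by rewrite /tail /= in kl *; lia.
  by rewrite pE subrK.
have p0 : p 0 = 0.
  have [_ tV' _ _] := hV'; have [_ tV _ _] := hV.
  by have := tV' 0; rewrite VV' tV; lia.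
have -> : V' = V by apply/funext => k; rewrite VV' p0 addr0.
exists 0%N, (fun=> flag_simplex (range V)); split=> // j _.
by apply/MP; exists V.
Qed.

Lemma apartment_complex : chamber_complex (KM M).
Proof. exact/(complex_axioms hn hL0 Mlat Mzs Mint)/apartment_gallery. Qed.

(** Between the neighbours of [V k] in the chain, an index set of the right type
    contains exactly one of [k - 1] and [k]. *)
Lemma apartment_thin : thin (KM M).
Proof.
move=> s /(panelP hn hL0 Mlat Mzs Mint)[V [k [hV ->]]].
have [u [hB uM]] := apartment_chain hV; have [_ _ _ _ VE] := hB.
have [hB' e ne] := swap_chain hB (k - 1); set V' := perm_chain _ _ in hB' e ne.
rewrite subrK in e ne.
have hV' : tchain M V'.
  rewrite -uM -(latts_perm hn u (adm_tr hn (k - 1))); exact: (basis_tchain hn hB').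
exists (flag_simplex (range V)), (flag_simplex (range V')); split.
  by move=> /(tchain_simplex_inj hL0 Mlat hV hV') VV'; apply: ne; rewrite VV'.
have nk1 : ~~ dv (k + 1 - k) by apply: (dv_neq hn (dvdz0 _)); lia.
have nk2 : ~~ dv (k - 1 - k) by apply: (dv_neq hn (dvdz0 _)); lia.
move=> c; split=> [[/MP[V3 hV3 ->] /(panel_sub hn hL0 Mlat k hV hV3) e3]|[->|->]]; last 2 first.
- by split; [apply/MP; exists V|move=> E []].
- by split; [apply/MP; exists V'|apply/(panel_sub hn hL0 Mlat k hV hV')].
have [V3M tV3 V3le _] := hV3; have [X hX XE] : latts u (V3 k) by rewrite uM.
have X1 : tail (k + 1) `<=` X.
  by apply/(spn_sub hn hL0 hB (nset_tail hn _) hX); rewrite XE -VE -e3.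
have X2 : X `<=` tail (k - 1).
  apply/(spn_sub hn hL0 hB hX (nset_tail hn _)); rewrite XE -VE -(e3 _ nk2).
  by have := V3le (k - 1); rewrite subrK.
have tX Y l : X = Y -> spn u Y = V l -> l = k.
  by move=> XY YV; have := tV3 k; rewrite -XE XY YV; case: hV => _ -> _ _.
have nkk j : tail (k + 1) j \/ j = k \/ j = k - 1 \/ ~ tail (k - 1) j.
  by rewrite /tail /=; lia.
have [Xk|nXk] := pselect (X k); have [Xk1|nXk1] := pselect (X (k - 1)).
- suff : k - 1 = k by lia.
  apply: (tX (tail (k - 1)) (k - 1) _ (esym (VE _))).
  apply/seteqP; split=> // j h; case: (nkk j) => [/X1//|[->//|[->//|//]]].
- left; suff -> : V3 = V by [].
  apply: (@tchain_eq _ _ _ k hV3 hV) => //.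
  rewrite VE -XE; congr (spn u _); apply/seteqP; split=> j.
    move=> Xj; have := X2 _ Xj; rewrite /tail /=.
    have : j != k - 1 by apply: contra_notN nXk1 => /eqP <-.
    lia.
  case: (nkk j) => [/X1//|[->//|[->|]]]; rewrite /tail /=; lia.
- right; suff -> : V3 = V' by [].
  apply: (@tchain_eq _ _ _ k hV3 hV') => //.
    rewrite -XE /V' /perm_chain; congr (spn u _).
    have t1 : tr n (k - 1) (k - 1) = k by rewrite tr_l subrK.
    have t2 : tr n (k - 1) k = k - 1 by rewrite -{2}t1 (tr_invol hn).
    have tt : tr n (k - 1) @` tail (k + 1) = tail (k + 1).
      by apply: tr_tail; rewrite (_ : k + 1 - (k - 1) - 1 = k + 1 - k)//; lia.
    apply/seteqP; split=> [j Xj|_ [l kl <-]].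
      case: (nkk j) => [|[jk|[->|h]]]; last by case: h; exact: X2.
      - rewrite -tt => -[l kl <-]; exists l => //; rewrite /tail /= in kl *; lia.
      - by case: nXk; rewrite -jk.
      - by exists k; rewrite // /tail /=.
    have [->|lk] := eqVneq l k; first by rewrite t2.
    by apply: X1; rewrite -tt; exists l => //; rewrite /tail /= in kl *; lia.
  by move=> l h; rewrite e3 ?e.
- suff : k + 1 = k by lia.
  apply: (tX (tail (k + 1)) (k + 1) _ (esym (VE _))).
  apply/seteqP; split=> // j Xj; have := X2 _ Xj; rewrite /tail /=.
  have : j != k by apply: contra_notN nXk => /eqP <-.
  have : j != k - 1 by apply: contra_notN nXk1 => /eqP <-.
  lia.
Qed.

End Apartment.

End Buildings.

(** * Thickness and isomorphisms of apartments *)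

Section Buildings.
Variables (R : realType) (n : nat).
Hypothesis hn : (2 <= n)%N.
Local Notation H := (L2 R n).
Variable L0 : set H.
Hypothesis hL0 : forall k, Gr_nplus (zs k L0).
Implicit Types (L : set H) (k l q r a : int) (X Y : set int) (V W : int -> set H).
Implicit Types (u v w : int -> H) (p : int -> int) (S : set (set H)).
Local Notation lattice := (lattice L0).
Local Notation ty := (ty L0).
Local Notation tchain := (tchain L0).
Local Notation basis := (@basis R n L0).
Local Notation dv x := ((n%:Z %| x)%Z).
Local Notation KM M := (flag_complex (mflag M)).

Let lid : lattice `<=` lattice. Proof. by []. Qed.
Let lz k L : lattice L -> lattice (zs k L). Proof. exact: lattice_zs. Qed.
Let DP := chamberP hn hL0 lid lz (lattice_interpolating hL0).

Lemma apartment_chamber V u : basis V u -> chamber (KM (latts u)) `<=` chamber (KM lattice).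
Proof.
move=> hB c; have la := latts_lattice hn hL0 hB.
move=> /(chamberP hn hL0 la (latts_zs hn hL0 hB) (latts_interpolating hn hL0 hB)).
move=> [V' [VM tV Vle Vz] ->]; apply/DP; exists V' => //; split=> // k; exact: la.
Qed.

Lemma lattice_gallery c d : chamber (KM lattice) c -> chamber (KM lattice) d ->
  gallery (KM lattice) c d.
Proof.
move=> /DP[V hV ->] /DP[V' hV' ->].
have [u [hB hV'u]] := common_apartment hn hL0 hV hV'.
have AP := chamberP hn hL0 (latts_lattice hn hL0 hB) (latts_zs hn hL0 hB)
  (latts_interpolating hn hL0 hB).
have [||m [g [g0 gm gc ga]]] := @apartment_gallery _ _ hn _ hL0 _ _ hB
    (flag_simplex (range V)) (flag_simplex (range V')).
- by apply/AP; exists V => //; exact: (basis_tchain hn hB).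
- by apply/AP; exists V'.
by exists m, g; split=> // i im; apply: (apartment_chamber hB); exact: gc.
Qed.

Lemma lattice_complex : chamber_complex (KM lattice).
Proof. exact/(complex_axioms hn hL0 lid lz (lattice_interpolating hL0))/lattice_gallery. Qed.

Lemma insert_line V k x : tchain lattice V -> V (k - 1) x -> ~ V (k + 1) x ->
  exists V', [/\ tchain lattice V', V' k = sumset (V (k + 1)) (line x) &
    forall l, ~~ dv (l - k) -> V' l = V l].
Proof.
move=> hV Vx nVx; have [Vl tV Vle Vz] := hV.
have sV l := lattice_sub (Vl l); have sx := line_subspace x.
pose L := sumset (V (k + 1)) (line x).
have VL : V (k + 1) `<=` L by exact: sumset_ge_l.
have LV : L `<=` V (k - 1).
  apply: sumset_le => //; first by apply: (tchain_le hV); lia.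
  exact: line_min.
have sL : subspace L by exact: subspace_sum.
have hL : lattice L.
  apply: (lattice_sandwich hL0 (Vl _) (Vl _) VL LV sL).
  apply: (subset_trans (zs_mono LV)); rewrite Vz; apply: (subset_trans _ VL).
  by apply: (tchain_le hV); lia.
have q1 : quotient_dim L (V (k + 1)) 1.
  apply/(qd1P _ (sV _)); exists x.
    by apply: sumset_ge_r => //; exact: line_gen.
  split=> // _ /sumsetP[f [_ [Vf [c _ <-] ->]]]; exists c.
  by rewrite addrK.
have tL : ty L = k by have := ty_qd hL0 hL (Vl _) VL q1; rewrite tV; lia.
exact: (tchain_update hn hL0 lid lz hV hL tL VL LV).
Qed.

(** Since z maps [V (k - 1)] into [V (k + 1)], all subspaces between them are
    lattices. The quotient is a plane, spanned by the classes of [x] and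
    [y]: it contains the distinct lines of [x], [y] and [x + y]. *)
Lemma lattice_thick : thick (KM lattice).
Proof.
move=> s /(panelP hn hL0 lid lz (lattice_interpolating hL0))[V [k [hV ->]]].
have [u [hB _]] := basis_exists hn hL0 hV.
have [_ _ Vu nVu _] := hB; have [Vl tV Vle Vz] := hV.
have sV l := lattice_sub (Vl l).
have Va : V (k - 1) (u (k - 1)) by [].
have nVa : ~ V k (u (k - 1)) by have := @nVu (k - 1); rewrite subrK.
have Vb : V k (u k) by []; have nVb : ~ V (k + 1) (u k) by [].
move: (u (k - 1)) (u k) Va nVa Vb nVb => x y Vx nVx Vy nVy.
have Vk1 : V (k + 1) `<=` V k by exact: Vle.
have Vk0 : V k `<=` V (k - 1) by have := Vle (k - 1); rewrite subrK.
have nVxy : ~ V k (x + y) by move=> /(subDl (sV _) Vy).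
have [||V1 [hV1 V1k V1l]] := @insert_line V k x hV; try by [].
  by move=> /Vk1.
have [||V2 [hV2 V2k V2l]] := @insert_line V k y hV; try by [].
  exact: Vk0.
have [||V3 [hV3 V3k V3l]] := @insert_line V k (x + y) hV; try by [].
- by apply: (subD (sV _)) => //; exact: Vk0.
- by move=> /Vk1.
have memL (w z : H) : sumset (V (k + 1)) (line w) z -> exists c, V (k + 1) (z - c *: w).
  by move=> /sumsetP[f [_ [Vf [c _ <-] ->]]]; exists c; rewrite addrK.
have Lmem (w : H) : sumset (V (k + 1)) (line w) w.
  by apply: sumset_ge_r; [exact: sV|exact: line_gen].
have ne W W' (w w' : H) : tchain lattice W -> tchain lattice W' ->
    W k = sumset (V (k + 1)) (line w) -> W' k = sumset (V (k + 1)) (line w') ->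
    (forall c, ~ V (k + 1) (w' - c *: w)) ->
    flag_simplex (range W) <> flag_simplex (range W').
  move=> hW hW' Wk W'k nc /(tchain_simplex_inj hL0 lid hW hW') WW'.
  have := Lmem w'; rewrite -W'k -WW' Wk => /memL[c]; exact: nc.
exists (flag_simplex (range V1)), (flag_simplex (range V2)), (flag_simplex (range V3)).
split.
- apply/nesym/(ne _ _ _ _ hV2 hV1 V2k V1k) => c /Vk1 h; apply: nVx.
  apply: (subDl (sV _) _ h); exact/(subN (sV _))/(subZ _ (sV _)).
- apply: (ne _ _ _ _ hV1 hV3 V1k V3k) => c h.
  have [c1|c1] := eqVneq c 1.
    by apply: nVy; move: h; rewrite c1 scale1r addrAC subrr add0r.
  apply: nVx; have d0 : 1 - c != 0 by rewrite subr_eq0 eq_sym.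
  rewrite -[x](scalerK d0); apply: (subZ _ (sV _)).
  apply: (subDl (sV _) Vy); move: (Vk1 _ h).
  by rewrite scalerBl scale1r addrAC.
- apply: (ne _ _ _ _ hV2 hV3 V2k V3k) => c /Vk1; rewrite -addrA => h; apply: nVx.
  apply: (subDl (sV _) _ h); apply: (subB (sV _)) => //; exact: (subZ _ (sV _)).
split; [by apply/DP; exists V1|by apply/DP; exists V2|by apply/DP; exists V3|].
split.
- exact/(panel_sub hn hL0 lid k hV hV1).
- exact/(panel_sub hn hL0 lid k hV hV2).
- exact/(panel_sub hn hL0 lid k hV hV3).
Qed.

Lemma orb_spn V u X Y : basis V u -> nset n X -> nset n Y ->
  orb (spn u X) = orb (spn u Y) <-> exists q, Y = shift n q X.
Proof.
move=> hB hX hY; split=> [/orb_eq[q]|[q ->]].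
  rewrite (spn_zs hn hL0 hB)// => /(spn_inj hn hL0 hB hY) e; exists q.
  by apply: e; exact: (nset_shift hn).
by rewrite -(spn_zs hn hL0 hB)// orb_zs.
Qed.

(** The map of vertices between two apartments which preserves index sets, defined
    by choosing an index set of the elementary flag. *)
Definition transfer u u' (E : set (set H)) : set (set H) :=
  xget E [set E' | exists X, [/\ nset n X, E = orb (spn u X) & E' = orb (spn u' X)]].

Section Iso.
Variables (V V' : int -> set H) (u u' : int -> H).
Hypotheses (hB : basis V u) (hB' : basis V' u').

Lemma transferE X : nset n X -> transfer u u' (orb (spn u X)) = orb (spn u' X).
Proof.
move=> hX; rewrite /transfer; case: xgetP => [E' _ [Y [hY e ->]]|/(_ (orb (spn u' X)))].
  by apply/(orb_spn hB' hY hX)/(orb_spn hB hY hX).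
by case; exists X.
Qed.

Definition transfer_flag S : set (set H) :=
  [set spn u' X | X in [set X | nset n X /\ S (spn u X)]].

Lemma transfer_mflag S : mflag (latts u) S -> mflag (latts u') (transfer_flag S).
Proof.
move=> [[L SL] SM Stot Szs]; split.
- have [X hX XL] := SM _ SL; exists (spn u' X); exists X => //.
  by rewrite /= XL.
- by move=> _ [X [hX _] <-]; exists X.
- move=> _ _ [X [hX SX] <-] [Y [hY SY] <-]; case: (Stot _ _ SX SY).
    by move=> /(spn_sub hn hL0 hB hX hY)/(spn_sub hn hL0 hB' hX hY); left.
  by move=> /(spn_sub hn hL0 hB hY hX)/(spn_sub hn hL0 hB' hY hX); right.
- move=> q _ [X [hX SX] <-]; rewrite (spn_zs hn hL0 hB')//; exists (shift n q X) => //.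
  split; first exact: (nset_shift hn).
  by rewrite -(spn_zs hn hL0 hB)//; exact: Szs.
Qed.

Lemma transfer_simplex S : mflag (latts u) S ->
  transfer u u' @` flag_simplex S = flag_simplex (transfer_flag S).
Proof.
move=> hS; have hS' := transfer_mflag hS; have [_ SM _ _] := hS.
rewrite (flag_simplexE hL0 (latts_lattice hn hL0 hB) hS).
rewrite (flag_simplexE hL0 (latts_lattice hn hL0 hB') hS').
apply/seteqP; split=> [_ [_ [L SL <-] <-]|_ [_ [X [hX SX] <-] <-]].
  have [X hX XL] := SM _ SL; subst L; rewrite transferE//.
  by exists (spn u' X) => //; exists X.
by exists (orb (spn u X)); [exists (spn u X)|exact: transferE].
Qed.

End Iso.

Lemma transfer_flagK V V' u u' S : basis V u -> basis V' u' -> mflag (latts u') S ->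
  transfer_flag u u' (transfer_flag u' u S) = S.
Proof.
move=> hB hB' [_ SM _ _]; apply/seteqP; split=> [_ [X [hX [Y [hY SY]]] + <-]|L SL].
  by move=> /(spn_inj hn hL0 hB hY hX) <-.
have [X hX XL] := SM _ SL; subst L; exists X => //; split=> //.
by exists X.
Qed.

Lemma transfer_iso V V' u u' : basis V u -> basis V' u' ->
  complex_iso (KM (latts u)) (KM (latts u')) (transfer u u').
Proof.
move=> hB hB'; have la := latts_lattice hn hL0 hB; have lzz := latts_zs hn hL0 hB.
split.
  move=> _ _ /(vertexP hL0 la lzz)[_ [X hX <-] ->] /(vertexP hL0 la lzz)[_ [Y hY <-] ->].
  rewrite !(transferE hB hB')// => /(orb_spn hB' hX hY) e.
  exact/(orb_spn hB hX hY).
apply/seteqP; split=> [_ [_ [S hS <-] <-]|_ [S hS <-]].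
  rewrite (transfer_simplex hB hB')//; exists (transfer_flag u u' S) => //.
  exact: (transfer_mflag hB hB').
have hS' := transfer_mflag hB' hB hS.
exists (flag_simplex (transfer_flag u' u S)); first by exists (transfer_flag u' u S).
by rewrite (transfer_simplex hB hB')// (transfer_flagK hB hB').
Qed.

(** These lattices test which indices between [s] and [t] belong to [X], without
    reference to the basis. *)
Lemma gap_lattice V u X s t : basis V u -> nset n X ->
  sumset (V t) (spn u X `&` V s) = spn u (tail t `|` (X `&` tail s)).
Proof.
move=> hB hX; have [_ _ _ _ VE] := hB.
rewrite (spnU hn hL0 hB (nset_tail hn t) (nsetI hX (nset_tail hn s))) -VE.
by rewrite (spnI_tail hn hL0 hB).
Qed.

Lemma gap_above V u X s t a : basis V u -> nset n X -> s <= a < t ->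
  V s `<=` sumset (V t) (spn u X `&` V s) -> X a.
Proof.
move=> hB hX /andP[sa at_]; have [_ _ _ _ VE] := hB; rewrite gap_lattice// VE.
have hU := nsetU (nset_tail hn t) (nsetI hX (nset_tail hn s)).
move=> /(spn_sub hn hL0 hB (nset_tail hn s) hU) /(_ a)[//||[]//].
by rewrite /tail /=; lia.
Qed.

Lemma gap_below V u X s t a : basis V u -> nset n X -> s <= a < t ->
  sumset (V t) (spn u X `&` V s) `<=` V t -> ~ X a.
Proof.
move=> hB hX /andP[sa at_]; have [_ _ _ _ VE] := hB; rewrite gap_lattice// VE.
have hU := nsetU (nset_tail hn t) (nsetI hX (nset_tail hn s)).
move=> /(spn_sub hn hL0 hB hU (nset_tail hn t)) h Xa.
by have := h a; rewrite /tail /= => /(_ (or_intror (conj Xa sa))); lia.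
Qed.

(** Let both chambers contain a maximal chain of common lattices. For a common
    lattice [L] and a gap [B < A] of this chain, [B + L :&: A] is common, so it
    is [A] or [B] by maximality: the index set of [L] contains all the indices
    of the gap or none, and which case holds does not depend on the apartment. *)
Lemma aligned V1 u1 V2 u2 : basis V1 u1 -> basis V2 u2 ->
  exists V u V' u', [/\ basis V u, latts u = latts u1, basis V' u', latts u' = latts u2 &
    forall L, latts u L -> latts u' L -> exists X, [/\ nset n X, L = spn u X & L = spn u' X]].
Proof.
move=> hB1 hB2; pose I := latts u1 `&` latts u2.
have [[L IL]|nI] := pselect (I !=set0); last first.
  by exists V1, u1, V2, u2; split=> // L L1 L2; case: nI; exists L.
have la1 := latts_lattice hn hL0 hB1; have lz1 := latts_zs hn hL0 hB1.
have la2 := latts_lattice hn hL0 hB2; have lz2 := latts_zs hn hL0 hB2.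
have Ila : I `<=` lattice by move=> A [/la1].
have Iz k A : I A -> I (zs k A) by move=> [? ?]; split; [exact: lz1|exact: lz2].
have [S [hS _ max]] := mflag_max (orb_mflag Ila Iz IL).
have I1 : I `<=` latts u1 by move=> A [].
have I2 : I `<=` latts u2 by move=> A [].
have [V hV SV] := mflag_ext hL0 la1 lz1 hn (latts_interpolating hn hL0 hB1) (mflag_sub I1 hS).
have [V' hV' SV'] := mflag_ext hL0 la2 lz2 hn (latts_interpolating hn hL0 hB2) (mflag_sub I2 hS).
have [u [hB uE]] := apartment_chain hn hL0 hB1 hV.
have [u' [hB' u'E]] := apartment_chain hn hL0 hB2 hV'.
exists V, u, V', u'; split=> // _ [X hX <-] [X' hX' e].
exists X; split=> //; rewrite -e; congr (spn u' _).
have IX : I (spn u X) by split; [rewrite -uE; exists X|rewrite -e -u'E; exists X'].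
apply/seteqP; suff h a : X' a <-> X a by split=> a /h.
have [A [B [SA SB tA tB gap]]] := mflag_gap hL0 Ila hn a hS.
have := tchain_range hV (SV _ SA); have := tchain_range hV' (SV' _ SA).
have := tchain_range hV (SV _ SB); have := tchain_range hV' (SV' _ SB).
move: (ty A) (ty B) tA tB => s t sa at_ Bt' Bt As' As.
have ast : s <= a < t by rewrite sa at_.
pose Q := sumset B (spn u X `&` A).
have QE : Q = sumset (V t) (spn u X `&` V s) by rewrite /Q Bt As.
have QE' : Q = sumset (V' t) (spn u' X' `&` V' s) by rewrite /Q Bt' As' e.
have IQ : I Q.
  split.
    rewrite -uE QE (gap_lattice _ _ hB hX); eexists; last by [].
    exact: nsetU (nset_tail hn t) (nsetI hX (nset_tail hn s)).
  rewrite -u'E QE' (gap_lattice _ _ hB' hX'); eexists; last by [].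
  exact: nsetU (nset_tail hn t) (nsetI hX' (nset_tail hn s)).
have [_ SI _ _] := hS.
have sA := lattice_sub (Ila _ (SI _ SA)); have sB := lattice_sub (Ila _ (SI _ SB)).
have sX := lattice_sub (Ila _ IX).
have BQ : B `<=` Q by apply: sumset_ge_l; exact: subspaceI.
have BA : B `<=` A by rewrite Bt As; apply: (tchain_le hV); lia.
have QA : Q `<=` A by apply: sumset_le => // f [].
have SQ := max_gap Ila Iz hS max gap IQ BQ QA.
case: (gap _ SQ) => [AQ|QB].
  split=> _.
    by apply: (gap_above hB hX ast); rewrite -QE -As.
  by apply: (gap_above hB' hX' ast); rewrite -QE' -As'.
split=> h.
  by case: (gap_below hB' hX' ast _ h); rewrite -QE' -Bt'.
by case: (gap_below hB hX ast _ h); rewrite -QE -Bt.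
Qed.

Lemma apartment_iso V1 u1 V2 u2 : basis V1 u1 -> basis V2 u2 ->
  exists f, complex_iso (KM (latts u1)) (KM (latts u2)) f /\
    forall E, KM (latts u1) [set E] -> KM (latts u2) [set E] -> f E = E.
Proof.
move=> hB1 hB2; have [V [u [V' [u' [hB <- hB' <- al]]]]] := aligned hB1 hB2.
exists (transfer u u'); split; first exact: (transfer_iso hB hB').
have la := latts_lattice hn hL0 hB; have lzz := latts_zs hn hL0 hB.
have la' := latts_lattice hn hL0 hB'; have lz' := latts_zs hn hL0 hB'.
move=> E /(vertexP hL0 la lzz)[L uL ->] /(vertexP hL0 la' lz')[L' u'L' e].
have u'L : latts u' L.
  by have [k ->] := orb_eq (esym e); exact: lz'.
have [X [hX LE LE']] := al _ uL u'L.
by rewrite [in LHS]LE (transferE hB hB')// -LE'.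
Qed.

End Buildings.

(** * The Coxeter complex *)

Section CoxeterIso.
Variables (R : realType) (n : nat).
Hypothesis hn : (2 <= n)%N.
Local Notation H := (L2 R n).
Variable L0 : set H.
Hypothesis hL0 : forall k, Gr_nplus (zs k L0).
Implicit Types (k l q : int) (p : int -> int) (S : set (set H)) (w : seq 'I_n).
Local Notation lattice := (lattice L0).
Local Notation ty := (ty L0).
Local Notation tchain := (tchain L0).
Local Notation dv x := ((n%:Z %| x)%Z).
Local Notation KM M := (flag_complex (mflag M)).
Local Notation m := (@affineA_matrix n).

Variables (V : int -> set H) (u : int -> H).
Hypothesis hB : basis L0 V u.

Let hV : tchain lattice V. Proof. by case: hB. Qed.
Let VE k : V k = spn u (tail k). Proof. by case: hB. Qed.

(** The chamber [w V] of the apartment. *)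
Definition word_chain w : int -> set H := perm_chain u (word_perm w).

(** The last letter [i] of the word preserves the half-line [>= i], hence the type
    of one lattice of the chain. *)
Lemma perm_chain_word p w k : admissible n p ->
  ty (perm_chain u (p \o word_perm w) k) = ty (perm_chain u p k).
Proof.
move=> hp; elim/last_ind: w k => [|w i IH] k //.
have hw := adm_comp hp (adm_word hn w); have hwi := adm_comp hp (adm_word hn (rcons w i)).
rewrite (perm_chain_tyE hn hL0 hB k i%:Z hwi) -(IH k).
rewrite (perm_chain_tyE hn hL0 hB k i%:Z hw); congr (ty (spn u _) + _).
rewrite -[RHS]image_comp -{2}(@tr_tail n hn i%:Z i%:Z); last first.
  by apply: (dv_neq hn (dvdz0 _)); lia.
rewrite !image_comp; apply: eq_imagel => l _ /=.
by rewrite word_perm_rcons.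
Qed.

Lemma word_chain_ty w k : ty (word_chain w k) = k.
Proof.
have h : admissible n id by split=> //; exists id.
rewrite /word_chain -[word_perm w]/(id \o word_perm w) perm_chain_word//.
by rewrite /perm_chain image_id -VE; case: hV.
Qed.

Lemma word_chain_tchain w : tchain (latts u) (word_chain w).
Proof.
have hw := adm_word hn w.
rewrite -(latts_perm hn u hw); apply: (basis_tchain hn (L0 := L0)).
exact: (basis_perm hn hL0 hB hw (word_chain_ty w 0)).
Qed.

(** Sorting yields a word up to a translation, which is trivial because the types
    agree. *)
Lemma chain_word V' : tchain (latts u) V' -> exists w, V' = word_chain w.
Proof.
move=> hV'; have [p [hp [_ _ _ _ V'E]]] := tchain_perm hn hL0 hB hV'.
have [w [c [_ pE _]]] := adm_ascending hn hp.
have hc : admissible n (fun k => k + c).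
  split; first by exists (fun k => k - c) => k; rewrite ?addrK ?subrK.
  by move=> k; rewrite addrAC.
have {}pE : p = (fun k => k + c) \o word_perm w by apply/funext => k; rewrite pE.
have c0 : c = 0.
  have [_ tV' _ _] := hV'; have := tV' 0; rewrite V'E spn_perm pE.
  rewrite -/(perm_chain u _ 0) perm_chain_word//.
  have -> : perm_chain u (fun k => k + c) 0 = V c.
    rewrite VE; congr (spn u _); apply/seteqP; split=> [_ [l kl <-]|l cl].
      by rewrite /tail /= in kl *; lia.
    by exists (l - c); rewrite ?subrK// /tail /= in cl *; lia.
  by case: hV => _ -> _ _.
exists w; apply/funext => k; rewrite V'E spn_perm pE c0; congr (spn u _).
by apply: eq_imagel => l _ /=; rewrite addr0.
Qed.

Lemma word_chain_vertex w w' (i : 'I_n) :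
  coxeter_vertex m w i = coxeter_vertex m w' i <->
  word_chain w (i%:Z + 1) = word_chain w' (i%:Z + 1).
Proof.
have wK (v : seq 'I_n) k : word_perm v (word_perm (rev v) k) = k.
  by have := word_perm_revK hn (rev v) k; rewrite revK.
have nw (v : seq 'I_n) := nset_perm_tail hn (i%:Z + 1) (adm_word hn v).
rewrite (coxeter_vertexP hn); split=> [h|/(spn_inj hn hL0 hB (nw w) (nw w')) e k].
  rewrite /word_chain /perm_chain; congr (spn u _).
  apply/seteqP; split=> _ [l il <-]; rewrite /tail /= in il.
    exists (word_perm (rev w') (word_perm w l)); last exact: wK.
    have := h (word_perm (rev w') (word_perm w l)).
    by rewrite word_perm_cat wK (word_perm_revK hn) /tail /=; lia.
  exists (word_perm (rev w) (word_perm w' l)); last exact: wK.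
  have := h l; rewrite word_perm_cat /tail /=; lia.
rewrite word_perm_cat; apply/idP/idP => ik.
  have : (word_perm w @` tail (i%:Z + 1)) (word_perm w' k).
    by exists (word_perm (rev w) (word_perm w' k)); [rewrite /tail /=; lia|exact: wK].
  by rewrite e => /(perm_mem (adm_word hn w')); lia.
have : (word_perm w' @` tail (i%:Z + 1)) (word_perm w' k).
  by exists k; rewrite // /tail /=; lia.
rewrite -e => h; have := @perm_mem n (word_perm w) (i%:Z + 1)
  (word_perm (rev w) (word_perm w' k)) (adm_word hn w).
by rewrite wK => /(_ h); lia.
Qed.

Definition coxeter_map (E : set (seq 'I_n)) : set (set H) :=
  xget set0 [set E' | exists w i,
    E = coxeter_vertex m w i /\ E' = orb (word_chain w (i%:Z + 1))].

Lemma coxeter_mapE w i : coxeter_map (coxeter_vertex m w i) = orb (word_chain w (i%:Z + 1)).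
Proof.
rewrite /coxeter_map; case: xgetP => [_ _ [w' [i' [e ->]]]|/(_ (orb (word_chain w (i%:Z + 1))))].
  have ii' := coxeter_vertex_type hn e; subst i'.
  by congr orb; apply/esym/word_chain_vertex.
by case; exists w, i.
Qed.

Lemma coxeter_iso : complex_iso (coxeter_complex m) (KM (latts u)) coxeter_map.
Proof.
have la := latts_lattice hn hL0 hB; have lz := latts_zs hn hL0 hB.
have vertex E : coxeter_complex m [set E] -> exists w i, E = coxeter_vertex m w i.
  move=> [w [J [[i Ji] e]]]; exists w, i.
  by have : [set coxeter_vertex m w i | i in J] (coxeter_vertex m w i); [exists i|rewrite -e].
split=> [_ _ /vertex[w [i ->]] /vertex[w' [i' ->]]|].
  rewrite !coxeter_mapE => /orb_eq[q e].
  have [wl _ _ _] := word_chain_tchain w.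
  have := word_chain_ty w' (i'%:Z + 1); rewrite e tyz//; last exact: la.
  rewrite word_chain_ty => iq; have := ltn_ord i; have := ltn_ord i' => li' li.
  have q0 : q = 0 by nia.
  have ii' : i = i' by apply/val_inj => /=; move: iq; rewrite q0 mulr0; lia.
  subst i'; apply/word_chain_vertex.
  by rewrite e q0 zs0.
apply/seteqP; split=> [_ [_ [w [J [[i Ji] ->]]] <-]|_ [S hS <-]].
  have hw := tchain_mflag (word_chain_tchain w).
  have [||S [hS _ ->]] := @simplex_face _ _ _ hL0 _ la _
      (coxeter_map @` [set coxeter_vertex m w i | i in J]) hw.
  - move=> _ [_ [j Jj <-] <-]; rewrite coxeter_mapE.
    by rewrite (tchain_simplex hL0 la (word_chain_tchain w)); exists (j%:Z + 1).
  - by exists (coxeter_map (coxeter_vertex m w i)); exists (coxeter_vertex m w i) => //; exists i.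
  by exists S.
have [V' hV' SV'] := mflag_ext hL0 la lz hn (latts_interpolating hn hL0 hB) hS.
have [w V'E] := chain_word hV'; subst V'.
have hw := tchain_mflag hV'.
pose J := [set i : 'I_n | flag_simplex S (orb (word_chain w (i%:Z + 1)))].
have surj E : flag_simplex S E -> exists2 i, J i & E = orb (word_chain w (i%:Z + 1)).
  move=> SE; have := (simplex_sub hL0 la hS hw).2 SV' _ SE.
  rewrite (tchain_simplex hL0 la hV') => -[k _ kE].
  have k0 : 0 <= ((k - 1) %% n%:Z)%Z by rewrite modz_ge0//; lia.
  have hk : (absz ((k - 1) %% n%:Z)%Z < n)%N by rewrite -ltz_nat gez0_abs// ltz_pmod//; lia.
  have e : orb (word_chain w k) = orb (word_chain w ((Ordinal hk)%:Z + 1)).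
    apply/(tchain_orb_eq hn _ _ hV'); rewrite /= gez0_abs//; apply/dvdzP.
    by exists (- ((k - 1) %/ n%:Z)%Z); have := divz_eq (k - 1) n%:Z; lia.
  by exists (Ordinal hk); rewrite /J /= -e kE.
exists [set coxeter_vertex m w i | i in J].
  exists w, J; split=> //; have [[L SL] _ _ _] := hS.
  have [i Ji _] := surj _ ((simplex_orb hL0 la L hS).2 SL).
  by exists i.
apply/seteqP; split=> [_ [_ [i Ji <-] <-]|E /surj[i Ji ->]]; first by rewrite coxeter_mapE.
by exists (coxeter_vertex m w i); [exists i|exact: coxeter_mapE].
Qed.

End CoxeterIso.

Theorem theorem3p2 (R : realType) (n : nat) (hn : (2 <= n)%N)
    (F : set (set (set (L2 R n)))) (hF : compatibility_class F) :
  building_of_type (@affineA_matrix n) (flag_complex F) (apartments F).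
Proof.
have [L0 hL0 ->] := class_lattice hn hF.
have aP := apartmentsP hn hL0.
have lz k L : lattice L0 L -> lattice L0 (zs k L) by exact: lattice_zs.
have DP := chamberP hn hL0 (fun _ h => h) lz (lattice_interpolating hL0).
split; last first.
  move=> A /aP[V [u [hB ->]]]; exists (coxeter_map u).
  exact: (coxeter_iso hn hL0 hB).
split.
- by split; [exact: lattice_complex|exact: lattice_thick].
- move=> A /aP[V [u [hB ->]]]; split.
  + apply: flag_complexS; exact: (latts_lattice hn hL0 hB).
  + exact: (apartment_complex hn hL0 hB).
  + exact: (apartment_thin hn hL0 hB).
  + exact: (apartment_chamber hn hL0 hB).
- move=> _ _ /DP[V hV ->] /DP[V' hV' ->].
  have [u [hB hV'u]] := common_apartment hn hL0 hV hV'.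
  exists (flag_complex (mflag (latts u))); split; first by apply/aP; exists V, u.
    exists (range V) => //; exact: tchain_mflag (basis_tchain hn hB).
  by exists (range V') => //; exact: tchain_mflag hV'u.
- move=> A A' /aP[V [u [hB ->]]] /aP[V' [u' [hB' ->]]].
  exact: (apartment_iso hn hL0 hB hB').
Qed.
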